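(* Let $\alpha\in(1/3,1/2)$, $T>0$, $\mathbf w\in G\Omega_\alpha([0,T],\mathbb R^d)$ and $[a,b]\subset[0,T]$. Let $\mathcal M$ be a compact foliated space and let $V_0,\dots,V_d$ be leafwise $C^3$ vector fields on $\mathcal M$. Then for every $m\in\mathcal M$ there exists a unique solution $(x_t)_{t\in[a,b]}$ to the RDE $$dx_t=\sum_{i=1}^dV_i(x_t)\,dw^i_t+V_0(x_t)\,dt$$ on $[a,b]$ driven by $\mathbf w$ with $x_a=m$. Moreover, if $\mathbf w$ is the natural lift of some $w\in C_0^{1-\mathrm{Hld}}([0,T],\mathbb R^d)$, then this unique solution coincides with the solution of the corresponding ODE in the Riemann–Stieltjes sense.
   Context: **Leafwise regularity.** Let $W_1,W_2$ be topological spaces and $U\subset\mathbb R^p\times W_1$ open, with points $(y,z)$. A function $f:U\to\mathbb R^d$ is of class $C_L^k$ if $f(\cdot,z)$ is $C^k$ for each $z$ and all $\partial_y^\beta f$ with $|\beta|\le k$ are continuous on $U$. A map $f:U\to V$, $V\subset\mathbb R^d\times W_2$ open, is of class $C_L^k$ if it is locally of the form $f(y,z)=(f_1(y,z),f_2(z))$ with $f_1$ of class $C_L^k$ and $f_2$ continuous; leafwise smooth means of class $C_L^k$ for all $k$. **Foliated spaces.** Let $\mathcal M,\mathcal Z$ be locally compact, separable, metrizable spaces. $\mathcal M$ is a $p$-dimensional foliated space (modelled transversely on $\mathcal Z$) if it has an open cover $\{U_\alpha\}$ and homeomorphisms $\varphi_\alpha:U_\alpha\to B_{\alpha,1}\times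 B_{\alpha,2}$, $B_{\alpha,1}\subset\mathbb R^p$ connected open, $B_{\alpha,2}\subset\mathcal Z$ open, with leafwise smooth transition maps. The $(U_\alpha,\varphi_\alpha)$ are foliated charts; sets $\varphi_\alpha^{-1}(B_{\alpha,1}\times\{z\})$ are plaques. The atlas is assumed regular: locally finite; each $\overline{U_\alpha}$ is a compact subset of a foliated chart $(W_\alpha,\psi_\alpha)$ with $\varphi_\alpha=\psi_\alpha|_{U_\alpha}$; each plaque of $U_\alpha$ meets at most one plaque of $\overline{U_\beta}$. The leaf $\mathcal L_m$ through $m$ is the set of $x$ for which there are plaques $P_1,\dots,P_n$ with $m\in P_1$, $x\in P_n$, $P_i\cap P_{i+1}\ne\emptyset$; leaves are smooth $p$-manifolds. A leafwise $C^k$ vector field is a map $V:m\mapsto V(m)\in T_m(\mathcal L_m)$ whose components with respect to $\partial/\partial y^1,\dots,\partial/\partial y^p$ are of class $C_L^k$ in every foliated chart. $C_L^k(\mathcal M)$ is the set of real functions on $\mathcal M$ of class $C_L^k$ in every chart (leafwise $C^k$-functions). **Rough paths.** $\Omega_\alpha([0,T],\mathbb R^d)$ is the set of continuous maps $\mathbf w=(\mathbf w^1,\mathbf w^2)$ from $\triangle_T=\{0\le s\le t\le T\}$ to $\mathbb R^d\oplus(\mathbb R^d\otimes\mathbb R^d)$ with $\mathbf w^1_{s,t}=\mathbf w^1_{s,u}+\mathbf w^1_{u,t}$, $\mathbf w^2_{s,t}=\mathbf w^2_{s,u}+\mathbf w^2_{u,t}+\mathbf w^1_{s,u}\otimes\mathbf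 w^1_{u,t}$ for $s\le u\le t$ and $\|\mathbf w^i\|_{i\alpha}=\sup_{s<t}|\mathbf w^i_{s,t}|/(t-s)^{i\alpha}<\infty$, $i=1,2$; metric $\mathrm d_\alpha(\mathbf w,\hat{\mathbf w})=\max_{i=1,2}\|\mathbf w^i-\hat{\mathbf w}^i\|_{i\alpha}$. $C_0^{1-\mathrm{Hld}}([0,T],\mathbb R^d)$ is the set of Lipschitz paths with $w_0=0$; the natural lift $\mathbf L(w)$ is $\mathbf w^1_{s,t}=w_t-w_s$, $\mathbf w^2_{s,t}=\int_s^t(w_u-w_s)\otimes dw_u$. $G\Omega_\alpha([0,T],\mathbb R^d)$ is the $\mathrm d_\alpha$-closure of $\mathbf L(C_0^{1-\mathrm{Hld}}([0,T],\mathbb R^d))$. Components are written $\mathbf w^{1,i}$, $\mathbf w^{2,jk}$. **RDE on $\mathcal M$.** $x\in C([a,b],\mathcal M)$ is a solution of the RDE with initial condition $m$ if $x_a=m$ and for every leafwise $C^3$-function $f$ on $\mathcal M$ there is a constant $C$ (which may depend on $f,[a,b],\mathbf w,x,V_i$ but not on $(s,t)$) such that for all $a\le s\le t\le b$ $$\Big|f(x_t)-f(x_s)-\sum_{i=1}^dV_if(x_s)\mathbf w^{1,i}_{s,t}-\sum_{j,k=1}^dV_jV_kf(x_s)\mathbf w^{2,jk}_{s,t}-V_0f(x_s)(t-s)\Big|\le C|t-s|^{3\alpha}.$$ For Lipschitz $w$, a continuous path $x$ with $x_a=m$ solves the corresponding ODE in the Riemann–Stieltjes sense if $f(x_t)-f(x_s)=\sum_i\int_s^tV_if(x_u)\,dw^i_u+\int_s^tV_0f(x_u)\,du$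 for all leafwise $C^3$-functions $f$ and all $a\le s\le t\le b$. *)

(* Defs.v *)
From HB Require Import structures.
From mathcomp Require Import all_boot all_order all_algebra.
From mathcomp Require Import all_classical all_reals all_analysis.

Set Implicit Arguments.
Unset Strict Implicit.
Unset Printing Implicit Defensive.

Import Order.TTheory GRing.Theory Num.Theory.
Import numFieldNormedType.Exports.

Local Open Scope classical_set_scope.
Local Open Scope ring_scope.

Section leafwise_regularity.
Context {R : realType} {p : nat}.

Definition partial {W : topologicalType} {E : normedModType R} (i : 'I_p)
    (f : 'rV[R]_p * W -> E) (q : 'rV[R]_p * W) : E :=
  'D_(delta_mx 0 i) (fun y => f (y, q.2)) q.1.

(* Words in 'I_p replace multi-indices: iter_partial [:: i1; ...; ir] f is
   d_{i1} ... d_{ir} f.  Once all words of length at most k give continuous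
   functions, the order of the letters is irrelevant. *)
Definition iter_partial {W : topologicalType} {E : normedModType R}
    (s : seq 'I_p) (f : 'rV[R]_p * W -> E) : 'rV[R]_p * W -> E :=
  foldr partial f s.

(* U is meant to be open.  Only the values of f on U matter.  Joint continuity
   of the iterated partials implies their continuity on every slice, so that
   each f(., z) is of class C^k. *)
Definition CL {W : topologicalType} {E : normedModType R} (k : nat)
    (U : set ('rV[R]_p * W)) (f : 'rV[R]_p * W -> E) : Prop :=
  (forall (s : seq 'I_p) (i : 'I_p) q, (size s < k)%N -> U q ->
     derivable (fun y => iter_partial s f (y, q.2)) q.1 (delta_mx 0 i)) /\
  (forall (s : seq 'I_p) q, (size s <= k)%N -> U q ->
     {for q, continuous (iter_partial s f)}).

Definition CL_map {d : nat} {W1 W2 : topologicalType} (k : nat)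
    (U : set ('rV[R]_p * W1)) (f : 'rV[R]_p * W1 -> 'rV[R]_d * W2) : Prop :=
  forall q, U q ->
    exists (N : set ('rV[R]_p * W1)) (f1 : 'rV[R]_p * W1 -> 'rV[R]_d)
           (f2 : W1 -> W2),
      [/\ open N, N q & N `<=` U] /\
      [/\ CL k N f1,
          (forall z, (snd @` N) z -> {for z, continuous f2}) &
          (forall q', N q' -> f q' = (f1 q', f2 q'.2))].

Definition leafwise_smooth {d : nat} {W1 W2 : topologicalType}
    (U : set ('rV[R]_p * W1)) (f : 'rV[R]_p * W1 -> 'rV[R]_d * W2) : Prop :=
  forall k, CL_map k U f.

End leafwise_regularity.

Definition separable (X : topologicalType) : Prop :=
  exists2 D : set X, countable D & dense D.

(* A homeomorphism chart_map : chart_dom -> chart_B1 x chart_B2 with inverse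
   chart_inv; both are total functions, with arbitrary values outside these
   sets. *)
Record chart (R : realType) (p : nat) (M Z : topologicalType) := Chart {
  chart_dom : set M ;
  chart_B1 : set 'rV[R]_p ;
  chart_B2 : set Z ;
  chart_map : M -> 'rV[R]_p * Z ;
  chart_inv : 'rV[R]_p * Z -> M ;
  chart_dom_open : open chart_dom ;
  chart_B1_open : open chart_B1 ;
  chart_B1_connected : connected chart_B1 ;
  chart_B2_open : open chart_B2 ;
  chart_map_in : forall x,
    chart_dom x -> (chart_B1 `*` chart_B2) (chart_map x) ;
  chart_inv_in : forall q,
    (chart_B1 `*` chart_B2) q -> chart_dom (chart_inv q) ;
  chart_mapK : forall x, chart_dom x -> chart_inv (chart_map x) = x ;
  chart_invK : forall q,
    (chart_B1 `*` chart_B2) q -> chart_map (chart_inv q) = q ;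
  chart_map_continuous : {within chart_dom, continuous chart_map} ;
  chart_inv_continuous : {within chart_B1 `*` chart_B2, continuous chart_inv} }.

Section atlases.
Context {R : realType} {p : nat} {M Z : topologicalType}.
Implicit Types (c : chart R p M Z).

Definition chart_image c : set ('rV[R]_p * Z) := chart_B1 c `*` chart_B2 c.

Definition transition_dom c c' : set ('rV[R]_p * Z) :=
  chart_image c `&` [set q | chart_dom c' (chart_inv c q)].

Definition transition c c' : 'rV[R]_p * Z -> 'rV[R]_p * Z :=
  fun q => chart_map c' (chart_inv c q).

Definition smooth_transition c c' : Prop :=
  leafwise_smooth (transition_dom c c') (transition c c').

Definition foliated_atlas (I : Type) (A : I -> chart R p M Z) : Prop :=
  (forall x, exists i, chart_dom (A i) x) /\
  (forall i j, smooth_transition (A i) (A j)).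

Definition foliated_chart (I : Type) (A : I -> chart R p M Z) c : Prop :=
  forall i, smooth_transition c (A i) /\ smooth_transition (A i) c.

(* For D = chart_dom c this is the plaque of c at height z, i.e. the preimage
   of chart_B1 c x {z}.  For D the closure of a smaller chart domain contained in
   chart_dom c it is a plaque of that closure. *)
Definition plaque c (D : set M) (z : Z) : set M :=
  D `&` [set x | (chart_map c x).2 = z].

Definition regular_atlas (I : Type) (A : I -> chart R p M Z) : Prop :=
  (forall x : M, exists2 N, nbhs x N &
     finite_set [set i | chart_dom (A i) `&` N !=set0]) /\
  exists W : I -> chart R p M Z,
    [/\ (forall i, foliated_chart A (W i)),
        (forall i, compact (closure (chart_dom (A i)))),
        (forall i, closure (chart_dom (A i)) `<=` chart_dom (W i)),
        (forall i x, chart_dom (A i) x ->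
           chart_map (A i) x = chart_map (W i) x) &
        (forall i j z z1 z2,
           let P := plaque (A i) (chart_dom (A i)) z in
           let Q := plaque (W j) (closure (chart_dom (A j))) in
           P `&` Q z1 !=set0 -> P `&` Q z2 !=set0 -> Q z1 = Q z2)].

End atlases.

(* Metrizability of M and Z is expressed by metricType; the metric itself is
   never used, only its topology. *)
Record foliated_space (R : realType) (p : nat) (M Z : metricType R) :=
  FoliatedSpace {
    fs_index : Type ;
    atlas : fs_index -> chart R p M Z ;
    fs_locally_compact : locally_compact [set: M] ;
    fs_separable : separable M ;
    fs_transverse_locally_compact : locally_compact [set: Z] ;
    fs_transverse_separable : separable Z ;
    fs_atlas : foliated_atlas atlas ;
    fs_regular : regular_atlas atlas }.

Section foliated_calculus.
Context {R : realType} {p : nat} {M Z : metricType R}.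
Variable F : foliated_space p M Z.

Definition CL_fun (k : nat) (f : M -> R) : Prop :=
  forall i : fs_index F, CL k (chart_image (atlas i))
    (fun q => f (chart_inv (atlas i) q) : R^o).

(* The tangent space at m of the leaf through m.  The charts of the leaf near m
   are the plaques through m, with the coordinates y of the foliated charts
   around m, so that a tangent vector is a family of components (one vector of
   R^p per chart around m) transforming by the Jacobian matrices
   of the leafwise changes of coordinates.  The components in charts not
   containing m are set to 0. *)
Record tangent (m : M) := Tangent {
  tcomp : fs_index F -> 'rV[R]_p ;
  tcomp_out : forall i, ~ chart_dom (atlas i) m -> tcomp i = 0 ;
  tcomp_jacobian : forall i j,
    chart_dom (atlas i) m -> chart_dom (atlas j) m -> forall l : 'I_p,
    tcomp j 0 l = \sum_(k < p) tcomp i 0 k *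
      partial k (fun q => (transition (atlas i) (atlas j) q).1 0 l : R^o)
              (chart_map (atlas i) m) }.

Definition vector_field := forall m : M, tangent m.

Definition CL_vector_field (k : nat) (V : vector_field) : Prop :=
  forall i : fs_index F, CL k (chart_image (atlas i))
    (fun q => tcomp (V (chart_inv (atlas i) q)) i).

Definition chart_at (m : M) : fs_index F := projT1 (cid ((fs_atlas F).1 m)).

(* V f.  For f of class C_L^1 the value does not depend on the choice of the
   chart around m. *)
Definition vf_apply (V : vector_field) (f : M -> R) (m : M) : R :=
  let i := chart_at m in
  \sum_(k < p) tcomp (V m) i 0 k *
    partial k (fun q => f (chart_inv (atlas i) q) : R^o)
            (chart_map (atlas i) m).

End foliated_calculus.

Section riemann_stieltjes.
Context {R : realType}.

(* The sum associated with the partition s <= t_1 < ... < t_n given by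
   s :: pts (see itv_partition) and the tags xi. *)
Definition RS_sum (f g : R -> R) (s : R) (pts : seq R) (xi : nat -> R) : R :=
  \sum_(i < size pts) f (xi i) * (g (nth s pts i) - g (nth s (s :: pts) i)).

Definition is_RS_integral (f g : R -> R) (s t I : R) : Prop :=
  forall e, 0 < e -> exists2 delta, 0 < delta &
    forall (pts : seq R) (xi : nat -> R),
      itv_partition s t pts ->
      (forall i, (i < size pts)%N ->
         nth s pts i - nth s (s :: pts) i < delta /\
         nth s (s :: pts) i <= xi i <= nth s pts i) ->
      `|RS_sum f g s pts xi - I| < e.

(* The integral of f dg over [s, t], and 0 if it does not exist. *)
Definition RS_integral (f g : R -> R) (s t : R) : R :=
  xget 0 [set I | is_RS_integral f g s t I].

End riemann_stieltjes.

Section rough_paths.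
Context {R : realType} {d : nat}.

Definition simplex (T : R) : set (R * R) :=
  [set st | [/\ 0 <= st.1, st.1 <= st.2 & st.2 <= T]].

Definition holder_norm {E : normedModType R} (T gamma : R) (u : R * R -> E) :
    \bar R :=
  ereal_sup [set (`|u st| / (st.2 - st.1) `^ gamma)%:E |
             st in simplex T `&` [set st | st.1 < st.2]].

(* R^d (x) R^d is identified with d x d matrices, u (x) v with the matrix of
   entries u^j v^k.  The norms are the library's (maximum) norms. *)
Definition tensor (u v : 'rV[R]_d) : 'M[R]_d := u^T *m v.

(* Elements of Omega_alpha are represented by total functions on R * R of which
   only the restriction to the simplex is meaningful. *)
Notation two_level := (R * R -> 'rV[R]_d * 'M[R]_d).

Definition rough_path (alpha T : R) (w : two_level) : Prop :=
  [/\ {within simplex T, continuous w},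
      (forall s u t, 0 <= s -> s <= u -> u <= t -> t <= T ->
         (w (s, t)).1 = (w (s, u)).1 + (w (u, t)).1 /\
         (w (s, t)).2 = (w (s, u)).2 + (w (u, t)).2
                        + tensor (w (s, u)).1 (w (u, t)).1),
      (holder_norm T alpha (fun st => (w st).1) < +oo)%E &
      (holder_norm T (2 * alpha) (fun st => (w st).2) < +oo)%E].

Definition rough_dist (alpha T : R) (w w' : two_level) : \bar R :=
  maxe (holder_norm T alpha (fun st => (w st).1 - (w' st).1))
       (holder_norm T (2 * alpha) (fun st => (w st).2 - (w' st).2)).

(* C_0^{1-Hld}([0, T], R^d) *)
Definition lipschitz_path (T : R) (v : R -> 'rV[R]_d) : Prop :=
  v 0 = 0 /\ [lipschitz (v : R^o -> 'rV[R]_d) t | t in `[0, T]%classic].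

Definition natural_lift (v : R -> 'rV[R]_d) : two_level :=
  fun st => (v st.2 - v st.1,
    \matrix_(j, k) RS_integral (fun u => (v u - v st.1) 0 j)
                               (fun u => v u 0 k) st.1 st.2).

(* G Omega_alpha([0, T], R^d) *)
Definition geometric_rough_path (alpha T : R) (w : two_level) : Prop :=
  rough_path alpha T w /\
  forall e : R, 0 < e ->
    exists2 v, lipschitz_path T v &
               (rough_dist alpha T w (natural_lift v) < e%:E)%E.

End rough_paths.

Section differential_equations.
Context {R : realType} {p d : nat} {M Z : metricType R}.
Variable F : foliated_space p M Z.
Variables (V0 : vector_field F) (V : 'I_d -> vector_field F).

Definition rde_solution (alpha : R) (w : R * R -> 'rV[R]_d * 'M[R]_d)
    (a b : R) (m : M) (x : R -> M) : Prop :=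
  [/\ {within `[a, b]%classic, continuous x}, x a = m &
      forall f : M -> R, CL_fun F 3 f ->
        exists C : R, forall s t, a <= s -> s <= t -> t <= b ->
          `| f (x t) - f (x s)
             - \sum_(i < d) vf_apply (V i) f (x s) * (w (s, t)).1 0 i
             - \sum_(j < d) \sum_(k < d)
                 vf_apply (V j) (vf_apply (V k) f) (x s) * (w (s, t)).2 j k
             - vf_apply V0 f (x s) * (t - s) |
          <= C * `|t - s| `^ (3 * alpha)].

(* The dt integral is the Riemann integral, i.e. the Riemann-Stieltjes integral
   against the identity. *)
Definition ode_solution (v : R -> 'rV[R]_d) (a b : R) (m : M) (x : R -> M) :
    Prop :=
  [/\ {within `[a, b]%classic, continuous x}, x a = m &
      forall f : M -> R, CL_fun F 3 f ->
        forall s t, a <= s -> s <= t -> t <= b ->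
          f (x t) - f (x s) =
            \sum_(i < d) RS_integral (fun u => vf_apply (V i) f (x u))
                                     (fun u => v u 0 i) s t
            + RS_integral (fun u => vf_apply V0 f (x u)) id s t].

End differential_equations.

(* Main.v *)
(* In a foliated chart the transverse coordinate of a solution is constant:
   bump(x) d(z0, z(x)) is a test function whose derivatives along the leaves
   vanish near the starting point, so the expansion bounds its increments by
   C |t - s|^(3 alpha) with 3 alpha > 1.  Testing with bump times a coordinate
   shows that, on the plaque, a solution y satisfies
   |y_t - mu_st(y_s)| <= L |t - s|^(3 alpha), where mu_st is Davie's
   second-order Euler step.  As mu_ut o mu_su - mu_st is itself of order
   3 alpha, also in Lipschitz norm, a sewing argument shows that two such paths
   with the same starting point agree.

   For existence, the schemes built from mu on finite partitions satisfy this
   estimate uniformly, and so does their limit along an ultrafilter.  By Taylor's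
   formula and the symmetry relation of geometric rough paths the limit satisfies
   the expansion for every C^3 function; compactness of M makes the time of
   existence uniform, and the pieces are concatenated.

   For a Lipschitz driver w^2 is of order 2 and the integrals are approximated by
   one-point Riemann sums to order 1 + alpha > 3 alpha, so that solutions of the RDE
   solve the ODE, and solutions of the ODE satisfy the same local estimate
   |y_t - mu_st(y_s)| <= L |t - s|^(3 alpha). *)
Require Import Defs.
From HB Require Import structures.
From mathcomp Require Import all_boot all_order all_algebra.
From mathcomp Require Import all_classical all_reals all_analysis.
From mathcomp Require Import ring lra.
Set Implicit Arguments.
Unset Strict Implicit.
Unset Printing Implicit Defensive.
Import Order.TTheory GRing.Theory Num.Theory.
Import numFieldNormedType.Exports.
Local Open Scope classical_set_scope.
Local Open Scope ring_scope.

(** * Sewing *)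

(** The vector fields are C^3 along the leaves but only continuous across them, so no estimate can
    compare two plaques. All estimates are therefore made at one fixed height, and constancy of the
    height has to be extracted from the test functions, which may depend on the height in any
    continuous way. Test functions live on all of M, so a function given in a chart must be cut off
    by a bump before the equation can be tested with it. Orders are counted by a single number eta,
    a multiple of (t - s)^alpha: first-level weights are O(eta), second-level ones O(eta^2), and the
    drift weight t - s joins the second level because 2 alpha < 1. Chen's relation cancels the
    defect of the Davie step up to second order. What is left is O(eta^3), and 3 alpha > 1 makes
    halving an interval a contraction. For uniqueness the defect must in addition be Lipschitz in
    the starting point: this compares Taylor remainders of the coefficients at two base points,
    which consumes their third derivatives and the symmetry of the second ones. *)

Section powers.
Context {R : realType}.
Implicit Types x y r s : R.

Lemma le_powR x y r : 0 <= r -> 0 <= x -> x <= y -> x `^ r <= y `^ r.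
Proof.
by move=> r0 x0 xy; apply: ge0_ler_powR => //; rewrite nnegrE//; exact: le_trans xy.
Qed.

Lemma powR_half x r : 0 <= x -> (x / 2) `^ r = 2^-1 `^ r * x `^ r.
Proof. by move=> x0; rewrite mulrC powRM. Qed.

(** Each half of an interval carries the factor 2^(-r), and the two halves together still contract.
    Every sewing argument below closes through this inequality. *)
Lemma half_powR_lt r : 1 < r -> 2 * 2^-1 `^ r < 1 :> R.
Proof.
move=> r1.
have -> : 2^-1 `^ r = 2^-1 * 2^-1 `^ (r - 1) :> R by rewrite mulr_powRB1//; lra.
rewrite mulrA divff ?mul1r//.
rewrite -powR_inv1// -powRrM /powR ifF; last by apply/eqP; lra.
by rewrite expR_lt1 mulN1r mulNr oppr_lt0 mulr_gt0 ?ln_gt0//; lra.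
Qed.
End powers.

Section discrete_sewing.
Context {R : realType} {E : normedModType R}.
(** Two radii occur because scheme points stay within [r] of [y0], while one further step of size at
    most [m <= r] may reach [2 * r]. [LK] is the recursion for the error constant: two halves, one
    of them transported twice by [mu], plus one defect and one transported defect. [mLr] closes the
    bootstrap that keeps the scheme within [r]. *)
Variables (mu : R -> R -> E -> E) (y0 : E) (s0 t0 theta e K m r L : R).
Hypotheses (theta0 : 0 <= theta) (e0 : 0 <= e) (K0 : 0 <= K) (L0 : 0 <= L).
Hypothesis m0 : 0 <= m.
Hypothesis mu_id : forall s y, mu s s y = y.
Hypothesis mu_bound : forall s t y, s0 <= s -> s <= t -> t <= t0 ->
  `|y - y0| <= 2 * r -> `|mu s t y - y| <= m.
Hypothesis mu_lip : forall s t y y', s0 <= s -> s <= t -> t <= t0 ->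
  `|y - y0| <= 2 * r -> `|y' - y0| <= 2 * r ->
  `|mu s t y - mu s t y'| <= (1 + e) * `|y - y'|.
Hypothesis mu_defect : forall s u t y, s0 <= s -> s <= u -> u <= t -> t <= t0 ->
  `|y - y0| <= r -> `|mu u t (mu s u y) - mu s t y| <= K * (t - s) `^ theta.
Hypothesis LK : L * 2^-1 `^ theta * (1 + (1 + e) ^+ 2) + (2 + e) * K <= L.
Hypothesis mLr : m + L * (t0 - s0) `^ theta <= r.

Let mr : m <= r.
Proof. by apply: le_trans mLr; rewrite lerDl mulr_ge0// powR_ge0. Qed.

Let r0 : 0 <= r. Proof. exact: le_trans mr. Qed.

Let mu_near s t y : s0 <= s -> s <= t -> t <= t0 -> `|y - y0| <= r ->
  `|mu s t y - y0| <= 2 * r.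
Proof.
move=> ss st tt yr; have -> : mu s t y - y0 = (mu s t y - y) + (y - y0) by rewrite addrA subrK.
apply: le_trans (ler_normD _ _) _.
have := mu_bound ss st tt (y := y); rewrite (le_trans yr) ?ler_peMl//; last by lra.
by move=> /(_ isT); have := mr; move: yr; lra.
Qed.

Variables (tau : nat -> R) (y : nat -> E).
Hypothesis tau_ge : forall k, s0 <= tau k.

(** [k] is the last index before the midpoint. The middle interval from [k] to [k.+1] may be long,
    which is harmless: for the scheme it is a single step and carries no error of its own. *)
Let split_index n i j : (i < j <= n)%N ->
  (forall k, (k < n)%N -> tau k <= tau k.+1) ->
  exists k, [/\ (i <= k < j)%N, tau i <= tau k,  tau k.+1 <= tau j,
    tau k - tau i <= (tau j - tau i) / 2 & tau j - tau k.+1 <= (tau j - tau i) / 2].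
Proof.
move=> /andP[ij jn] mono.
have le : forall k l, (k <= l <= n)%N -> tau k <= tau l.
  move=> k l /andP[kl ln]; elim: l kl ln => [|l IH]; first by rewrite leqn0 => /eqP->.
  rewrite leq_eqVlt => /orP[/eqP->//|kl ln].
  by apply: le_trans (IH kl (ltnW ln)) _; apply: mono.
have ile : tau i <= tau j by apply: le; rewrite (ltnW ij).
pose P k := (i <= k < j)%N && (tau k - tau i <= (tau j - tau i) / 2).
have exP : exists k, P k by exists i; rewrite /P leqnn ij/= subrr divr_ge0// subr_ge0.
have bP k : P k -> (k <= j)%N by move=> /andP[/andP[_ /ltnW]].
case: (ex_maxnP exP bP) => k /andP[kij kh] kmax.
have /andP[ik kj] := kij.
exists k; split => //.
- by apply: le; rewrite ik (leq_trans (ltnW kj)).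
- by apply: le; rewrite kj jn.
- move: kj; rewrite leq_eqVlt => /orP[/eqP->|kj]; first by rewrite subrr divr_ge0// subr_ge0.
  have : ~~ P k.+1 by apply/negP => /kmax; rewrite ltnn.
  by rewrite /P (leq_trans ik)//= kj/= -ltNge; lra.
Qed.

(* Davie's induction: the time interval is split near its midpoint, where each
   half carries a factor 2^-theta, with 2 * 2^-theta < 1. *)
Let scheme_estimate n :
  (forall k, (k < n)%N -> tau k <= tau k.+1) -> tau n <= t0 ->
  (forall k, (k < n)%N -> y k.+1 = mu (tau k) (tau k.+1) (y k)) ->
  (forall k, (k < n)%N -> `|y k - y0| <= r) -> `|y n - y0| <= 2 * r ->
  forall i j, (i <= j <= n)%N ->
  `|y j - mu (tau i) (tau j) (y i)| <= L * (tau j - tau i) `^ theta.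
Proof.
move=> mono taun ys ball balln i j.
have ball2 k : (k <= n)%N -> `|y k - y0| <= 2 * r.
  rewrite leq_eqVlt => /orP[/eqP->//|/ball/le_trans]; apply.
  by rewrite ler_peMl//; lra.
have taule : forall k, (k <= n)%N -> tau k <= t0.
  move=> k kn; apply: le_trans taun.
  elim: n kn mono {ys ball balln ball2} => [|l IH]; first by rewrite leqn0 => /eqP->.
  rewrite leq_eqVlt => /orP[/eqP->//|kl mono].
  by apply: le_trans (mono _ (leqnn _)); apply: IH => // k' /ltnW/mono.
have [N] := ubnP (j - i)%N; elim: N i j => // N IH i j jiN /andP[].
rewrite leq_eqVlt => /orP[/eqP<- _|ij jn].
  by rewrite mu_id subrr normr0 mulr_ge0// powR_ge0.
have [k [/andP[ik kj] tik tkj h1 h2]] := split_index (n := n) (introT andP (conj ij jn)) mono.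
have kn := leq_trans kj jn.
have tkk := mono _ kn.
have h0 : 0 <= tau j - tau i by rewrite subr_ge0 (le_trans tik)// (le_trans tkk).
set h := tau j - tau i in h0 h1 h2 *.
have := LK; set q := 2^-1 `^ theta => LK'.
have I1 : `|y k - mu (tau i) (tau k) (y i)| <= L * (q * h `^ theta).
  have kiN : (k - i < N)%N.
    by rewrite -ltnS (leq_trans _ jiN)// ltnS ltn_sub2r.
  apply: le_trans (IH i k kiN _) _; first by rewrite ik ltnW.
  by rewrite ler_wpM2l// -powR_half// le_powR// subr_ge0.
have I2 : `|y j - mu (tau k.+1) (tau j) (y k.+1)| <= L * (q * h `^ theta).
  have kiN : (j - k.+1 < N)%N.
    by rewrite -ltnS (leq_trans _ jiN)// ltnS ltn_sub2l.
  apply: le_trans (IH k.+1 j kiN _) _; first by rewrite kj.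
  by rewrite ler_wpM2l// -powR_half// le_powR// subr_ge0.
have bi : `|y i - y0| <= r by apply: ball; exact: leq_trans jn.
have hle : forall s t, tau i <= s -> s <= t -> t <= tau j -> (t - s) `^ theta <= h `^ theta.
  by move=> s t ? ? ?; rewrite le_powR ?subr_ge0// /h; lra.
have tj := taule _ jn; have tk := taule _ kn; have tk' := taule _ (ltnW kn).
(* The middle step is exact. Its image is compared with the same step started from the one-step
   value at [tau k] (Lipschitz bound), then with the single step from [tau i] (defect). *)
have I3 : `|mu (tau k) (tau k.+1) (y k) - mu (tau k) (tau k.+1) (mu (tau i) (tau k) (y i))|
   <= (1 + e) * (L * (q * h `^ theta)).
  apply: le_trans (mu_lip _ _ _ _ _) _ => //; [exact: ball2 (ltnW kn)|exact: mu_near|].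
  by rewrite ler_wpM2l// addr_ge0.
have I4 : `|mu (tau k) (tau k.+1) (mu (tau i) (tau k) (y i)) - mu (tau i) (tau k.+1) (y i)|
    <= K * h `^ theta.
  apply: le_trans (mu_defect _ _ _ _ _) _ => //.
  by rewrite ler_wpM2l// hle// (le_trans tik).
have I5 : `|mu (tau k.+1) (tau j) (mu (tau i) (tau k.+1) (y i)) - mu (tau i) (tau j) (y i)|
    <= K * h `^ theta.
  apply: le_trans (mu_defect _ _ _ _ _) _ => //.
  exact: le_trans tkk.
have I6 : `|y k.+1 - mu (tau i) (tau k.+1) (y i)| <=
    (1 + e) * (L * (q * h `^ theta)) + K * h `^ theta.
  rewrite ys//; apply: le_trans (ler_distD (mu (tau k) (tau k.+1) (mu (tau i) (tau k) (y i))) _ _) _.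
  exact: lerD.
have I7 : `|mu (tau k.+1) (tau j) (y k.+1) - mu (tau k.+1) (tau j) (mu (tau i) (tau k.+1) (y i))|
    <= (1 + e) * ((1 + e) * (L * (q * h `^ theta)) + K * h `^ theta).
  apply: le_trans (mu_lip _ _ _ _ _) _ => //; [exact: ball2|apply: mu_near => //; exact: le_trans tkk|].
  by rewrite ler_wpM2l// addr_ge0.
apply: le_trans (ler_distD (mu (tau k.+1) (tau j) (y k.+1)) _ _) _.
apply: le_trans (lerD (lexx _) (ler_distD (mu (tau k.+1) (tau j) (mu (tau i) (tau k.+1) (y i))) _ _)) _.
apply: le_trans (lerD I2 (lerD I7 I5)) _.
rewrite [leLHS](_ : _ = (L * q * (1 + (1 + e) ^+ 2) + (2 + e) * K) * h `^ theta); last by ring.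
by rewrite ler_wpM2r// powR_ge0.
Qed.

(** Strong induction: if all earlier points lie within [r], the last one lies within [2 * r], so the
    error estimate applies up to [n]; taken from index 0 it brings the last point back within [r] by
    [mLr]. *)
Lemma scheme_bound n : y 0%N = y0 ->
  (forall k, (k < n)%N -> tau k <= tau k.+1) -> tau n <= t0 ->
  (forall k, (k < n)%N -> y k.+1 = mu (tau k) (tau k.+1) (y k)) ->
  `|y n - y0| <= r /\ forall i j, (i <= j <= n)%N ->
  `|y j - mu (tau i) (tau j) (y i)| <= L * (tau j - tau i) `^ theta.
Proof.
move=> y00; elim/ltn_ind: n => n IH mono taun ys.
have ball k : (k < n)%N -> `|y k - y0| <= r.
  move=> kn; apply: (IH k kn _ _ _).1.
  - by move=> l lk; apply: mono; exact: ltn_trans kn.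
  - apply: le_trans taun; elim: n kn mono {IH ys} => // l IH.
    rewrite ltnS leq_eqVlt => /orP[/eqP->|kl] mono; first exact: mono.
    by apply: le_trans (mono l _) => //; apply: IH => // l' /ltnW/mono.
  - by move=> l lk; apply: ys; exact: ltn_trans kn.
have taule : tau 0%N <= tau n.
  by elim: n mono {IH ys ball taun} => // l IH mono; apply: le_trans (mono l _) => //; apply: IH => ? /ltnW/mono.
have balln : `|y n - y0| <= 2 * r.
  case: n mono taun ys ball {IH taule} => [_ _ _ _|n mono taun ys ball].
    by rewrite y00 subrr normr0 mulr_ge0.
  by rewrite ys//; apply: mu_near => //; [exact: mono|exact: ball].
have est := scheme_estimate mono taun ys ball balln.
split => //.
have := est 0%N n (leqnn n); rewrite y00 => est0.
rewrite -[y n](subrK (mu (tau 0%N) (tau n) y0)) -addrA.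
apply: le_trans (ler_normD _ _) _; apply: le_trans mLr; rewrite [leLHS]addrC lerD//.
  by apply: mu_bound => //; rewrite subrr normr0 mulr_ge0.
by apply: le_trans est0 _; rewrite ler_wpM2l// le_powR ?subr_ge0// lerB.
Qed.

End discrete_sewing.

Lemma ultra_fmap (T U : Type) (f : T -> U) (F : set_system T) :
  UltraFilter F -> UltraFilter (f @ F).
Proof.
move=> FU; split; first exact: fmap_proper_filter.
move=> H HF sub; rewrite eqEsubset; split => // A HA.
case: (in_ultra_setVsetC (f @^-1` A) FU) => // FC.
have /filter_ex[x []//] : H (A `&` ~` A) by apply: filterI => //; exact: sub.
Qed.

Section scheme_limit.
Context {R : realType} {E : normedModType R}.

(** The scheme runs through the points of [pi] in the interval and is interpolated by one step of
    [mu] from the last partition point. The error estimate is claimed only from times [s] in [pi];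
    refinement will reach every [s]. *)
Lemma sorted_scheme (mu : R -> R -> E -> E) (y0 : E) (s0 t0 theta e K m r L : R) :
  0 <= theta -> 0 <= e -> 0 <= K -> 0 <= L -> 0 <= m ->
  (forall s y, mu s s y = y) ->
  (forall s t y, s0 <= s -> s <= t -> t <= t0 ->
    `|y - y0| <= 2 * r -> `|mu s t y - y| <= m) ->
  (forall s t y y', s0 <= s -> s <= t -> t <= t0 ->
    `|y - y0| <= 2 * r -> `|y' - y0| <= 2 * r ->
    `|mu s t y - mu s t y'| <= (1 + e) * `|y - y'|) ->
  (forall s u t y, s0 <= s -> s <= u -> u <= t -> t <= t0 ->
    `|y - y0| <= r -> `|mu u t (mu s u y) - mu s t y| <= K * (t - s) `^ theta) ->
  L * 2^-1 `^ theta * (1 + (1 + e) ^+ 2) + (2 + e) * K <= L ->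
  m + L * (t0 - s0) `^ theta <= r -> s0 <= t0 ->
  forall pi : seq R, exists y : R -> E, [/\ y s0 = y0,
    forall t, s0 <= t -> t <= t0 -> `|y t - y0| <= r &
    forall s t, s \in pi -> s0 <= s -> s <= t -> t <= t0 ->
      `|y t - mu s t (y s)| <= L * (t - s) `^ theta].
Proof.
move=> theta0 e0 K0 L0 m0 mu_id mu_bound mu_lip mu_defect LK mLr s0t0 pi.
pose P := sort <=%O (undup (s0 :: [seq u <- pi | s0 <= u <= t0])).
have Psort : sorted <%O P by rewrite sort_lt_sorted undup_uniq.
have Pin u : (u \in P) = (u == s0) || ((s0 <= u <= t0) && (u \in pi)).
  by rewrite mem_sort mem_undup inE mem_filter.
have Pge u : u \in P -> s0 <= u <= t0.
  by rewrite Pin => /orP[/eqP->|/andP[]//]; rewrite lexx.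
(* The default value [t0] keeps [tau k] above [s0] beyond the end of the partition. *)
pose tau := nth t0 P.
have tau_ge k : s0 <= tau k.
  have [kP|kP] := ltnP k (size P); last by rewrite /tau nth_default.
  by have /andP[] := Pge _ (mem_nth t0 kP).
have tau_in u : u \in P -> exists2 i, (i < size P)%N & tau i = u.
  by move=> uP; exists (index u P); rewrite ?index_mem// /tau nth_index.
have lt_tau i j : (i < size P)%N -> (j < size P)%N -> (tau i < tau j) = (i < j)%N.
  by move=> iP jP; rewrite /tau lt_sorted_ltn_nth.
have [i0 i0P tau_i0] : exists2 i, (i < size P)%N & tau i = s0.
  by apply: tau_in; rewrite Pin eqxx.
have P0 : (0 < size P)%N by exact: leq_ltn_trans i0P.
have tau0 : tau 0%N = s0.
  apply/eqP; rewrite eq_le tau_ge andbT -tau_i0 leNgt lt_tau//.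
pose fix Y k := if k is k'.+1 then mu (tau k') (tau k'.+1) (Y k') else y0.
(* Index of the last partition point not after [t]. If no point exceeds [t], then [find] returns the
   size and the predecessor is the last index. *)
pose kk t := (find (fun u => t < u) P).-1.
have find_gt0 t : s0 <= t -> (0 < find (fun u => (t < u)%O) P)%N.
  move=> st; rewrite lt0n; apply/eqP => f0.
  have hs : has (fun u => (t < u)%O) P by rewrite has_find f0.
  by have := nth_find t0 hs; rewrite f0 -/(tau 0%N) tau0 ltNge st.
have kkP t : s0 <= t -> (kk t < size P)%N.
  by move=> /find_gt0 f0; rewrite /kk prednK// find_size.
have kkle t : s0 <= t -> tau (kk t) <= t.
  move=> st; have := @before_find _ t0 (fun u => (t < u)%O) P (kk t).
  by rewrite /kk prednK ?find_gt0// leqnn => /(_ isT) /negbT; rewrite -leNgt.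
have kkge t i : s0 <= t -> (i < size P)%N -> tau i <= t -> (i <= kk t)%N.
  move=> st iP it; rewrite /kk -ltnS prednK ?find_gt0// ltnNge; apply/negP => fi.
  have hs : has (fun u => (t < u)%O) P by rewrite has_find (leq_ltn_trans fi).
  have := nth_find t0 hs; rewrite ltNge => /negP; apply; apply: le_trans it.
  by rewrite leNgt lt_tau// -?leqNgt// (leq_ltn_trans fi).
have kktau i : (i < size P)%N -> kk (tau i) = i.
  move=> iP; apply/eqP; rewrite eqn_leq kkge// andbT leqNgt -lt_tau ?kkP//.
  by rewrite -leNgt kkle.
pose y t := mu (tau (kk t)) t (Y (kk t)).
have ytau i : (i < size P)%N -> y (tau i) = Y i by move=> iP; rewrite /y kktau.
have key t : s0 <= t -> t <= t0 -> `|y t - y0| <= r /\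
    forall i, (i <= kk t)%N -> `|y t - mu (tau i) t (Y i)| <= L * (t - tau i) `^ theta.
  move=> st tt.
  pose k := kk t.
  (* Appending [t] as a final partition point turns the interpolated value [y t] into a value of a
     scheme, so that [scheme_bound] covers it. *)
  pose tau' j := if (j <= k)%N then tau j else t.
  pose Y' j := if (j <= k)%N then Y j else y t.
  have tau'_ge j : s0 <= tau' j by rewrite /tau'; case: ifP.
  have := @scheme_bound R E mu y0 s0 t0 theta e K m r L theta0 e0 K0 L0 m0 mu_id
    mu_bound mu_lip mu_defect LK mLr tau' Y' tau'_ge k.+1.
  rewrite /tau' /Y' /= ltnn => /(_ erefl)[|//||[h1 h2]].
  - move=> l; rewrite ltnS => lk; rewrite lk; case: ifP => [lk'|_].
      have kP := kkP t st.
      by rewrite ltW// lt_tau ?ltnSn ?(leq_ltn_trans lk' kP) ?(leq_ltn_trans lk kP).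
    apply: le_trans (kkle _ st); rewrite leNgt lt_tau -?leqNgt ?kkP//.
    exact: leq_ltn_trans lk (kkP t st).
  - move=> l; rewrite ltnS => lk; rewrite lk; case: ifP => // lk'.
    suff -> : l = k by [].
    by apply/eqP; rewrite eqn_leq lk leqNgt lk'.
  - split => // i ik; have := h2 i k.+1; rewrite leqnn (leqW ik) => /(_ isT).
    by rewrite ik ltnn.
exists y; split.
- by rewrite -tau0 ytau.
- by move=> t st tt; have [] := key t st tt.
- move=> s t spi ss st tt.
  have [i iP is_] : exists2 i, (i < size P)%N & tau i = s.
    by apply: tau_in; rewrite Pin spi ss (le_trans st)// orbT.
  have [_] := key t (le_trans ss st) tt.
  move=> /(_ i); rewrite -is_ ytau//; apply; apply: kkge => //.
    exact: le_trans st.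
  by rewrite is_.
Qed.

(* No uniqueness is needed: the schemes converge along an ultrafilter that
   eventually contains every given partition point. *)
Theorem sewing_limit (mu : R -> R -> E -> E) (y0 : E) (s0 t0 theta e K m r L : R) :
  compact [set y : E | `|y - y0| <= r] ->
  0 <= theta -> 0 <= e -> 0 <= K -> 0 <= L -> 0 <= m ->
  (forall s y, mu s s y = y) ->
  (forall s t y, s0 <= s -> s <= t -> t <= t0 ->
    `|y - y0| <= 2 * r -> `|mu s t y - y| <= m) ->
  (forall s t y y', s0 <= s -> s <= t -> t <= t0 ->
    `|y - y0| <= 2 * r -> `|y' - y0| <= 2 * r ->
    `|mu s t y - mu s t y'| <= (1 + e) * `|y - y'|) ->
  (forall s u t y, s0 <= s -> s <= u -> u <= t -> t <= t0 ->
    `|y - y0| <= r -> `|mu u t (mu s u y) - mu s t y| <= K * (t - s) `^ theta) ->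
  L * 2^-1 `^ theta * (1 + (1 + e) ^+ 2) + (2 + e) * K <= L ->
  m + L * (t0 - s0) `^ theta <= r -> s0 <= t0 ->
  exists y : R -> E, [/\ y s0 = y0,
    forall t, s0 <= t -> t <= t0 -> `|y t - y0| <= r &
    forall s t, s0 <= s -> s <= t -> t <= t0 ->
      `|y t - mu s t (y s)| <= L * (t - s) `^ theta].
Proof.
move=> cpt theta0 e0 K0 L0 m0 mu_id mu_bound mu_lip mu_defect LK mLr s0t0.
have [Y HY] := choice (sorted_scheme theta0 e0 K0 L0 m0 mu_id mu_bound mu_lip
  mu_defect LK mLr s0t0).
have r0 : 0 <= r.
  by apply: le_trans mLr; rewrite addr_ge0// mulr_ge0// powR_ge0.
pose F := filter_from [set: seq R] (fun S => [set pi : seq R | {subset S <= pi}]).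
have FF : ProperFilter F.
  apply: filter_from_proper.
    apply: filter_from_filter; first by exists [::].
    move=> S S' _ _; exists (S ++ S') => // pi sub; split => u us; apply: sub;
      by rewrite mem_cat us ?orbT.
  by move=> S _; exists S.
have [G [GU FG]] := ultraFilterLemma FF.
have Gmem u : G [set pi : seq R | u \in pi].
  by apply: FG; exists [:: u] => // pi /= ->//; rewrite mem_head.
have lims t : exists l : E, (s0 <= t <= t0 -> Y pi t @[pi --> G] --> l).
  have [/andP[st tt]|_] := boolP (s0 <= t <= t0); last by exists y0.
  move: cpt; rewrite compact_ultra => /(_ _ (ultra_fmap (Y ^~ t) GU))[|l [_ cl]].
    by apply: (@filterE _ G) => pi /=; have [_ + _] := HY pi; exact.
  by exists l.
have [y yl] := choice lims.
have GP : ProperFilter G by exact: ultra_proper.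
have near_y eps t : 0 < eps -> s0 <= t -> t <= t0 -> \forall pi \near G, `|y t - Y pi t| < eps.
  move=> eps0 st tt.
  have /cvgrPdist_lt/(_ _ eps0) := yl t (introT andP (conj st tt)).
  exact.
have yball t : s0 <= t -> t <= t0 -> `|y t - y0| <= r.
  move=> st tt; apply/ler_addgt0Pr => eps eps0.
  have [pi h] := filter_ex (near_y eps t eps0 st tt).
  rewrite [leRHS]addrC; apply: le_trans (ler_distD (Y pi t) _ _) _; apply: lerD; first exact: ltW.
  by have [_ + _] := HY pi; exact.
exists y; split => //.
  apply/eqP; rewrite -subr_eq0 -normr_le0; apply/ler_addgt0Pr => eps eps0; rewrite add0r.
  have [pi] := filter_ex (near_y eps s0 eps0 (lexx _) s0t0).
  by have [-> _ _ /ltW] := HY pi.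
move=> s t ss st tt.
have ss' := le_trans ss st; have tt' := le_trans st tt.
apply/ler_addgt0Pr => eps eps0.
(* The approximation error enters once at time [t] and, through the Lipschitz constant of [mu],
   [1 + e] times at time [s]. *)
have d0 : 0 < eps / (2 + e) by rewrite divr_gt0// ltr_wpDr.
have [pi [[h1 h2] h3]] := filter_ex (filterI (filterI (near_y _ t d0 ss' tt)
   (near_y _ s d0 ss tt')) (Gmem s)).
have [_ bY eY] := HY pi.
apply: le_trans (ler_distD (Y pi t) _ _) _.
apply: le_trans (lerD (ltW h1) (ler_distD (mu s t (Y pi s)) _ _)) _.
have I1 := eY s t h3 ss st tt.
have I2 : `|mu s t (Y pi s) - mu s t (y s)| <= (1 + e) * (eps / (2 + e)).
  apply: le_trans (mu_lip _ _ _ _ _ _ _ _ _) _ => //.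
  - by apply: le_trans (bY s ss tt') _; rewrite ler_peMl//; lra.
  - by apply: le_trans (yball s ss tt') _; rewrite ler_peMl//; lra.
  - by rewrite ler_wpM2l ?addr_ge0// distrC ltW.
apply: le_trans (lerD (lexx _) (lerD I1 I2)) _.
suff : eps / (2 + e) + (1 + e) * (eps / (2 + e)) = eps by lra.
by field; rewrite gt_eqF// ltr_wpDr.
Qed.

End scheme_limit.

Lemma subrACA (V : zmodType) (a b c d : V) : a - b - (c - d) = a - c - (b - d).
Proof. by rewrite !opprB addrACA [RHS]addrACA [- b - c]addrC. Qed.
(** Two telescoping sums subtracted term by term. In [sewing_unique] the three groups are the
    remainders on the second half, the transport of the remainders on the first half, and the
    difference of the defects. *)
Lemma subr_telescope (V : zmodType) (a b c f a' b' c' f' : V) :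
  a - f - (a' - f') =
  (a - b - (a' - b')) + ((b - c - (b' - c')) + (c - f - (c' - f'))).
Proof.
rewrite (subrACA a f) (subrACA a b) (subrACA b c) (subrACA c f).
have tele (x y z t : V) : x - t = (x - y) + ((y - z) + (z - t)).
  by rewrite [y - z + _]addrA subrK addrA subrK.
exact: tele.
Qed.

Section sewing_unique.
Context {R : realType} {E : normedModType R}.

(* If A (t - s)^theta bounds the difference of the two remainders, then so does
   kappa A (t - s)^theta for a fixed kappa < 1; iterate from A = 2 L. *)
Theorem sewing_unique (mu : R -> R -> E -> E) (x y : R -> E) (D : set E)
    (s0 t0 theta e K L : R) :
  0 <= theta -> 0 <= e -> 0 <= K -> 0 <= L ->
  (forall s y, mu s s y = y) ->
  x s0 = y s0 ->
  (forall s t, s0 <= s -> s <= t -> t <= t0 ->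
     [/\ D (x s), D (mu s t (x s)), D (y s) & D (mu s t (y s))]) ->
  (forall s t, s0 <= s -> s <= t -> t <= t0 ->
     `|x t - mu s t (x s)| <= L * (t - s) `^ theta) ->
  (forall s t, s0 <= s -> s <= t -> t <= t0 ->
     `|y t - mu s t (y s)| <= L * (t - s) `^ theta) ->
  (forall s t a b, s0 <= s -> s <= t -> t <= t0 -> D a -> D b ->
     `|mu s t a - mu s t b| <= (1 + e) * `|a - b|) ->
  (forall s t a b c d, s0 <= s -> s <= t -> t <= t0 -> D a -> D b -> D c -> D d ->
     `|mu s t a - mu s t b - (mu s t c - mu s t d)| <=
     (1 + e) * `|a - b - (c - d)| + K * (`|a - b| + `|c - d|) * `|b - d|) ->
  (forall s u t, s0 <= s -> s <= u -> u <= t -> t <= t0 ->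
     `|(mu u t (mu s u (x s)) - mu s t (x s)) -
       (mu u t (mu s u (y s)) - mu s t (y s))| <= K * (t - s) `^ theta * `|x s - y s|) ->
  (2 + e) * 2^-1 `^ theta + (2 * K * L * (1 + e) + K) * (t0 - s0) `^ theta < 1 ->
  forall t, s0 <= t -> t <= t0 -> x t = y t.
Proof.
move=> theta0 e0 K0 L0 mu_id xy0 inD xsol ysol mu_lip mu_4 mu_def kappa1.
set q := 2^-1 `^ theta in kappa1 *; set H := (t0 - s0) `^ theta in kappa1 *.
set kappa := (X in X < 1) in kappa1.
have q0 : 0 <= q by exact: powR_ge0.
have H0 : 0 <= H by exact: powR_ge0.
have kappa0 : 0 <= kappa by rewrite !(addr_ge0, mulr_ge0).
pose Rm s t := x t - mu s t (x s) - (y t - mu s t (y s)).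
pose P A := 0 <= A /\ forall s t, s0 <= s -> s <= t -> t <= t0 -> `|Rm s t| <= A * (t - s) `^ theta.
have dist A : P A -> forall t, s0 <= t -> t <= t0 -> `|x t - y t| <= A * (t - s0) `^ theta.
  move=> [A0 PA] t st tt; have := PA s0 t (lexx _) st tt.
  by rewrite /Rm xy0 opprB addrA subrK.
have improve A : P A -> P (kappa * A).
  move=> PA; have [A0 PA'] := PA; split; first by rewrite mulr_ge0.
  move=> s t ss st tt; pose u := (s + t) / 2.
  have su : s <= u by rewrite /u; lra.
  have ut : u <= t by rewrite /u; lra.
  have uh1 : u - s = (t - s) / 2 by rewrite /u; field.
  have uh2 : t - u = (t - s) / 2 by rewrite /u; field.
  have ut0 := le_trans ut tt; have su0 := le_trans ss su.
  have h0 : 0 <= t - s by rewrite subr_ge0.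
  have [Dx Dmx Dy Dmy] := inD s u ss su ut0.
  have [Dxu _ Dyu _] := inD u u su0 (lexx u) ut0.
  pose h := (t - s) `^ theta.
  have hh : 0 <= h by exact: powR_ge0.
  have d : `|x s - y s| <= A * H.
    apply: le_trans (dist A PA s ss (le_trans st tt)) _; rewrite ler_wpM2l// le_powR ?subr_ge0// lerB//.
    exact: le_trans tt.
  have E1 := PA' u t su0 ut tt; have E2 := PA' s u ss su ut0.
  rewrite uh2 powR_half// -/q in E1; rewrite uh1 powR_half// -/q in E2.
  have X1 := xsol s u ss su ut0; have Y1 := ysol s u ss su ut0.
  rewrite uh1 powR_half// -/q in X1; rewrite uh1 powR_half// -/q in Y1.
  have E3 := mu_4 u t _ _ _ _ su0 ut tt Dxu Dmx Dyu Dmy.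
  have E4 := mu_def s u t ss su ut tt.
  have E5 := mu_lip s u _ _ ss su ut0 Dx Dy.
  have qh : q * h <= h.
    have one : 1 `^ theta = 1 :> R by rewrite powR1.
    by rewrite ler_piMl// /q -[leRHS]one le_powR//; lra.
  (* The quadratic term of [mu_4] is the product of one-step remainders, of size [L * h], with the
     distance of the two paths after one step, for which the current bound [A] is available. *)
  have B3 : K * (`|x u - mu s u (x s)| + `|y u - mu s u (y s)|) * `|mu s u (x s) - mu s u (y s)|
     <= K * (2 * L * h) * ((1 + e) * (A * H)).
    apply: ler_pM => //.
    - by rewrite mulr_ge0// addr_ge0.
    - rewrite ler_wpM2l//; have := ler_wpM2l L0 qh; move: X1 Y1; rewrite -/h; lra.
    - by apply: le_trans E5 _; rewrite ler_wpM2l// addr_ge0.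
  have -> : Rm s t = Rm u t +
     ((mu u t (x u) - mu u t (mu s u (x s)) - (mu u t (y u) - mu u t (mu s u (y s)))) +
      (mu u t (mu s u (x s)) - mu s t (x s) - (mu u t (mu s u (y s)) - mu s t (y s)))).
    exact: subr_telescope.
  have E3' := le_trans E3 (lerD (ler_wpM2l (addr_ge0 ler01 e0) E2) B3).
  apply: le_trans (ler_normD _ _) _.
  apply: le_trans (lerD E1 (le_trans (ler_normD _ _) (lerD E3' E4))) _.
  have Kd : K * (t - s) `^ theta * `|x s - y s| <= K * h * (A * H).
    by rewrite ler_wpM2l// mulr_ge0.
  apply: le_trans (lerD (lexx _) (lerD (lexx _) Kd)) _.
  by rewrite -/h le_eqVlt; apply/orP; left; apply/eqP; rewrite /kappa; ring.
have P0 : P (2 * L).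
  split; first by rewrite mulr_ge0.
  move=> s t ss st tt; apply: le_trans (ler_normB _ _) _.
  by have := xsol s t ss st tt; have := ysol s t ss st tt; lra.
have Pn n : P (kappa ^+ n * (2 * L)).
  by elim: n => [|n IH]; rewrite ?mul1r// exprS -mulrA; exact: improve.
move=> t st tt; apply/eqP; rewrite -subr_eq0 -normr_le0.
have cv : (fun n => geometric (2 * L * H) kappa n) @ \oo --> (0 : R).
  by apply: cvg_geometric; rewrite ger0_norm.
apply/ler_addgt0Pr => eps eps0; rewrite add0r.
have /cvgrPdist_lt/(_ _ eps0)/filter_ex[n] := cv.
rewrite /= add0r normrN ger0_norm; last by rewrite !(mulr_ge0, exprn_ge0).
move=> /ltW; apply: le_trans; apply: le_trans (dist _ (Pn n) t st tt) _.
rewrite [leRHS](_ : _ = kappa ^+ n * (2 * L) * H); last by ring.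
by rewrite ler_wpM2l ?(mulr_ge0, exprn_ge0)// le_powR ?subr_ge0// lerB.
Qed.

End sewing_unique.

(** * Riemann-Stieltjes integrals and geometric rough paths *)

Section riemann_stieltjes_theory.
Context {R : realType}.
Implicit Types (F g : R -> R).

(** [z] and a constant path both follow the trivial flow [mu s t y = y], so this is an instance of
    uniqueness, with contraction factor 2 * 2^(-theta). *)
Lemma additive_constant (E : normedModType R) (z : R -> E) (s0 t0 theta C : R) : 1 < theta -> 0 <= C ->
  (forall s t, s0 <= s -> s <= t -> t <= t0 -> `|z t - z s| <= C * (t - s) `^ theta) ->
  forall s t, s0 <= s -> s <= t -> t <= t0 -> z t = z s.
Proof.
move=> th1 C0 zC s t ss st tt.
have := @sewing_unique R E (fun _ _ y => y) z (fun=> z s) setT s t theta 0 0 C.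
apply => //.
- by rewrite ltW// (lt_trans _ th1).
- by move=> u v su uv vt; apply: zC => //; [exact: le_trans su|exact: le_trans tt].
- by move=> u v *; rewrite subrr normr0 mulr_ge0// powR_ge0.
- by move=> *; rewrite addr0 mul1r.
- by move=> *; rewrite addr0 mul1r mul0r mul0r addr0.
- by move=> *; rewrite !subrr normr0 !mul0r.
- by rewrite !(mulr0, mul0r, addr0) half_powR_lt.
Qed.

Lemma itv_partition_exists (s t delta : R) : s <= t -> 0 < delta ->
  exists2 pts, itv_partition s t pts &
    forall i, (i < size pts)%N -> nth s pts i - nth s (s :: pts) i < delta.
Proof.
rewrite le_eqVlt => /orP[/eqP<-|st] d0; first by exists [::] => //; split.
pose n := (Num.truncn ((t - s) / delta)).+1.
have n0 : 0 < n%:R :> R by rewrite ltr0n.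
pose f i : R := s + (t - s) * (i%:R / n%:R).
have f0 : f 0%N = s by rewrite /f mul0r mulr0 addr0.
have fn : f n = t by rewrite /f divff ?mulr1 ?gt_eqF// addrCA subrr addr0.
pose pts := [seq f i.+1 | i <- iota 0 n].
have sz : size pts = n by rewrite size_map size_iota.
have nthE i : (i < n)%N -> nth s pts i = f i.+1.
  by move=> iN; rewrite (nth_map 0%N) ?size_iota// nth_iota// add0n.
have nthE' i : (i <= n)%N -> nth s (s :: pts) i = f i.
  by case: i => [|i] iN; [rewrite f0|rewrite /= nthE].
have step i : f i.+1 - f i = (t - s) / n%:R.
  rewrite /f -[i.+1]addn1 natrD; field; exact: lt0r_neq0.
exists pts.
- split.
    apply/(pathP s) => i; rewrite sz => iN; rewrite nthE' ?(ltnW iN)// nthE//.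
    by rewrite -subr_gt0 step divr_gt0// subr_gt0.
  rewrite -[last s pts]/(last s (s :: pts)) -nth_last -[size (s :: pts)]/(size pts).+1 sz.
  by rewrite nthE' ?fn.
- move=> i; rewrite sz => iN; rewrite nthE// nthE' ?(ltnW iN)// step.
  rewrite ltr_pdivrMr// mulrC -ltr_pdivrMr//.
  exact: truncnS_gt.
Qed.

Lemma is_RS_integral_unique F g s t I J : s <= t ->
  is_RS_integral F g s t I -> is_RS_integral F g s t J -> I = J.
Proof.
move=> st hI hJ; apply/eqP; rewrite -subr_eq0 -normr_le0.
apply/ler_addgt0Pr => e e0; rewrite add0r.
have e2 : 0 < e / 2 by rewrite divr_gt0.
have [d1 d10 h1] := hI _ e2; have [d2 d20 h2] := hJ _ e2.
have d0 : 0 < Num.min d1 d2 by rewrite lt_min d10.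
have [pts part fine] := itv_partition_exists st d0.
pose xi i := nth s (s :: pts) i.
have tag i : (i < size pts)%N -> nth s (s :: pts) i <= xi i <= nth s pts i.
  move=> ip; rewrite lexx ltW//.
  by case: part => /(pathP s)/(_ i ip).
have := h1 pts xi part; have := h2 pts xi part.
set S := RS_sum _ _ _ _ _ => H2 H1.
have {}H1 : `|S - I| < e / 2.
  by apply: H1 => i ip; split; [have := fine i ip; rewrite lt_min => /andP[]|exact: tag].
have {}H2 : `|S - J| < e / 2.
  by apply: H2 => i ip; split; [have := fine i ip; rewrite lt_min => /andP[]|exact: tag].
by rewrite (le_trans (ler_distD S _ _))// [e]splitr ltW// ltrD// distrC.
Qed.

Lemma RS_integralE F g s t I : s <= t -> is_RS_integral F g s t I ->
  RS_integral F g s t = I.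
Proof.
move=> st hI; rewrite /RS_integral; case: xgetP => [x _ /= hx|/(_ I)//].
exact: is_RS_integral_unique hI.
Qed.

(** Errors that are uniformly small relative to the length of the subinterval add up over a
    partition to a small multiple of [t - s], while the increments of [y] telescope. *)
Lemma is_RS_integral_increments F g (y : R -> R) s t : s <= t ->
  (forall eta, 0 < eta -> exists2 delta, 0 < delta &
     forall u xi v, s <= u -> u <= xi -> xi <= v -> v <= t -> v - u < delta ->
       `|F xi * (g v - g u) - (y v - y u)| <= eta * (v - u)) ->
  is_RS_integral F g s t (y t - y s).
Proof.
move=> st H e e0.
(* The summand 1 admits [s = t] and makes the total error strictly smaller than [e]. *)
have eta0 : 0 < e / (t - s + 1) by rewrite divr_gt0// ltr_wpDl// subr_ge0.
have [delta d0 Hd] := H _ eta0; exists delta => // pts xi part fine.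
have partP := part.
case: part => /(pathP s) lt_pts /eqP lastt.
pose P i := nth s (s :: pts) i.
have mono i j : (i <= j <= size pts)%N -> P i <= P j.
  move=> /andP[ij jn]; elim: j ij jn => [|j IH]; first by rewrite leqn0 => /eqP->.
  rewrite leq_eqVlt => /orP[/eqP->//|ij jn].
  by apply: le_trans (IH ij (ltnW jn)) (ltW _); exact: lt_pts.
have Pn : P (size pts) = t by rewrite /P -lastt -[last s pts]/(last s (s :: pts)) -nth_last.
have tele u : \sum_(i < size pts) (u (P i.+1) - u (P i)) = u t - u s :> R.
  by rewrite -(big_mkord xpredT (fun i => u (P i.+1) - u (P i))) (telescope_sumr (u \o P))//= Pn.
rewrite /RS_sum -tele -sumrB.
apply: le_lt_trans (ler_norm_sum _ _ _) _.
apply: (@le_lt_trans _ _ (\sum_(i < size pts) e / (t - s + 1) * (P i.+1 - P i))).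
  apply: ler_sum => i _; have [fi /andP[xi1 xi2]] := fine i (ltn_ord i).
  apply: Hd => //.
  - by apply: (mono 0%N i); rewrite leq0n ltnW.
  - by rewrite -Pn; apply: (mono i.+1 (size pts)); rewrite ltn_ord /=.
rewrite -mulr_sumr (tele id)/= -mulrA gtr_pMr// mulrC ltr_pdivrMr ?ltr_wpDl ?subr_ge0//.
lra.
Qed.

(** The integral arises by sewing the flow [mu s t y = y + F s * (g t - g s)], whose defect
    [(F u - F s) * (g t - g u)] has order [1 + beta]. [L] is chosen before [F] and [g], so the
    one-point approximation is uniform over all integrands with the same constants. *)
Lemma RS_primitive (beta CF Cg : R) : 0 < beta -> 0 <= CF -> 0 <= Cg ->
  exists2 L, 0 <= L & forall F g s0 t0, s0 <= t0 ->
    (forall s t, s0 <= s -> s <= t -> t <= t0 -> `|F t - F s| <= CF * (t - s) `^ beta) ->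
    (forall s t, s0 <= s -> s <= t -> t <= t0 -> `|g t - g s| <= Cg * (t - s)) ->
    exists y : R -> R, forall s t, s0 <= s -> s <= t -> t <= t0 ->
      [/\ is_RS_integral F g s t (y t - y s), RS_integral F g s t = y t - y s &
          `|y t - y s - F s * (g t - g s)| <= L * (t - s) `^ (1 + beta)].
Proof.
move=> beta0 CF0 Cg0.
have th1 : 1 < 1 + beta by rewrite ltrDl.
have q1 := half_powR_lt th1; set q := 2^-1 `^ (1 + beta) in q1.
have q2 : 0 < 1 - 2 * q by rewrite subr_gt0.
pose K := CF * Cg; have K0 : 0 <= K by rewrite mulr_ge0.
(* Fixed point of the error recursion for an isometric flow, [2 * q * L + 2 * K = L]. *)
exists (2 * K / (1 - 2 * q)); first by rewrite divr_ge0 ?mulr_ge0// ltW.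
set L := 2 * K / _.
have L0 : 0 <= L by rewrite divr_ge0 ?mulr_ge0// ltW.
move=> F g s0 t0 st0 FH gL.
pose mu s t (y : R^o) : R^o := y + F s * (g t - g s).
have powM h : 0 <= h -> h `^ beta * h = h `^ (1 + beta).
  move=> h0; rewrite mulrC -[1 + beta]subr0 -{1}[h](powRr1 h0).
  have [->|hn0] := eqVneq h 0.
    by rewrite !powR0 ?gt_eqF ?subr0 ?mul0r//; lra.
  by rewrite subr0 powRD// hn0 implybT.
pose m := (`|F s0| + CF * (t0 - s0) `^ beta) * (Cg * (t0 - s0)).
have m0 : 0 <= m by rewrite mulr_ge0 ?addr_ge0 ?mulr_ge0 ?powR_ge0// subr_ge0.
(* The estimates for this flow hold on the whole line, so the radius may be as large as the
   bootstrap requires and the interval need not be short. *)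
pose r := m + L * (t0 - s0) `^ (1 + beta).
have [||||||y [_ _ ysol]] := @sewing_limit R R^o mu 0 s0 t0 (1 + beta) 0 K m r L _
   (ltW (lt_trans ltr01 th1)) (lexx 0) K0 L0 m0 _ _ _ _ _ (lexx _) st0.
- rewrite (_ : [set _ | _] = `[-r, r]%classic); first exact: segment_compact.
  by apply/seteqP; split => y; rewrite /= subr0 ler_norml in_itv.
- by move=> s y; rewrite /mu subrr mulr0 addr0.
- move=> s t y ss st tt _; rewrite /mu addrAC subrr add0r normrM /m ler_pM//.
    rewrite -[F s](subrK (F s0)); apply: le_trans (ler_normD _ _) _.
    rewrite addrC lerD//; apply: le_trans (FH _ _ (lexx _) ss _) _; first exact: le_trans tt.
    by rewrite ler_wpM2l// le_powR ?(ltW beta0) ?subr_ge0// lerB// (le_trans st).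
  apply: le_trans (gL _ _ ss st tt) _.
  by rewrite ler_wpM2l// lerB.
- by move=> s t y y' *; rewrite /mu opprD addrACA subrr addr0 addr0 mul1r.
- move=> s u t y ss su ut tt _.
  rewrite /mu [X in `|X|](_ : _ = (F u - F s) * (g t - g u)); last by ring.
  rewrite normrM -powM ?subr_ge0 ?(le_trans su)// mulrACA ler_pM//.
    apply: le_trans (FH _ _ ss su (le_trans ut tt)) _.
    by rewrite ler_wpM2l// le_powR ?(ltW beta0) ?subr_ge0// lerB.
  apply: le_trans (gL _ _ (le_trans ss su) ut tt) _.
  by rewrite ler_wpM2l// lerB.
- rewrite -/q addr0 expr1n /L.
  by rewrite le_eqVlt; apply/orP; left; apply/eqP; field; rewrite gt_eqF.
exists y => s t ss st tt.
have est u v : s0 <= u -> u <= v -> v <= t0 ->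
    `|y v - y u - F u * (g v - g u)| <= L * (v - u) `^ (1 + beta).
  by move=> *; rewrite -addrA -opprD; exact: ysol.
have int : is_RS_integral F g s t (y t - y s).
  apply: is_RS_integral_increments => // eta eta0.
  (* Moving the tag from [u] to [xi] costs [K] and passing to the primitive costs [L], both times (v
     - u)^(1 + beta); below this mesh the factor (v - u)^beta absorbs [K + L]. *)
  pose d := (eta / (K + L + 1)) `^ beta^-1.
  have KL : 0 < K + L + 1 by rewrite ltr_wpDl// addr_ge0.
  have d0 : 0 < d by rewrite powR_gt0// divr_gt0.
  exists d => // u xi v su uxi xiv vt vud.
  have su' := le_trans ss su; have vt' := le_trans vt tt; have uv := le_trans uxi xiv.
  have h0 : 0 <= v - u by rewrite subr_ge0.
  have E1 := est u v su' uv vt'.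
  have E2 : `|(F xi - F u) * (g v - g u)| <= K * (v - u) `^ (1 + beta).
    rewrite normrM -powM// mulrACA ler_pM//.
      apply: le_trans (FH _ _ su' uxi (le_trans xiv vt')) _.
      by rewrite ler_wpM2l// le_powR ?(ltW beta0) ?subr_ge0// lerB.
    exact: gL.
  rewrite [X in `|X|](_ : _ = (F xi - F u) * (g v - g u) - (y v - y u - F u * (g v - g u))); last by ring.
  apply: le_trans (ler_normB _ _) _; apply: le_trans (lerD E2 E1) _.
  rewrite -mulrDl -powM// mulrA ler_wpM2r//.
  have hd : (v - u) `^ beta <= eta / (K + L + 1).
    have <- : d `^ beta = eta / (K + L + 1).
      by rewrite /d -powRrM mulVf ?gt_eqF// powRr1// divr_ge0// ltW.
    by rewrite le_powR// ltW.
  apply: (@le_trans _ _ ((K + L) * (eta / (K + L + 1)))).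
    by rewrite ler_wpM2l// addr_ge0.
  by rewrite mulrA ler_pdivrMr// mulrC ler_wpM2l ?ltW//; lra.
split => //; first exact: RS_integralE.
exact: est.
Qed.

End riemann_stieltjes_theory.

Section matrix_norm.
Context {R : realType}.

Lemma norm_coord_le m n (A : 'M[R]_(m, n)) i j : `|A i j| <= `|A|.
Proof.
rewrite [leRHS]/Num.norm /= mx_normrE; apply/bigmax_geP; right.
by exists (i, j).
Qed.

Lemma mx_norm_le m n (A : 'M[R]_(m, n)) c : 0 <= c ->
  (forall i j, `|A i j| <= c) -> `|A| <= c.
Proof.
move=> c0 h; rewrite [leLHS]/Num.norm /= mx_normrE; apply/bigmax_leP.
by split => // -[i j] _; exact: h.
Qed.
End matrix_norm.

Section rough_path_theory.
Context {R : realType} {d : nat}.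
Implicit Types (v : R -> 'rV[R]_d) (w : R * R -> 'rV[R]_d * 'M[R]_d).

Lemma lipschitz_pathP T v : lipschitz_path T v ->
  exists2 k, 0 <= k & forall s t i, 0 <= s -> s <= t -> t <= T ->
    `|v t 0 i - v s 0 i| <= k * (t - s).
Proof.
move=> [_ /pinfty_ex_gt0[k k0 H]]; exists k; first exact: ltW.
move=> s t i s0 st tT.
have := H (t, s); rewrite /= !in_itv/= s0 tT (le_trans s0)//= (le_trans st)// => /(_ (conj isT isT)).
rewrite [`|t - s|]ger0_norm ?subr_ge0//; apply: le_trans.
by have := norm_coord_le (v t - v s) 0 i; rewrite !mxE.
Qed.

Lemma holder_norm_le {E : normedModType R} T gamma (u : R * R -> E) (c : R) :
  (holder_norm T gamma u <= c%:E)%E ->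
  forall s t, 0 <= s -> s < t -> t <= T -> `|u (s, t)| <= c * (t - s) `^ gamma.
Proof.
move=> h s t s0 st tT.
have P : 0 < (t - s) `^ gamma by rewrite powR_gt0// subr_gt0.
rewrite -ler_pdivrMr// -lee_fin; apply: le_trans h.
apply: ereal_sup_ubound; exists (s, t) => //=.
by split => //; split => //=; exact: ltW.
Qed.

Lemma holder_norm_bounded {E : normedModType R} T gamma (u : R * R -> E) :
  (holder_norm T gamma u < +oo)%E ->
  exists2 c, 0 <= c & forall s t, 0 <= s -> s < t -> t <= T -> `|u (s, t)| <= c * (t - s) `^ gamma.
Proof.
case E0 : (holder_norm T gamma u) => [c| |] // _.
- exists (Num.max c 0); first by rewrite le_max lexx orbT.
  move=> s t s0 st tT; apply: le_trans ((@holder_norm_le _ T gamma u c _ s t s0 st tT)) _.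
    by rewrite E0.
  by rewrite ler_wpM2r ?powR_ge0// le_max lexx.
(* The value -oo is the supremum of the empty set: there is no pair [s < t] to be bounded. *)
- exists 0 => // s t s0 st tT.
  apply: (@holder_norm_le _ T gamma u 0) => //.
  by rewrite E0 leNye.
Qed.

Lemma powR_1D1 (h : R) : 0 <= h -> h `^ (1 + 1) = h ^+ 2.
Proof. by move=> h0; rewrite -powR_mulrn. Qed.

Lemma RS_integral_lipschitz (CF Cg : R) : 0 <= CF -> 0 <= Cg ->
  exists2 L, 0 <= L & forall (F g : R -> R) s0 t0, s0 <= t0 ->
    (forall s t, s0 <= s -> s <= t -> t <= t0 -> `|F t - F s| <= CF * (t - s)) ->
    (forall s t, s0 <= s -> s <= t -> t <= t0 -> `|g t - g s| <= Cg * (t - s)) ->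
    exists y : R -> R, forall s t, s0 <= s -> s <= t -> t <= t0 ->
      [/\ is_RS_integral F g s t (y t - y s), RS_integral F g s t = y t - y s &
          `|y t - y s - F s * (g t - g s)| <= L * (t - s) ^+ 2].
Proof.
move=> CF0 Cg0; have [L L0 H] := RS_primitive ltr01 CF0 Cg0; exists L => //.
move=> F g s0 t0 st0 FL gL; have [|y Hy] := H F g s0 t0 st0 _ gL.
  by move=> s t ss st tt; rewrite powRr1 ?subr_ge0//; exact: FL.
exists y => s t ss st tt; have [? ?] := Hy s t ss st tt.
by rewrite powR_1D1// subr_ge0.
Qed.

(** The integrand [v u - v s] vanishes at [u = s], so the one-point approximation of the integral is
    zero and only its quadratic error remains. *)
Lemma lift_square_bound T v : lipschitz_path T v ->
  exists2 C, 0 <= C & forall s t j k, 0 <= s -> s <= t -> t <= T ->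
    `|(natural_lift v (s, t)).2 j k| <= C * (t - s) ^+ 2.
Proof.
move=> /lipschitz_pathP[c c0 vc].
have [L L0 H] := RS_integral_lipschitz c0 c0; exists L => // s t j k s0 st tT.
rewrite mxE /=.
have [||y Hy] := H (fun u => (v u - v s) 0 j) (fun u => v u 0 k) s t st.
- move=> u u' su uu ut; rewrite !mxE opprB addrA subrK.
  by apply: vc => //; [exact: le_trans su|exact: le_trans tT].
- by move=> u u' su uu ut; apply: vc => //; [exact: le_trans su|exact: le_trans tT].
have [_ -> ] := Hy s t (lexx s) st (lexx t).
by rewrite !mxE subrr mul0r subr0.
Qed.

(** Integration by parts. With primitives [y1] and [y2] of the two integrals, [y1 + y2 - F j * F k]
    has increments of second order: the first-order parts cancel and leave the product of two
    increments. Hence it is constant. *)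
Lemma lift_symmetric T v s t j k : lipschitz_path T v ->
  0 <= s -> s <= t -> t <= T ->
  (natural_lift v (s, t)).2 j k + (natural_lift v (s, t)).2 k j =
  (natural_lift v (s, t)).1 0 j * (natural_lift v (s, t)).1 0 k.
Proof.
move=> /lipschitz_pathP[c c0 vc] s0 st tT.
have [L L0 H] := RS_integral_lipschitz c0 c0.
rewrite !mxE /=.
have lipv i u u' : s <= u -> u <= u' -> u' <= t -> `|v u' 0 i - v u 0 i| <= c * (u' - u).
  by move=> su uu ut; apply: vc => //; [exact: le_trans su|exact: le_trans tT].
pose F i u := (v u - v s) 0 i.
have FE i u u' : F i u' - F i u = v u' 0 i - v u 0 i.
  by rewrite /F !mxE opprB addrA subrK.
have lipF i u u' : s <= u -> u <= u' -> u' <= t -> `|F i u' - F i u| <= c * (u' - u).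
  by rewrite FE; exact: lipv.
have [y1 Hy1] := H (F j) (fun u => v u 0 k) s t st (lipF j) (lipv k).
have [y2 Hy2] := H (F k) (fun u => v u 0 j) s t st (lipF k) (lipv j).
have [_ -> _] := Hy1 s t (lexx s) st (lexx t).
have [_ -> _] := Hy2 s t (lexx s) st (lexx t).
pose z u : R^o := y1 u + y2 u - F j u * F k u.
have zE : z t = z s.
  apply: (@additive_constant _ R^o z s t (1 + 1) (2 * L + c ^+ 2)); rewrite ?ltrDl//.
    by rewrite addr_ge0 ?mulr_ge0// exprn_ge0.
  move=> u u' su uu ut; rewrite powR_1D1 ?subr_ge0//.
  have [_ _] := Hy1 u u' su uu ut; have [_ _] := Hy2 u u' su uu ut.
  rewrite -(FE j) -(FE k) => E2 E1.
  have E3 : `|(F j u' - F j u) * (F k u' - F k u)| <= c ^+ 2 * (u' - u) ^+ 2.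
    rewrite normrM -exprMn expr2 ler_pM//; exact: lipF.
  rewrite [X in `|X|](_ : _ = (y1 u' - y1 u - F j u * (F k u' - F k u)) +
     (y2 u' - y2 u - F k u * (F j u' - F j u)) - (F j u' - F j u) * (F k u' - F k u)); last first.
    by rewrite /z; ring.
  apply: le_trans (ler_normB _ _) _; apply: le_trans (lerD (ler_normD _ _) (lexx _)) _.
  by move: E1 E2 E3; lra.
move: zE; rewrite /z /F !mxE !subrr mul0r; lra.
Qed.

(** In coordinates: Hölder bounds with one constant for both levels, valid also for [s = t], Chen's
    relation, and the condition that the symmetric part of the second level is half the square of
    the first. From here on the driver enters the existence and uniqueness arguments only through
    these properties. *)
Definition weakly_geometric alpha T w K := [/\ 0 <= K,
    forall s t i, 0 <= s -> s <= t -> t <= T -> `|(w (s, t)).1 0 i| <= K * (t - s) `^ alpha,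
    forall s t j k, 0 <= s -> s <= t -> t <= T ->
      `|(w (s, t)).2 j k| <= K * (t - s) `^ (2 * alpha),
    forall s u t, 0 <= s -> s <= u -> u <= t -> t <= T ->
      (forall i, (w (s, t)).1 0 i = (w (s, u)).1 0 i + (w (u, t)).1 0 i) /\
      (forall j k, (w (s, t)).2 j k = (w (s, u)).2 j k + (w (u, t)).2 j k
                        + (w (s, u)).1 0 j * (w (u, t)).1 0 k) &
    forall s t j k, 0 <= s -> s <= t -> t <= T ->
      (w (s, t)).2 j k + (w (s, t)).2 k j = (w (s, t)).1 0 j * (w (s, t)).1 0 k].

(** Only the symmetry relation needs the approximation by lifts: it holds for natural lifts and
    passes to the limit, since at fixed times both levels are controlled by the rough path
    metric. *)
Lemma geometric_rough_pathP alpha T w : 0 < alpha ->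
  geometric_rough_path alpha T w -> exists K, weakly_geometric alpha T w K.
Proof.
move=> alpha0 [[_ chen h1 h2] approx].
have chen' s u t : 0 <= s -> s <= u -> u <= t -> t <= T ->
      (forall i, (w (s, t)).1 0 i = (w (s, u)).1 0 i + (w (u, t)).1 0 i) /\
      (forall j k, (w (s, t)).2 j k = (w (s, u)).2 j k + (w (u, t)).2 j k
                        + (w (s, u)).1 0 j * (w (u, t)).1 0 k).
  move=> s0 su ut tT; have [-> ->] := chen s u t s0 su ut tT.
  by split=> [i|j k]; rewrite !mxE ?big_ord1 ?mxE.
have w1ss s i : 0 <= s -> s <= T -> (w (s, s)).1 0 i = 0.
  by move=> s0 sT; have [/(_ i) + _] := chen' s s s s0 (lexx s) (lexx s) sT; lra.
have w2ss s j k : 0 <= s -> s <= T -> (w (s, s)).2 j k = 0.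
  move=> s0 sT; have [_ /(_ j k)] := chen' s s s s0 (lexx s) (lexx s) sT.
  by rewrite !w1ss// mul0r; lra.
have [K1 K10 {}h1] := holder_norm_bounded h1.
have [K2 K20 {}h2] := holder_norm_bounded h2.
pose K := K1 + K2; have K0 : 0 <= K by rewrite addr_ge0.
have b1 s t i : 0 <= s -> s <= t -> t <= T -> `|(w (s, t)).1 0 i| <= K * (t - s) `^ alpha.
  move=> s0; rewrite le_eqVlt => /orP[/eqP<- sT|st tT].
    by rewrite w1ss// normr0 mulr_ge0// powR_ge0.
  apply: le_trans (norm_coord_le _ _ _) _; apply: le_trans (h1 s t s0 st tT) _.
  by rewrite ler_wpM2r ?powR_ge0// lerDl.
have b2 s t j k : 0 <= s -> s <= t -> t <= T -> `|(w (s, t)).2 j k| <= K * (t - s) `^ (2 * alpha).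
  move=> s0; rewrite le_eqVlt => /orP[/eqP<- sT|st tT].
    by rewrite w2ss// normr0 mulr_ge0// powR_ge0.
  apply: le_trans (norm_coord_le _ _ _) _; apply: le_trans (h2 s t s0 st tT) _.
  by rewrite ler_wpM2r ?powR_ge0// lerDr.
exists K; split => // s t j k s0; rewrite le_eqVlt => /orP[/eqP<- sT|st tT].
  by rewrite !w2ss// !w1ss// mul0r addr0.
apply/eqP; rewrite -subr_eq0 -normr_le0; apply/ler_addgt0Pr => e e0; rewrite add0r.
set p1 := (t - s) `^ alpha; set p2 := (t - s) `^ (2 * alpha).
have p10 : 0 <= p1 by exact: powR_ge0.
have p20 : 0 <= p2 by exact: powR_ge0.
(* If both levels are approximated to relative precision [e'], the two sides of the relation differ
   by at most [e' * B]. The bound [e' <= 1] is used for the product of two first-level errors. *)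
pose B := 2 * p2 + p1 * (2 * (K * p1) + p1) + 1.
have B0 : 0 < B by rewrite ltr_wpDl// !(addr_ge0, mulr_ge0).
pose e' := Num.min 1 (e / B).
have e'0 : 0 < e' by rewrite lt_min ltr01 divr_gt0.
have e'1 : e' <= 1 by rewrite ge_min lexx.
have e'B : e' * B <= e by rewrite -ler_pdivlMr// ge_min lexx orbT.
have [v vT] := approx e' e'0.
rewrite /rough_dist gt_max => /andP[/ltW d1 /ltW d2].
have E1 i : `|(w (s, t)).1 0 i - (natural_lift v (s, t)).1 0 i| <= e' * p1.
  have := holder_norm_le d1 s0 st tT; apply: le_trans.
  by have := norm_coord_le ((w (s, t)).1 - (natural_lift v (s, t)).1) 0 i; rewrite !mxE.
have E2 j' k' : `|(w (s, t)).2 j' k' - (natural_lift v (s, t)).2 j' k'| <= e' * p2.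
  have := holder_norm_le d2 s0 st tT; apply: le_trans.
  by have := norm_coord_le ((w (s, t)).2 - (natural_lift v (s, t)).2) j' k'; rewrite !mxE.
have S := lift_symmetric j k vT s0 (ltW st) tT.
have := E1 j; have := E1 k; have := E2 j k; have := E2 k j.
have := b1 s t j s0 (ltW st) tT; have := b1 s t k s0 (ltW st) tT; rewrite -/p1.
set wj := (w (s, t)).1 0 j; set wk := (w (s, t)).1 0 k.
move: S; set lj := (natural_lift v (s, t)).1 0 j; set lk := (natural_lift v (s, t)).1 0 k.
set ljk := (natural_lift _ _).2 j k; set lkj := (natural_lift _ _).2 k j.
set wjk := (w (s, t)).2 j k; set wkj := (w (s, t)).2 k j.
move=> S bk bj F1 F2 F3 F4.
rewrite [X in `|X|](_ : _ = (wjk - ljk) + (wkj - lkj) - (wj * (wk - lk) + wk * (wj - lj) -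
   (wk - lk) * (wj - lj))); last by move: S; nra.
have G1 : `|wj * (wk - lk)| <= K * p1 * (e' * p1) by rewrite normrM ler_pM.
have G2 : `|wk * (wj - lj)| <= K * p1 * (e' * p1) by rewrite normrM ler_pM.
have G3 : `|(wk - lk) * (wj - lj)| <= e' * p1 * p1.
  rewrite normrM ler_pM//; apply: le_trans F4 _.
  by rewrite ler_piMl.
apply: le_trans (ler_normB _ _) _; apply: le_trans (lerD (ler_normD _ _) (ler_normB _ _)) _.
apply: le_trans (lerD (lexx _) (lerD (ler_normD _ _) (lexx _))) _.
apply: le_trans e'B; rewrite /B.
apply: le_trans (lerD (lerD F2 F1) (lerD (lerD G1 G2) G3)) _.
suff -> : e' * (2 * p2 + p1 * (2 * (K * p1) + p1) + 1) =
   e' * p2 + e' * p2 + (K * p1 * (e' * p1) + K * p1 * (e' * p1) + e' * p1 * p1) + e' by rewrite lerDl ltW.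
ring.
Qed.

End rough_path_theory.

(** * Calculus of leafwise differentiable functions *)

Section one_variable.
Context {R : realType}.

Lemma mean_value_inequality (f df : R -> R^o) (b c K : R) : 0 <= b ->
  (forall t, 0 <= t -> t <= b -> is_derive (t : R) 1 f (df t)) ->
  (forall t, 0 <= t -> t <= b -> `|df t - c| <= K) ->
  `|f b - f 0 - c * b| <= K * b.
Proof.
move=> b0 fdf dfK.
have [||x xb ->] := @MVT_segment R f df 0 b b0.
- by move=> x; rewrite in_itv/= => /andP[x0 xb]; apply: fdf; exact: ltW.
- apply: derivable_within_continuous => x; rewrite in_itv/= => /andP[x0 xb].
  by have [] := fdf x x0 xb.
- rewrite subr0 -mulrBl normrM [`|b|]ger0_norm// ler_wpM2r//.
  by move: xb; rewrite in_itv/= => /andP[x0 xb]; exact: dfK.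
Qed.

(** The mean value inequality is applied to [f'] and then to [f] minus the parabola
    [c / 2 * t ^+ 2]. Allowing any [c] near the values of [f''] makes it a third-order Taylor bound
    once [f''] is Lipschitz. *)
Lemma taylor1_inequality (f f' f'' : R -> R^o) (c K : R) :
  (forall t, 0 <= t -> t <= 1 -> is_derive (t : R) 1 f (f' t)) ->
  (forall t, 0 <= t -> t <= 1 -> is_derive (t : R) 1 f' (f'' t)) ->
  (forall t, 0 <= t -> t <= 1 -> `|f'' t - c| <= K) ->
  `|f 1 - f 0 - f' 0 - c / 2| <= K.
Proof.
move=> d1 d2 h.
have K0 : 0 <= K by apply: le_trans (h 0 _ _).
have E1 t : 0 <= t -> t <= 1 -> `|f' t - f' 0 - c * t| <= K * t.
  move=> t0 t1; apply: (@mean_value_inequality f' f'') => // s s0 st.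
    by apply: d2 => //; exact: le_trans t1.
  by apply: h => //; exact: le_trans t1.
pose g t : R^o := f t - c / 2 * t ^+ 2.
have dg t : 0 <= t -> t <= 1 -> is_derive (t : R) 1 g (f' t - c * t).
  move=> t0 t1; have H := d1 t t0 t1.
  by apply: is_derive_eq; rewrite /GRing.scale /=; field.
have := @mean_value_inequality g (fun t => f' t - c * t) 1 (f' 0) K ler01 dg.
rewrite /g expr0n /= expr1n !mulr1 mulr0 subr0.
move=> H; rewrite (_ : _ - _ = f 1 - c / 2 - f 0 - f' 0); last by ring.
apply: H => t t0 t1; rewrite addrAC; apply: le_trans (E1 t t0 t1) _.
by rewrite ler_piMr.
Qed.

Lemma is_derive_line (V W : normedModType R) (f : V -> W) (x v : V) (t : R) :
  derivable f (x + t *: v) v ->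
  is_derive t 1 (fun t : R => f (x + t *: v)) ('D_v f (x + t *: v)).
Proof.
move=> df; have E : (fun h => h^-1 *: (((fun t : R => f (x + t *: v)) \o shift t) (h *: 1) - f (x + t *: v)))
  = (fun h => h^-1 *: ((f \o shift (x + t *: v)) (h *: v) - f (x + t *: v))).
  by apply/funext => h /=; rewrite [h *: 1]mulr1 scalerDl addrCA.
by split; rewrite /derivable/derive E.
Qed.

Lemma is_derive_at_line (V W : normedModType R) (f : V -> W) (x v : V) (df : W) :
  is_derive (0 : R) 1 (fun t : R => f (x + t *: v)) df -> is_derive x v f df.
Proof.
have E : (fun h => h^-1 *: (((fun t : R => f (x + t *: v)) \o shift 0) (h *: 1) - f (x + 0 *: v)))
  = (fun h => h^-1 *: ((f \o shift x) (h *: v) - f x)).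
  by apply/funext => h /=; rewrite [h *: 1]mulr1 scale0r !addr0 (addrC x).
by move=> [d1 d2]; split; rewrite /derivable/derive -E.
Qed.

End one_variable.

(** * Chain rule on slices *)

Section chain_rule.
Context {R : realType} {p : nat} {W : topologicalType}.
Implicit Types (U : set ('rV[R]_p * W)) (f g : 'rV[R]_p * W -> R^o).

Lemma slice_nbhs (P : set ('rV[R]_p * W)) (q : 'rV[R]_p * W) :
  nbhs q P -> \forall y \near q.1, P (y, q.2).
Proof.
case: q => y z [[A B] /= [yA zB] sub].
by apply: filterS yA => y' Ay'; apply: sub; split => //=; exact: nbhs_singleton.
Qed.

(** Continuous partial derivatives give differentiability on the slice: the increment is added one
    coordinate at a time and the mean value inequality is used on each leg. *)
Lemma partial_expansion U g q : open U -> CL 1 U g -> U q ->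
  forall e, 0 < e -> exists2 delta, 0 < delta & forall v : 'rV[R]_p, `|v| < delta ->
    `|g (q.1 + v, q.2) - g q - \sum_l v 0 l * partial l g q| <= e * `|v|.
Proof.
case: q => y z oU [dg cg] qU e e0 /=.
(* There are [p] legs; [p.+1] avoids a division by zero when the leaves are points. *)
pose e' := e / p.+1%:R.
have e'0 : 0 < e' by rewrite divr_gt0// ltr0n.
have : \forall y' \near y, U (y', z) /\ forall l, `|partial l g (y', z) - partial l g (y, z)| <= e'.
  have n1 := @slice_nbhs U (y, z) (open_nbhs_nbhs (conj oU qU)).
  have n2 : \forall y' \near y, forall l, `|partial l g (y', z) - partial l g (y, z)| <= e'.
    apply: (@filter_forall _ _ (fun l y' => `|partial l g (y', z) - partial l g (y, z)| <= e') (nbhs y)) => l.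
    apply: (@slice_nbhs (fun q => `|partial l g q - partial l g (y, z)| <= e') (y, z)).
    have /cvgrPdist_le/(_ _ e'0) := cg [:: l] (y, z) (ltnSn 0) qU.
    by apply: filterS => q' /=; rewrite distrC.
  exact: filterS2 n1 n2.
move=> /nbhs_ballP[delta /= d0 near_y]; exists delta => // v vd.
pose tr m : 'rV[R]_p := \row_j (if (j < m)%N then v 0 j else 0).
have tr0 : tr 0%N = 0 by apply/rowP => j; rewrite !mxE.
have trp : tr p = v by apply/rowP => j; rewrite !mxE ltn_ord.
have vj j : `|v 0 j| <= `|v| by exact: norm_coord_le.
have step (l : 'I_p) : `|g (y + tr l.+1, z) - g (y + tr l, z) - v 0 l * partial l g (y, z)| <= e' * `|v|.
  pose c t := y + tr l + (v 0 l * t) *: delta_mx 0 l.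
  have cU t : 0 <= t -> t <= 1 -> `|c t - y| < delta.
    move=> t0 t1; apply: le_lt_trans vd.
    rewrite /c addrAC [y + _]addrC addrK; apply: mx_norm_le => // i j.
    rewrite ord1 !mxE eqxx -val_eqE /=; case: (ltngtP j l) => [jl|jl|_].
    - by rewrite mulr0 addr0.
    - by rewrite mulr0 addr0 normr0.
    - by rewrite add0r mulr1 normrM [`|t|]ger0_norm// (le_trans _ (vj l))// ler_piMr.
  have -> : g (y + tr l.+1, z) = g (c 1, z).
    congr (g (_, z)); rewrite /c -addrA; congr (_ + _); apply/rowP => j; rewrite !mxE eqxx -val_eqE/= ltnS.
    by case: (ltngtP j l) => [jl|jl|/val_inj->]; rewrite ?mulr0 ?addr0// !mulr1 add0r.
  have -> : g (y + tr l, z) = g (c 0, z) by rewrite /c mulr0 scale0r addr0.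
  rewrite -[X in _ - X]mulr1 -[leRHS]mulr1.
  apply: (@mean_value_inequality _ (fun t => g (c t, z)) (fun t => v 0 l * partial l g (c t, z))) => // t t0 t1.
    have [Uc _] : U (c t, z) /\ forall l, `|partial l g (c t, z) - partial l g (y, z)| <= e'.
      by apply: near_y; rewrite mx_norm_ball /ball_/= distrC; exact: cU.
    have D := @dg [::] l (c t, z) isT Uc.
    have L := @is_derive_line R _ _ (fun y => g (y, z)) (y + tr l) (delta_mx 0 l) (v 0 l * t) D.
    have H : is_derive (t : R) 1 (fun t : R => v 0 l * t : R) (v 0 l).
      by apply: is_derive_eq; rewrite /GRing.scale /= mulr1.
    have := @is_derive1_comp R (fun u => g (y + tr l + u *: delta_mx 0 l, z)) (fun t : R => v 0 l * t : R) t _ _ L H.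
    by rewrite mulrC.
  have [_ /(_ l)] : U (c t, z) /\ forall l, `|partial l g (c t, z) - partial l g (y, z)| <= e'.
      by apply: near_y; rewrite mx_norm_ball /ball_/= distrC; exact: cU.
  by move=> h; rewrite -mulrBr normrM mulrC ler_pM.
have -> : g (y + v, z) - g (y, z) = \sum_(l < p) (g (y + tr l.+1, z) - g (y + tr l, z)).
  rewrite -(big_mkord xpredT (fun l => g (y + tr l.+1, z) - g (y + tr l, z))).
  by rewrite (telescope_sumr (fun l => g (y + tr l, z)))// trp tr0 addr0.
rewrite -sumrB; apply: le_trans (ler_norm_sum _ _ _) _.
apply: (@le_trans _ _ (\sum_(l < p) e' * `|v|)); first exact: ler_sum.
rewrite sumr_const card_ord -mulrnAl ler_wpM2r// /e' -mulr_natl mulrCA ger_pMr//.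
by rewrite ler_pdivrMr ?ltr0n// mul1r ler_nat.
Qed.

Lemma chain_curve U g z (c : R -> 'rV[R]_p) (c' : 'I_p -> R) (t0 : R) :
  open U -> CL 1 U g -> U (c t0, z) ->
  (forall l, is_derive t0 1 (fun t => c t 0 l : R^o) (c' l)) ->
  is_derive t0 1 (fun t => g (c t, z)) (\sum_l c' l * partial l g (c t0, z)).
Proof.
move=> oU CLg Uc dc.
pose Q l h : R := h^-1 * (c (h + t0) 0 l - c t0 0 l).
have cvQ l : Q l h @[h --> 0^'] --> c' l.
  have [cv <-] := dc l; have := cv; rewrite /derivable /derive => /cvg_ex[L HL].
  have E : (fun h => h^-1 *: (((fun t => c t 0 l : R^o) \o shift t0) (h *: 1) - c t0 0 l)) = Q l.
    by apply/funext => h /=; rewrite /Q [h *: 1]mulr1.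
  move: HL; rewrite E => HL.
  suff -> : lim (Q l h @[h --> 0^']) = L by [].
  exact/cvg_lim.
suff cv : h^-1 * (g (c (h + t0), z) - g (c t0, z)) @[h --> 0^'] --> (\sum_l c' l * partial l g (c t0, z) : R).
  have E : (fun h => h^-1 *: (((fun t => g (c t, z)) \o shift t0) (h *: 1) - g (c t0, z))) =
    (fun h => h^-1 * (g (c (h + t0), z) - g (c t0, z))).
    by apply/funext => h /=; rewrite [h *: 1]mulr1.
  split; rewrite /derivable /derive E; last exact/cvg_lim.
  by apply/cvg_ex; eexists; exact: cv.
apply/cvgrPdist_le => e e0.
(* [D] bounds the gradient at the base point, and [B] bounds the difference quotients of the curve
   once they are within 1 of their limits. *)
pose D := \sum_l `|partial l g (c t0, z)| + 1.
have D0 : 0 < D by rewrite ltr_wpDl// sumr_ge0.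
pose B := \sum_l `|c' l| + 1.
have B0 : 0 < B by rewrite ltr_wpDl// sumr_ge0.
have eB : 0 < e / 2 / B by rewrite !divr_gt0.
have eD : 0 < Num.min 1 (e / 2 / D) by rewrite lt_min ltr01 !divr_gt0.
have [delta d0 Hexp] := partial_expansion oU CLg Uc eB.
have near_nQ : \forall h \near (0 : R)^', forall l, `|c' l - Q l h| <= Num.min 1 (e / 2 / D).
  by apply: (@filter_forall _ _ (fun l h => `|c' l - Q l h| <= Num.min 1 (e / 2 / D)) _) => l;
    have /cvgrPdist_le/(_ _ eD) := cvQ l.
have near_nh : \forall h \near (0 : R)^', `|h| < delta / B.
  by apply: dnbhs0_lt; rewrite divr_gt0.
have near_nh0 : \forall h \near (0:R)^', h != 0 by exact: nbhs_dnbhs_neq.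
near=> h.
have nQ : forall l, `|c' l - Q l h| <= Num.min 1 (e / 2 / D) by near: h.
have nh : `|h| < delta / B by near: h.
have nh0 : h != 0 by near: h.
pose v := c (h + t0) - c t0.
have vl l : v 0 l = h * Q l h by rewrite /v !mxE /Q mulrA divff// mul1r.
have vB : `|v| <= B * `|h|.
  apply: mx_norm_le => [|i l]; first by rewrite mulr_ge0// ltW.
  rewrite ord1 vl normrM mulrC ler_wpM2r//.
  rewrite -[Q l h](subrK (c' l)) (le_trans (ler_normD _ _))// addrC lerD//.
    by rewrite (bigD1 l)//= lerDl sumr_ge0.
  by rewrite distrC (le_trans (nQ l))// ge_min lexx.
have vd : `|v| < delta.
  by apply: le_lt_trans vB _; rewrite mulrC -ltr_pdivlMr.
have := Hexp v vd; rewrite /= /v addrCA subrr addr0 => E1.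
have -> : \sum_l c' l * partial l g (c t0, z) - h^-1 * (g (c (h + t0), z) - g (c t0, z)) =
  \sum_l (c' l - Q l h) * partial l g (c t0, z) - h^-1 * (g (c (h + t0), z) - g (c t0, z) -
    \sum_l v 0 l * partial l g (c t0, z)).
  set G := g (c (h + t0), z) - g (c t0, z); set S := \sum_l v 0 l * _.
  rewrite [h^-1 * (G - S)]mulrBr opprB addrA; congr (_ - _).
  rewrite /S mulr_sumr -big_split /=; apply: eq_bigr => l _.
  rewrite vl; field; exact: nh0.
apply: le_trans (ler_normB _ _) _; rewrite [e]splitr; apply: lerD.
  apply: le_trans (ler_norm_sum _ _ _) _.
  apply: (@le_trans _ _ (\sum_l e / 2 / D * `|partial l g (c t0, z)|)).
    apply: ler_sum => l _; rewrite normrM ler_wpM2r//.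
    by apply: le_trans (nQ l) _; rewrite ge_min lexx orbT.
  rewrite -mulr_sumr -mulrA ger_pMr ?divr_gt0// mulrC ler_pdivrMr// mul1r /D.
  by rewrite lerDl.
rewrite normrM normfV mulrC ler_pdivrMr ?normr_gt0//.
apply: le_trans E1 _.
apply: (@le_trans _ _ (e / 2 / B * (B * `|h|))).
  by rewrite ler_wpM2l// ltW.
by rewrite mulrA divfK// gt_eqF.
Unshelve. all: by end_near. Qed.

End chain_rule.

Lemma near_eq_continuous (X Y : topologicalType) (f g : X -> Y) (x : X) :
  (\near x, f x = g x) -> {for x, continuous f} -> {for x, continuous g}.
Proof.
move=> fg cf; have fgx := nbhs_singleton fg.
have : f @ x --> g x by rewrite -fgx; exact: cf.
by apply: cvg_trans; exact: near_eq_cvg.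
Qed.

(** * Stability of the leafwise regularity classes *)

Section CL_general.
Context {R : realType} {p : nat} {W : topologicalType} {E : normedModType R}.
Implicit Types (U : set ('rV[R]_p * W)) (f g : 'rV[R]_p * W -> E).

Lemma CL_le k k' U f : (k <= k')%N -> CL k' U f -> CL k U f.
Proof.
move=> kk [d c]; split.
- by move=> s i q sk; apply: d; exact: leq_trans kk.
- by move=> s q sk; apply: c; exact: leq_trans kk.
Qed.

Lemma CL_sub k U U' f : U' `<=` U -> CL k U f -> CL k U' f.
Proof. by move=> sub [d c]; split => [s i q|s q] sk /sub; [exact: d|exact: c]. Qed.

Lemma CL_continuous k U f q : CL k U f -> U q -> {for q, continuous f}.
Proof. by move=> [_ c]; exact: (c [::]). Qed.

Lemma CL0P U f : (forall q, U q -> {for q, continuous f}) -> CL 0 U f.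
Proof. by move=> c; split => // s q; rewrite leqn0 => /nilP->; exact: c. Qed.

(** The last letter of a word is the derivative taken first. Splitting words at their right end
    therefore reduces class k + 1 of [f] to class k of its first partials, which is how all
    inductions on the order proceed. *)
Lemma iter_partial_rcons s i f : iter_partial (rcons s i) f = iter_partial s (partial i f).
Proof. by rewrite /iter_partial foldr_rcons. Qed.

Lemma CL_partial k U f i : CL k.+1 U f -> CL k U (partial i f).
Proof.
move=> [d c]; split.
- move=> s j q sk Uq; rewrite -iter_partial_rcons; apply: d => //.
  by rewrite size_rcons.
- move=> s q sk Uq; rewrite -iter_partial_rcons; apply: c => //.
  by rewrite size_rcons.
Qed.

Lemma CL_derivable k U f i q : CL k.+1 U f -> U q ->
  derivable (fun y => f (y, q.2)) q.1 (delta_mx 0 i).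
Proof. by move=> [d _]; exact: (d [::]). Qed.

Lemma CLSP k U f :
  (forall q, U q -> {for q, continuous f}) ->
  (forall i q, U q -> derivable (fun y => f (y, q.2)) q.1 (delta_mx 0 i)) ->
  (forall i, CL k U (partial i f)) -> CL k.+1 U f.
Proof.
move=> cf df CLd; split.
- move=> s j q; case/lastP: s => [_ |s i]; first exact: df.
  rewrite size_rcons ltnS => sk Uq; rewrite iter_partial_rcons.
  by have [+ _] := CLd i; apply.
- move=> s q; case/lastP: s => [_ |s i]; first exact: cf.
  rewrite size_rcons ltnS => sk Uq; rewrite iter_partial_rcons.
  by have [_] := CLd i; apply.
Qed.

Lemma near_slice_eq U f g (q : 'rV[R]_p * W) : open U -> U q -> (forall q, U q -> f q = g q) ->
  \forall y \near q.1, f (y, q.2) = g (y, q.2).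
Proof.
move=> oU Uq fg; apply: filterS (slice_nbhs (open_nbhs_nbhs (conj oU Uq))) => y.
exact: fg.
Qed.

Lemma eq_partial U f g i q : open U -> U q -> (forall q, U q -> f q = g q) ->
  partial i f q = partial i g q.
Proof. by move=> oU Uq fg; apply: near_eq_derive; exact: near_slice_eq fg. Qed.

Lemma eq_CL k U f g : open U -> (forall q, U q -> f q = g q) -> CL k U f -> CL k U g.
Proof.
move=> oU; elim: k f g => [|k IH] f g fg CLf.
  apply: CL0P => q Uq; have cf := CL_continuous CLf Uq.
  apply: near_eq_continuous cf.
  by apply: filterS (open_nbhs_nbhs (conj oU Uq)) => q' /fg.
apply: CLSP.
- move=> q Uq; have cf := CL_continuous CLf Uq.
  apply: near_eq_continuous cf.
  by apply: filterS (open_nbhs_nbhs (conj oU Uq)) => q' /fg.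
- move=> i q Uq; apply: near_eq_derivable (CL_derivable CLf Uq).
  exact: near_slice_eq fg.
- move=> i; apply: IH (CL_partial i CLf) => q Uq.
  exact: eq_partial fg.
Qed.

Lemma partial_cst i (c : E) :
  partial i (fun _ : 'rV[R]_p * W => c) = fun=> 0.
Proof. by apply/funext => q; rewrite /partial derive_cst. Qed.

Lemma CL_cst k U (c : E) : CL k U (fun=> c).
Proof.
elim: k c => [|k IH] c; first by apply: CL0P => q _; exact: cvg_cst.
apply: CLSP => [q _|i q _|i]; [exact: cvg_cst|exact: (@derivable_cst _ _ _ c)|].
by rewrite partial_cst.
Qed.

(** A function of the height alone has vanishing leafwise derivatives, so plain continuity puts it
    in every class. This is what makes a transverse distance an admissible test function. *)
Lemma CL_snd k U (h : W -> E) : open U -> (forall q, U q -> {for q.2, continuous h}) ->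
  CL k U (fun q => h q.2).
Proof.
move=> oU ch.
have ch' q : U q -> {for q, continuous (fun q : 'rV[R]_p * W => h q.2)}.
  by move=> Uq; apply: (@continuous_comp _ _ _ snd h q); [exact: cvg_snd|exact: ch].
case: k => [|k]; first exact: CL0P.
apply: CLSP => //; first by move=> i q _; exact: (@derivable_cst _ _ _ (h q.2)).
move=> i; rewrite (_ : partial i _ = fun=> 0); first exact: CL_cst.
by apply/funext => q; exact: (@derive_cst _ _ _ (h q.2)).
Qed.

End CL_general.

Section CL_scalar.
Context {R : realType} {p : nat} {W : topologicalType}.
Implicit Types (U : set ('rV[R]_p * W)) (f g : 'rV[R]_p * W -> R^o).

Lemma CL_coord_component k U m n (f : 'rV[R]_p * W -> 'M[R]_(m, n)) a b : open U ->
  CL k U f -> CL k U (fun q => f q a b : R^o).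
Proof.
move=> oU; elim: k f => [|k IH] f CLf.
  apply: CL0P => q Uq; apply: (@continuous_comp _ _ _ f (fun M : 'M[R]_(m, n) => M a b : R^o) q).
    exact: CL_continuous CLf Uq.
  exact: coord_continuous.
apply: CLSP.
- move=> q Uq; apply: (@continuous_comp _ _ _ f (fun M : 'M[R]_(m, n) => M a b : R^o) q).
    exact: CL_continuous CLf Uq.
  exact: coord_continuous.
- by move=> i q Uq; have /derivable_mxP := CL_derivable (i := i) CLf Uq; apply.
- move=> i; apply: (@eq_CL _ _ _ _ k U (fun q => partial i f q a b : R^o)) => //.
    by move=> q Uq; rewrite /partial derive_mx ?mxE//; exact: CL_derivable CLf Uq.
  by apply: IH; exact: CL_partial.
Qed.

Lemma partialD U f g i q : CL 1 U f -> CL 1 U g -> U q ->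
  partial i (fun q => f q + g q) q = partial i f q + partial i g q.
Proof.
move=> CLf CLg Uq; rewrite /partial.
exact: (@deriveD _ _ _ (fun y => f (y, q.2)) (fun y => g (y, q.2)) _ _
  (CL_derivable CLf Uq) (CL_derivable CLg Uq)).
Qed.

Lemma partialM U f g i q : CL 1 U f -> CL 1 U g -> U q ->
  partial i (fun q => f q * g q : R^o) q = f q * partial i g q + partial i f q * g q.
Proof.
move=> CLf CLg Uq; rewrite /partial.
rewrite (@deriveM _ _ (fun y => f (y, q.2)) (fun y => g (y, q.2)) _ _
  (CL_derivable CLf Uq) (CL_derivable CLg Uq)).
by case: q Uq => y z Uq; rewrite /GRing.scale/= [X in _ + X]mulrC.
Qed.

Lemma CLD k U f g : open U -> CL k U f -> CL k U g -> CL k U (fun q => f q + g q).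
Proof.
move=> oU; elim: k f g => [|k IH] f g CLf CLg.
  by apply: CL0P => q Uq; apply: cvgD; [exact: CL_continuous CLf Uq|exact: CL_continuous CLg Uq].
apply: CLSP.
- by move=> q Uq; apply: cvgD; [exact: CL_continuous CLf Uq|exact: CL_continuous CLg Uq].
- move=> i q Uq; apply: (@derivableD _ _ _ (fun y => f (y, q.2)) (fun y => g (y, q.2))).
    exact: CL_derivable CLf Uq.
  exact: CL_derivable CLg Uq.
- move=> i; apply: (@eq_CL _ _ _ _ k U (fun q => partial i f q + partial i g q)) => //.
    by move=> q Uq; rewrite (@partialD U)//; [exact: CL_le CLf|exact: CL_le CLg].
  by apply: IH; exact: CL_partial.
Qed.

Lemma CLM k U f g : open U -> CL k U f -> CL k U g -> CL k U (fun q => f q * g q : R^o).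
Proof.
move=> oU; elim: k f g => [|k IH] f g CLf CLg.
  by apply: CL0P => q Uq; apply: cvgM; [exact: CL_continuous CLf Uq|exact: CL_continuous CLg Uq].
apply: CLSP.
- by move=> q Uq; apply: cvgM; [exact: CL_continuous CLf Uq|exact: CL_continuous CLg Uq].
- move=> i q Uq; apply: (@derivableM _ _ (fun y => f (y, q.2)) (fun y => g (y, q.2))).
    exact: CL_derivable CLf Uq.
  exact: CL_derivable CLg Uq.
- move=> i; apply: (@eq_CL _ _ _ _ k U (fun q => (f q * partial i g q : R^o) + (partial i f q * g q : R^o))) => //.
    by move=> q Uq; rewrite (@partialM U)//; [exact: CL_le CLf|exact: CL_le CLg].
  exact: (CLD oU (IH _ _ (CL_le (leqnSn k) CLf) (CL_partial i CLg))
    (IH _ _ (CL_partial i CLf) (CL_le (leqnSn k) CLg))).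
Qed.

Lemma CL_sum k U (I : Type) (r : seq I) (P : pred I) (f : I -> 'rV[R]_p * W -> R^o) : open U ->
  (forall i, CL k U (f i)) -> CL k U (fun q => \sum_(i <- r | P i) f i q).
Proof.
move=> oU CLf; elim: r => [|i r IH].
  by apply: (eq_CL oU _ (CL_cst k U 0)) => q _; rewrite big_nil.
case Pi : (P i).
  by apply: (eq_CL oU _ (CLD oU (CLf i) IH)) => q _; rewrite big_cons Pi.
by apply: (eq_CL oU _ IH) => q _; rewrite big_cons Pi.
Qed.

Lemma partial_coord (l i : 'I_p) (q : 'rV[R]_p * W) : partial i (fun q => q.1 0 l : R^o) q = (i == l)%:R.
Proof.
rewrite /partial.
have D : is_derive q.1 (delta_mx 0 i) (fun y : 'rV[R]_p => y) (delta_mx 0 i : 'rV[R]_p) by exact: is_derive_id.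
have Dv : derivable (fun y : 'rV[R]_p => y) q.1 (delta_mx 0 i) by case: D.
have := derive_mx Dv; have [_ ->] := D => /matrixP/(_ 0 l); rewrite !mxE eqxx/= eq_sym.
by move=> <-; rewrite eq_sym.
Qed.

Lemma CL_coord k U (l : 'I_p) : CL k U (fun q => q.1 0 l : R^o).
Proof.
have c q : U q -> {for q, continuous (fun q : 'rV[R]_p * W => q.1 0 l : R^o)}.
  move=> _; apply: (@continuous_comp _ _ _ fst (fun M : 'rV[R]_p => M 0 l : R^o) q).
    exact: cvg_fst.
  exact: coord_continuous.
case: k => [|k]; first exact: CL0P.
apply: CLSP => //.
- move=> i q _; have /derivable_mxP : derivable (fun y : 'rV[R]_p => y) q.1 (delta_mx 0 i).
    exact: derivable_id.
  exact.
- move=> i; rewrite (_ : partial i _ = fun=> (i == l)%:R : R^o); first exact: CL_cst.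
  by apply/funext => q; rewrite partial_coord.
Qed.

End CL_scalar.

Section CL_composition.
Context {R : realType} {p d : nat} {W1 W2 : topologicalType}.
Variables (U : set ('rV[R]_p * W1)) (U' : set ('rV[R]_d * W2)).
Variables (f1 : 'rV[R]_p * W1 -> 'rV[R]_d) (f2 : W1 -> W2).
Hypotheses (oU : open U) (oU' : open U').
Hypothesis f2_cont : forall q, U q -> {for q.2, continuous f2}.
Hypothesis f_in : forall q, U q -> U' (f1 q, f2 q.2).

Lemma is_derive_slice_comp (g : 'rV[R]_d * W2 -> R^o) i q : CL 1 U f1 -> CL 1 U' g -> U q ->
  is_derive q.1 (delta_mx 0 i) (fun y => g (f1 (y, q.2), f2 q.2))
    (\sum_l partial i (fun q => f1 q 0 l : R^o) q * partial l g (f1 q, f2 q.2)).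
Proof.
move=> CLf CLg Uq; apply: is_derive_at_line.
have := @chain_curve R d W2 U' g (f2 q.2) (fun t => f1 (q.1 + t *: delta_mx 0 i, q.2))
  (fun l => partial i (fun q => f1 q 0 l : R^o) q) 0 oU' CLg.
have q0 : (q.1 + 0 *: delta_mx 0 i, q.2) = q by rewrite scale0r addr0; case: q Uq.
rewrite q0 => H; apply: H; first exact: f_in.
move=> l; have := @is_derive_line R _ _ (fun y => f1 (y, q.2) 0 l : R^o) q.1 (delta_mx 0 i) 0.
rewrite scale0r addr0; apply.
exact: (@CL_derivable _ _ _ _ 0 U (fun q => f1 q 0 l : R^o) i q (CL_coord_component _ _ oU CLf) Uq).
Qed.

(** Induction on [k]: by the chain rule each partial derivative of the composite is a sum of
    products of partials of [f1] with composites of partials of [g]. The map has the product form of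
    a transition map. *)
Lemma CL_comp k (g : 'rV[R]_d * W2 -> R^o) : CL k U f1 -> CL k U' g -> CL k U (fun q => g (f1 q, f2 q.2)).
Proof.
have cont k' (g' : 'rV[R]_d * W2 -> R^o) q : CL k' U f1 -> CL k' U' g' -> U q ->
    {for q, continuous (fun q => g' (f1 q, f2 q.2))}.
  move=> CLf CLg Uq.
  apply: (@continuous_comp _ _ _ (fun q => (f1 q, f2 q.2)) g' q); last first.
    by apply: (CL_continuous CLg); exact: f_in.
  have c1 : f1 x @[x --> q] --> f1 q by exact: CL_continuous CLf Uq.
  have c2 : f2 x.2 @[x --> q] --> f2 q.2.
    by apply: (@continuous_comp _ _ _ snd f2 q); [exact: cvg_snd|exact: f2_cont].
  exact: (cvg_pair c1 c2).
elim: k g => [|k IH] g CLf CLg; first by apply: CL0P => q; exact: (cont 0%N).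
have CLf1 := CL_le (ltn0Sn k) CLf; have CLg1 := CL_le (ltn0Sn k) CLg.
apply: CLSP; first by move=> q; exact: (cont k.+1).
- by move=> i q Uq; have [] := is_derive_slice_comp i CLf1 CLg1 Uq.
- move=> i; apply: (@eq_CL _ _ _ _ k U (fun q =>
     \sum_l partial i (fun q => f1 q 0 l : R^o) q * partial l g (f1 q, f2 q.2))) => //.
    by move=> q Uq; have [_ <-] := is_derive_slice_comp i CLf1 CLg1 Uq.
  apply: CL_sum => // l; apply: CLM => //.
    exact: CL_partial (CL_coord_component _ _ oU CLf).
  by apply: IH; [exact: CL_le CLf|exact: CL_partial].
Qed.

End CL_composition.

Section positive_part.
Context {R : realType}.

Lemma is_derive_pos_power n (u : R) :
  is_derive u 1 (fun u => Num.max u 0 ^+ n.+2 : R^o) (n.+2%:R * Num.max u 0 ^+ n.+1).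
Proof.
have [u0|u0|->] := ltgtP u 0.
- rewrite expr0n /= mulr0; apply: (@near_eq_is_derive _ _ _ (cst (0 : R^o))).
  have : \forall v \near u, v < 0 by exact: lt_nbhsl.
  by apply: filterS => v v0; rewrite max_r ?expr0n// ltW.
- have D : is_derive u 1 (fun u : R => u ^+ n.+2 : R^o) (n.+2%:R * u ^+ n.+1).
    have := @is_deriveX R R id n.+2 u 1 1 (is_derive_id _ _).
    by rewrite exprfctE /GRing.scale/= mulr1.
  apply: near_eq_is_derive D.
  have : \forall v \near u, 0 < v by exact: lt_nbhsr.
  by apply: filterS => v v0; rewrite max_l// ltW.
- rewrite expr0n /= mulr0.
  suff cv : h^-1 * (Num.max h 0 ^+ n.+2) @[h --> (0 : R)^'] --> (0 : R).
    have E : (fun h => h^-1 *: (((fun u => Num.max u 0 ^+ n.+2 : R^o) \o shift 0) (h *: 1) - Num.max 0 0 ^+ n.+2 )) =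
      (fun h => h^-1 * (Num.max h 0 ^+ n.+2)).
      by apply/funext => h /=; rewrite [h *: 1]mulr1 addr0 maxxx expr0n subr0.
    split; rewrite /derivable /derive E; last exact/cvg_lim.
    by apply/cvg_ex; eexists; exact: cv.
  apply/cvgrPdist_le => e e0.
  have e1 : 0 < Num.min 1 e by rewrite lt_min ltr01.
  have near_h : \forall h \near (0 : R)^', `|h| < Num.min 1 e by exact: dnbhs0_lt.
  apply: filterS near_h => h; rewrite lt_min => /andP[/ltW h1 /ltW he].
  rewrite sub0r normrN; have [h0|h0] := leP h 0.
    by rewrite expr0n /= mulr0 normr0 ltW.
  have hn0 : h != 0 by rewrite gt_eqF.
  rewrite exprS mulrA mulVf// mul1r normrX; apply: le_trans he.
  by rewrite exprS ler_piMr// exprn_ile1.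
Qed.

Lemma continuous_pos_power n : continuous (fun u : R => Num.max u 0 ^+ n.+1 : R^o).
Proof.
move=> u; case: n => [|n].
  have c : {for u, continuous (fun u : R => Num.max u 0)}.
    by apply: continuous_max; [exact: cvg_id|exact: cvg_cst].
  exact: c.
have [D _] := is_derive_pos_power n u.
by move/derivable1_diffP/differentiable_continuous : D.
Qed.

(** Each derivative lowers the exponent of the positive part by one, and the positive part itself is
    continuous. Powers of it thus supply cutoffs of any finite class. *)
Lemma CL_pos_power {p : nat} {W : topologicalType} k (U : set ('rV[R]_p * W)) (e : 'rV[R]_p * W -> R^o) :
  open U -> CL k U e -> CL k U (fun q => Num.max (e q) 0 ^+ k.+1 : R^o).
Proof.
move=> oU CLe.
have cont n q : U q -> {for q, continuous (fun q => Num.max (e q) 0 ^+ n.+1 : R^o)}.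
  move=> Uq; apply: (@continuous_comp _ _ _ e (fun u => Num.max u 0 ^+ n.+1 : R^o) q).
    exact: CL_continuous CLe Uq.
  exact: continuous_pos_power.
elim: k CLe => [|k IH] CLe; first by apply: CL0P => q; exact: cont.
have D i q : U q -> is_derive q.1 (delta_mx 0 i) (fun y => Num.max (e (y, q.2)) 0 ^+ k.+2 : R^o)
    (k.+2%:R * Num.max (e q) 0 ^+ k.+1 * partial i e q).
  move=> Uq; apply: is_derive_at_line.
  have De := @CL_derivable _ _ _ _ k U e i q CLe Uq.
  have := @is_derive_line R _ _ (fun y => e (y, q.2)) q.1 (delta_mx 0 i) 0.
  rewrite scale0r addr0 => /(_ De) L.
  have := @is_derive1_comp R (fun u => Num.max u 0 ^+ k.+2 : R) (fun t => e (q.1 + t *: delta_mx 0 i, q.2)) 0 _ _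
    (is_derive_pos_power k _) L.
  by rewrite scale0r addr0 /=; case: q Uq {De L}.
apply: CLSP; first by move=> q; exact: cont.
- by move=> i q Uq; have [] := D i q Uq.
- move=> i; apply: (@eq_CL _ _ _ _ k U (fun q => ((k.+2%:R : R^o) * (Num.max (e q) 0 ^+ k.+1 : R^o) : R^o) * partial i e q : R^o)) => //.
    by move=> q Uq; have [_ <-] := D i q Uq.
  have CLe' := CL_le (leqnSn k) CLe.
  exact: (CLM oU (CLM oU (CL_cst _ _ _) (IH CLe')) (CL_partial i CLe)).
Qed.

End positive_part.

Lemma near_slice_dist {R : realType} {p : nat} {W : topologicalType}
    (G : 'rV[R]_p * W -> R^o) q e : {for q, continuous G} -> 0 < e ->
  \forall y \near q.1, `|G (y, q.2) - G q| <= e.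
Proof.
move=> cG e0; apply: (@slice_nbhs _ _ _ (fun q' => `|G q' - G q| <= e)).
have /cvgrPdist_le/(_ _ e0) := cG.
by apply: filterS => q'; rewrite /= distrC.
Qed.

(** * Symmetry of second leafwise derivatives *)

Section schwarz.
Context {R : realType} {p : nat} {W : topologicalType}.
Variables (U : set ('rV[R]_p * W)) (f : 'rV[R]_p * W -> R^o).

(** The mean value inequality in direction [j] and then in direction [i]. The second difference on
    the left does not change when [i] and [j] are exchanged, so both mixed derivatives are its limit
    after division by [h * h]. *)
Lemma rectangle_increment i j y z a e h : 0 <= h -> CL 2 U f ->
  (forall s t, 0 <= s -> s <= h -> 0 <= t -> t <= h ->
     U (y + s *: delta_mx 0 i + t *: delta_mx 0 j, z) /\
     `|partial i (partial j f) (y + s *: delta_mx 0 i + t *: delta_mx 0 j, z) - a| <= e) ->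
  `|f (y + h *: delta_mx 0 i + h *: delta_mx 0 j, z) - f (y + h *: delta_mx 0 j, z)
    - (f (y + h *: delta_mx 0 i, z) - f (y, z)) - a * h * h| <= e * h * h.
Proof.
move=> h0 CLf H.
pose psi t : R^o := f (y + h *: delta_mx 0 i + t *: delta_mx 0 j, z) - f (y + t *: delta_mx 0 j, z).
pose dpsi t : R^o := partial j f (y + h *: delta_mx 0 i + t *: delta_mx 0 j, z) - partial j f (y + t *: delta_mx 0 j, z).
have H0 t : 0 <= t -> t <= h -> U (y + t *: delta_mx 0 j, z).
  by move=> t0 th; have [] := H 0 t (lexx 0) h0 t0 th; rewrite scale0r addr0.
have := @mean_value_inequality R psi dpsi h (a * h) (e * h) h0.
rewrite /psi scale0r !addr0; apply => t t0 th.
  have [Ut _] := H h t h0 (lexx h) t0 th.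
  have D1 := @is_derive_line R _ _ (fun y => f (y, z)) (y + h *: delta_mx 0 i) (delta_mx 0 j) t
    (CL_derivable (q := (_, _)) CLf Ut).
  have D2 := @is_derive_line R _ _ (fun y => f (y, z)) y (delta_mx 0 j) t
    (CL_derivable (q := (_, _)) CLf (H0 t t0 th)).
  exact: is_deriveB D1 D2.
have := @mean_value_inequality R (fun s => partial j f (y + s *: delta_mx 0 i + t *: delta_mx 0 j, z))
  (fun s => partial i (partial j f) (y + s *: delta_mx 0 i + t *: delta_mx 0 j, z)) h a e h0.
rewrite scale0r addr0; apply => s s0 sh.
  have [Us _] := H s t s0 sh t0 th.
  have := @is_derive_line R _ _ (fun y => partial j f (y, z)) (y + t *: delta_mx 0 j) (delta_mx 0 i) s.
  rewrite addrAC => /(_ (CL_derivable (q := (_, _)) (CL_partial j CLf) Us)).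
  by under eq_fun do rewrite addrAC.
by have [_] := H s t s0 sh t0 th.
Qed.

Lemma partial_commute i j q : open U -> CL 2 U f -> U q ->
  partial i (partial j f) q = partial j (partial i f) q.
Proof.
case: q => y z oU CLf Uq; apply/eqP; rewrite -subr_eq0 -normr_le0.
apply/ler_addgt0Pr => e e0; rewrite add0r.
have e2 : 0 < e / 2 by rewrite divr_gt0.
have nearP k l : \forall y' \near y, `|partial k (partial l f) (y', z) - partial k (partial l f) (y, z)| <= e / 2.
  by apply: (near_slice_dist (q := (y, z))) => //; exact: CL_continuous (CL_partial k (CL_partial l CLf)) Uq.
have nU := @slice_nbhs _ _ _ U (y, z) (open_nbhs_nbhs (conj oU Uq)).
have : \forall y' \near y, [/\ U (y', z),
    `|partial i (partial j f) (y', z) - partial i (partial j f) (y, z)| <= e / 2 &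
    `|partial j (partial i f) (y', z) - partial j (partial i f) (y, z)| <= e / 2].
  exact: filterS3 nU (nearP i j) (nearP j i).
move=> /nbhs_ballP[delta /= d0 near_y].
pose h := delta / 3; have h0 : 0 < h by rewrite divr_gt0.
have inb k l s t : 0 <= s -> s <= h -> 0 <= t -> t <= h ->
    ball y delta (y + s *: delta_mx 0 k + t *: delta_mx 0 l).
  move=> s0 sh t0 th; rewrite mx_norm_ball /ball_/= -addrA opprD addrA subrr add0r normrN.
  apply: le_lt_trans (ler_normD _ _) _; rewrite !normrZ !ger0_norm//.
  have b1 m : `|delta_mx 0 m : 'rV[R]_p| <= 1.
    by apply: mx_norm_le => // a b; rewrite !mxE; case: (_ && _); rewrite ?normr0 ?normr1.
  have := ler_wpM2l s0 (b1 k); have := ler_wpM2l t0 (b1 l); rewrite !mulr1.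
  by move: sh th h0; rewrite /h; lra.
have E1 := @rectangle_increment i j y z (partial i (partial j f) (y, z)) (e / 2) h (ltW h0) CLf.
have E2 := @rectangle_increment j i y z (partial j (partial i f) (y, z)) (e / 2) h (ltW h0) CLf.
have {}E1 := E1 (fun s t s0 sh t0 th => let: And3 a b c := near_y _ (inb i j s t s0 sh t0 th) in conj a b).
have {}E2 := E2 (fun s t s0 sh t0 th => let: And3 a b c := near_y _ (inb j i s t s0 sh t0 th) in conj a c).
rewrite [y + h *: delta_mx 0 j + _]addrAC in E2.
have h2 : 0 < h * h by rewrite mulr_gt0.
rewrite -(ler_pM2r h2) -[X in _ * X <= _](ger0_norm (ltW h2)) -normrM.
move: E1 E2; set S1 := f (y + _ + _, z); set S2 := f (y + h *: delta_mx 0 j, z).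
set S3 := f (y + h *: delta_mx 0 i, z); set S4 := f (y, z).
set A := partial i _ _; set B := partial j _ _ => E1 E2.
rewrite [X in `|X|](_ : _ = (S1 - S3 - (S2 - S4) - B * h * h) - (S1 - S2 - (S3 - S4) - A * h * h)); last by ring.
apply: le_trans (ler_normB _ _) _; apply: le_trans (lerD E2 E1) _.
by rewrite le_eqVlt; apply/orP; left; apply/eqP; field.
Qed.

End schwarz.

Section finite_sums.
Context {R : realType}.

(** [N] may be any upper bound of the number of terms: later one [N] serves for coordinates, driving
    fields and second-level indices at once, which keeps all constants polynomials in [N]. *)
Lemma dot_le (I : finType) (N : nat) (x y : I -> R) X Y : (#|I| <= N)%N ->
  (forall i, `|x i| <= X) -> (forall i, `|y i| <= Y) -> 0 <= X -> 0 <= Y ->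
  `|\sum_i x i * y i| <= N%:R * (X * Y).
Proof.
move=> IN hx hy X0 Y0; apply: le_trans (ler_norm_sum _ _ _) _.
apply: (@le_trans _ _ (\sum_(i : I) X * Y)).
  by apply: ler_sum => i _; rewrite normrM ler_pM.
by rewrite sumr_const -[leLHS]mulr_natl ler_wpM2r ?mulr_ge0// ler_nat.
Qed.

Lemma is_derive_sum_fun (I : finType) (h : I -> R -> R^o) (dh : I -> R) (t : R) :
  (forall i, is_derive t 1 (h i) (dh i)) ->
  is_derive t 1 (fun t => \sum_i h i t : R^o) (\sum_i dh i).
Proof.
move=> H; suff : forall r : seq I, is_derive t 1 (fun t => \sum_(i <- r) h i t : R^o) (\sum_(i <- r) dh i).
  exact.
elim=> [|i r IH].
  rewrite big_nil; under eq_fun do rewrite big_nil; exact: (@is_derive_cst _ R R^o).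
by rewrite big_cons; under eq_fun do rewrite big_cons; exact: is_deriveD.
Qed.

Lemma is_derive_mulc (f : R -> R^o) df c (t : R) :
  is_derive t 1 f df -> is_derive t 1 (fun t => c * f t : R^o) (c * df).
Proof.
move=> D; have -> : (fun t => c * f t : R^o) = c \*: f by apply/funext.
exact: is_deriveZ.
Qed.

End finite_sums.

(** * Taylor estimates on convex sets at a fixed height *)

Section box.
Context {R : realType} {p : nat} {W : topologicalType}.
Variables (U : set ('rV[R]_p * W)) (z : W) (B : set 'rV[R]_p) (N : nat).
Hypotheses (oU : open U) (pN : (p <= N)%N).
Hypothesis B_convex : forall a b t, B a -> B b -> 0 <= t -> t <= 1 -> B (a + t *: (b - a)).
Hypothesis BU : forall y, B y -> U (y, z).
Implicit Types g : 'rV[R]_p * W -> R^o.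

Definition bounded_words k g K := forall (s : seq 'I_p), (size s <= k)%N ->
  forall y, B y -> `|iter_partial s g (y, z)| <= K.

Lemma bounded_words_le k k' g K : (k <= k')%N -> bounded_words k' g K -> bounded_words k g K.
Proof. by move=> kk h s sk; apply: h; exact: leq_trans kk. Qed.

Lemma bounded_words_partial k g K i : bounded_words k.+1 g K -> bounded_words k (partial i g) K.
Proof.
move=> h s sk y By; rewrite -iter_partial_rcons; apply: h => //.
by rewrite size_rcons.
Qed.

Lemma bounded_words0 k g K y : bounded_words k g K -> B y -> `|g (y, z)| <= K.
Proof. by move=> h By; exact: (h [::]). Qed.

Lemma line_derivative g a v t : CL 1 U g -> B (a + t *: v) ->
  is_derive t 1 (fun t => g (a + t *: v, z)) (\sum_l v 0 l * partial l g (a + t *: v, z)).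
Proof.
move=> CLg /BU Ut; apply: chain_curve oU CLg Ut _ => l.
have -> : (fun t => (a + t *: v) 0 l : R^o) = (fun t : R => a 0 l + t * v 0 l).
  by apply/funext => s; rewrite !mxE.
by apply: is_derive_eq; rewrite /GRing.scale/=; ring.
Qed.

Let M : R := N%:R.
Let M0 : 0 <= M. Proof. by []. Qed.
Let cardp : (#|'I_p| <= N)%N. Proof. by rewrite card_ord. Qed.

Let coord (v : 'rV[R]_p) l : `|v 0 l| <= `|v|. Proof. exact: norm_coord_le. Qed.

Let segment a b t : B a -> B b -> 0 <= t -> t <= 1 -> B (a + t *: (b - a)).
Proof. exact: B_convex. Qed.

Lemma box_lipschitz g K a b : 0 <= K -> CL 1 U g -> bounded_words 1 g K -> B a -> B b ->
  `|g (b, z) - g (a, z)| <= M * K * `|b - a|.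
Proof.
move=> K0 CLg hK Ba Bb; set v := b - a.
have := @mean_value_inequality R (fun t => g (a + t *: v, z)) (fun t => \sum_l v 0 l * partial l g (a + t *: v, z))
  1 0 (M * K * `|v|) ler01.
rewrite scale1r scale0r addr0 mul0r subr0 mulr1 (_ : a + v = b); last by rewrite addrC subrK.
apply => t t0 t1.
  by apply: line_derivative => //; exact: segment.
rewrite subr0; apply: le_trans (dot_le (X := `|v|) (Y := K) cardp _ _ _ _) _ => //.
  by move=> l; apply: (hK [:: l]) => //; exact: segment.
by rewrite [`|v| * K]mulrC mulrA.
Qed.

Lemma box_taylor1 g K a b : 0 <= K -> CL 2 U g -> bounded_words 2 g K -> B a -> B b ->
  `|g (b, z) - g (a, z) - \sum_l (b - a) 0 l * partial l g (a, z)| <= M ^+ 2 * K * `|b - a| ^+ 2.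
Proof.
move=> K0 CLg hK Ba Bb; set v := b - a.
have CLg1 := CL_le (leqnSn 1) CLg.
have := @mean_value_inequality R (fun t => g (a + t *: v, z)) (fun t => \sum_l v 0 l * partial l g (a + t *: v, z))
  1 (\sum_l v 0 l * partial l g (a, z)) (M ^+ 2 * K * `|v| ^+ 2) ler01.
rewrite scale1r scale0r addr0 !mulr1 (_ : a + v = b); last by rewrite addrC subrK.
apply => t t0 t1.
  by apply: line_derivative => //; exact: segment.
rewrite -sumrB; under eq_bigr do rewrite -mulrBr.
apply: le_trans (dot_le (X := `|v|) (Y := M * K * `|v|) cardp _ _ _ _) _ => //; last 2 first.
  by rewrite !mulr_ge0.
  by rewrite le_eqVlt; apply/orP; left; apply/eqP; rewrite -/M; ring.
move=> l; apply: le_trans (box_lipschitz K0 (CL_partial l CLg) (bounded_words_partial _ hK) Ba _) _; first exact: segment.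
rewrite addrAC subrr add0r normrZ ger0_norm// ler_wpM2l ?mulr_ge0//.
by rewrite ler_piMl.
Qed.

Lemma box_taylor2 g K a b : 0 <= K -> CL 3 U g -> bounded_words 3 g K -> B a -> B b ->
  `|g (b, z) - g (a, z) - \sum_l (b - a) 0 l * partial l g (a, z)
    - (\sum_l (b - a) 0 l * (\sum_m (b - a) 0 m * partial m (partial l g) (a, z))) / 2| <=
  M ^+ 3 * K * `|b - a| ^+ 3.
Proof.
move=> K0 CLg hK Ba Bb; set v := b - a.
have CLg1 : CL 1 U g by exact: CL_le CLg.
have CLg2 l : CL 2 U (partial l g) by exact: CL_partial.
have := @taylor1_inequality R (fun t => g (a + t *: v, z)) (fun t => \sum_l v 0 l * partial l g (a + t *: v, z))
  (fun t => \sum_l v 0 l * (\sum_m v 0 m * partial m (partial l g) (a + t *: v, z)))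
  (\sum_l v 0 l * (\sum_m v 0 m * partial m (partial l g) (a, z))) (M ^+ 3 * K * `|v| ^+ 3).
rewrite scale1r scale0r addr0 (_ : a + v = b); last by rewrite addrC subrK.
apply => t t0 t1.
- by apply: line_derivative => //; exact: segment.
- apply: is_derive_sum_fun => l.
  have D := @line_derivative (partial l g) a v t (CL_le (leqnSn 1) (CLg2 l)) (segment Ba Bb t0 t1).
  exact: is_derive_mulc D.
rewrite -sumrB; under eq_bigr do rewrite -mulrBr -sumrB.
have step l : `|\sum_m (v 0 m * partial m (partial l g) (a + t *: v, z) - v 0 m * partial m (partial l g) (a, z))|
    <= M * (`|v| * (M * K * `|v|)).
  under eq_bigr do rewrite -mulrBr.
  apply: (dot_le cardp) => // [m|]; last by rewrite !mulr_ge0.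
  have hK2 := bounded_words_partial m (bounded_words_partial l hK).
  apply: le_trans (box_lipschitz K0 (CL_partial m (CLg2 l)) hK2 Ba _) _; first exact: segment.
  rewrite addrAC subrr add0r normrZ ger0_norm// ler_wpM2l ?mulr_ge0//.
  by rewrite ler_piMl.
apply: le_trans (dot_le (X := `|v|) (Y := M * (`|v| * (M * K * `|v|))) cardp _ _ _ _) _ => //.
  by rewrite !mulr_ge0.
by rewrite le_eqVlt; apply/orP; left; apply/eqP; rewrite -/M; ring.
Qed.

Let norm_segment (a b : 'rV[R]_p) t : 0 <= t -> t <= 1 -> `|a + t *: (b - a)| <= `|a| + `|b|.
Proof.
move=> t0 t1; have -> : a + t *: (b - a) = (1 - t) *: a + t *: b.
  by rewrite scalerBr scalerBl scale1r addrCA addrC.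
apply: le_trans (ler_normD _ _) _; rewrite !normrZ !ger0_norm ?subr_ge0//.
by apply: lerD; apply: ler_piMl => //; lra.
Qed.

(** Interpolate linearly from the pair (c, d) to the pair (a, b). The derivative of the difference
    of values is a gradient applied to a - b - (c - d), plus a difference of gradients applied to b
    - d. *)
Lemma box_4point g K a b c d : 0 <= K -> CL 2 U g -> bounded_words 2 g K ->
  B a -> B b -> B c -> B d ->
  `|g (a, z) - g (b, z) - (g (c, z) - g (d, z))| <=
  M * K * `|a - b - (c - d)| + M ^+ 2 * K * (`|a - b| + `|c - d|) * `|b - d|.
Proof.
move=> K0 CLg hK Ba Bb Bc Bd.
have CLg1 := CL_le (leqnSn 1) CLg.
pose al t := c + t *: (a - c); pose be t := d + t *: (b - d).
set C := (X in _ <= X).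
have Bal t : 0 <= t -> t <= 1 -> B (al t) by exact: segment.
have Bbe t : 0 <= t -> t <= 1 -> B (be t) by exact: segment.
have := @mean_value_inequality R (fun t => g (al t, z) - g (be t, z))
  (fun t => (\sum_l (a - c) 0 l * partial l g (al t, z)) - \sum_l (b - d) 0 l * partial l g (be t, z)) 1 0 C ler01.
rewrite /al /be !scale1r !scale0r !addr0 mul0r subr0 mulr1 [c + _]addrC [d + _]addrC !subrK.
apply => t t0 t1.
  by apply: is_deriveB; apply: line_derivative => //; [exact: Bal|exact: Bbe].
rewrite -/(al t) -/(be t) subr0.
have -> : (\sum_l (a - c) 0 l * partial l g (al t, z)) - \sum_l (b - d) 0 l * partial l g (be t, z) =
  (\sum_l (a - b - (c - d)) 0 l * partial l g (al t, z)) +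
  \sum_l (b - d) 0 l * (partial l g (al t, z) - partial l g (be t, z)).
  rewrite -sumrB -big_split; apply: eq_bigr => l _ /=; rewrite !mxE; ring.
apply: le_trans (ler_normD _ _) _; apply: lerD.
  apply: le_trans (dot_le (X := `|a - b - (c - d)|) (Y := K) cardp _ _ _ _) _ => //.
    by move=> l; apply: (hK [:: l]) => //; exact: Bal.
  by rewrite -/M [_ * K]mulrC mulrA.
have dist : `|al t - be t| <= `|c - d| + `|a - b|.
  apply: le_trans (norm_segment (c - d) (a - b) t0 t1).
  by rewrite /al /be opprD addrACA -scalerBr (subrACA a c).
apply: le_trans (dot_le (X := `|b - d|) (Y := M * K * (`|c - d| + `|a - b|)) cardp _ _ _ _) _ => //.
- move=> l; apply: le_trans (box_lipschitz K0 (CL_partial l CLg) (bounded_words_partial _ hK) (Bbe t t0 t1) (Bal t t0 t1)) _.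
  by rewrite ler_wpM2l// mulr_ge0.
- by rewrite !(mulr_ge0, addr_ge0).
by rewrite le_eqVlt; apply/orP; left; apply/eqP; rewrite -/M; ring.
Qed.

(** Base point and increment are interpolated simultaneously. After exchanging the mixed
    derivatives, the variation of the base point produces the first-order Taylor remainder of
    [partial l g], quadratic in the increment; the variation of the increment produces a difference
    of gradients. *)
Lemma box_remainder_lipschitz g K x y e e' : 0 <= K -> CL 3 U g -> bounded_words 3 g K ->
  B x -> B y -> B (x + e) -> B (y + e') ->
  `|(g (x + e, z) - g (x, z) - \sum_l e 0 l * partial l g (x, z)) -
    (g (y + e', z) - g (y, z) - \sum_l e' 0 l * partial l g (y, z))| <=
  M ^+ 3 * K * (`|e| + `|e'|) ^+ 2 * `|x - y| + M ^+ 2 * K * (`|e| + `|e'|) * `|e - e'|.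
Proof.
move=> K0 CLg hK Bx By Bxe Bye.
have CLg1 : CL 1 U g by exact: CL_le CLg.
have CLg2 : CL 2 U g by exact: CL_le CLg.
have hK2 : bounded_words 2 g K by exact: bounded_words_le hK.
pose X t := y + t *: (x - y); pose E t := e' + t *: (e - e').
set C := (Y in _ <= Y).
have BX t : 0 <= t -> t <= 1 -> B (X t) by exact: segment.
have XE t : X t + E t = (y + e') + t *: ((x + e) - (y + e')).
  by rewrite /X /E addrACA -scalerDr; congr (_ + _ *: _); rewrite opprD addrACA.
have BXE t : 0 <= t -> t <= 1 -> B (X t + E t) by move=> t0 t1; rewrite XE; exact: segment.
pose phi t : R^o := g (X t + E t, z) - g (X t, z) - \sum_l E t 0 l * partial l g (X t, z).
pose dphi t : R := (\sum_l ((x + e) - (y + e')) 0 l * partial l g (X t + E t, z)) -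
  (\sum_l (x - y) 0 l * partial l g (X t, z)) -
  \sum_l ((e - e') 0 l * partial l g (X t, z) + E t 0 l * (\sum_m (x - y) 0 m * partial m (partial l g) (X t, z))).
have X1 : X 1 = x by rewrite /X scale1r addrC subrK.
have E1 : E 1 = e by rewrite /E scale1r addrC subrK.
have X0 : X 0 = y by rewrite /X scale0r addr0.
have E0 : E 0 = e' by rewrite /E scale0r addr0.
have := @mean_value_inequality R phi dphi 1 0 C ler01.
rewrite /phi X1 X0 E1 E0 mul0r subr0 mulr1; apply => t t0 t1.
  apply: is_deriveB; first apply: is_deriveB.
  - have := @line_derivative g (y + e') ((x + e) - (y + e')) t CLg1.
    rewrite -XE => /(_ (BXE t t0 t1)) H.
    by have -> : (fun t => g (X t + E t, z)) = (fun t => g (y + e' + t *: (x + e - (y + e')), z))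
      by apply/funext => s; rewrite XE.
  - by apply: line_derivative => //; exact: BX.
  - apply: is_derive_sum_fun => l.
    have D1 : is_derive t 1 (fun t => E t 0 l : R^o) ((e - e') 0 l).
      have -> : (fun t => E t 0 l : R^o) = (fun t : R => e' 0 l + t * (e - e') 0 l).
        by apply/funext => s; rewrite !mxE.
      by apply: is_derive_eq; rewrite /GRing.scale/=; ring.
    have D2 : is_derive t 1 (fun t => partial l g (X t, z)) (\sum_m (x - y) 0 m * partial m (partial l g) (X t, z)).
      by apply: line_derivative; [exact: CL_partial|exact: BX].
    have := is_deriveM D1 D2; rewrite /GRing.scale /= => H.
    by rewrite addrC [(e - e') 0 l * _]mulrC.
rewrite subr0.
have -> : dphi t = (\sum_l (x - y) 0 l * (partial l g (X t + E t, z) - partial l g (X t, z) -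
      \sum_m E t 0 m * partial m (partial l g) (X t, z))) +
    \sum_l (e - e') 0 l * (partial l g (X t + E t, z) - partial l g (X t, z)).
  have swap : \sum_l E t 0 l * (\sum_m (x - y) 0 m * partial m (partial l g) (X t, z)) =
     \sum_l (x - y) 0 l * (\sum_m E t 0 m * partial m (partial l g) (X t, z)).
    under eq_bigr do rewrite mulr_sumr.
    rewrite exchange_big /=; apply: eq_bigr => l _; rewrite mulr_sumr; apply: eq_bigr => m _.
    rewrite (partial_commute l m oU CLg2 (BU (BX t t0 t1))); ring.
  rewrite /dphi big_split /= swap -big_split -!sumrB -!big_split; apply: eq_bigr => l _ /=.
  rewrite !mxE; ring.
have normE : `|E t| <= `|e| + `|e'| by rewrite addrC; exact: norm_segment.
have EE : X t + E t - X t = E t by rewrite addrAC subrr add0r.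
apply: le_trans (ler_normD _ _) _; apply: lerD.
  apply: le_trans (dot_le (X := `|x - y|) (Y := M ^+ 2 * K * (`|e| + `|e'|) ^+ 2) cardp _ _ _ _) _ => //.
  - move=> l; rewrite -{2}EE.
    apply: le_trans (box_taylor1 K0 (CL_partial l CLg) (bounded_words_partial _ hK) (BX t t0 t1) (BXE t t0 t1)) _.
    rewrite EE ler_wpM2l ?mulr_ge0 ?exprn_ge0// lerXn2r ?nnegrE ?addr_ge0//.
  - by rewrite !(mulr_ge0, exprn_ge0, addr_ge0).
  by rewrite le_eqVlt; apply/orP; left; apply/eqP; rewrite -/M; ring.
apply: le_trans (dot_le (X := `|e - e'|) (Y := M * K * (`|e| + `|e'|)) cardp _ _ _ _) _ => //.
- move=> l.
  apply: le_trans (box_lipschitz K0 _ (bounded_words_partial l hK2) (BX t t0 t1) (BXE t t0 t1)) _.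
    exact: CL_le (CL_partial l CLg).
  by rewrite EE ler_wpM2l ?mulr_ge0.
- by rewrite !(mulr_ge0, addr_ge0).
by rewrite le_eqVlt; apply/orP; left; apply/eqP; rewrite -/M; ring.
Qed.

End box.

(** * Davie's scheme on a plaque *)

Lemma sum_option (V : nmodType) (I : finType) (F : option I -> V) :
  \sum_J F J = F None + \sum_i F (Some i).
Proof.
rewrite (bigD1 None)//=; congr (_ + _).
rewrite (reindex_omap Some id)/=; last by case.
by apply: eq_bigl => i; rewrite eqxx.
Qed.

Section davie_step.
Context {R : realType} {p d : nat} {W : topologicalType}.
Local Notation fn := ('rV[R]_p * W -> R^o).

Definition lie (c : 'I_p -> fn) (g : fn) : fn := fun q => \sum_l c l q * partial l g q.

(* Second-level weights are indexed by the pairs (j, k) of driving components,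
   with None for the drift term. *)
Definition second_coef (c : 'I_d -> 'I_p -> fn) (c0 : 'I_p -> fn)
    (J : option ('I_d * 'I_d)) : 'I_p -> fn :=
  if J is Some jk then fun l => lie (c jk.1) (c jk.2 l) else c0.

Definition davie_incr (c1 : 'I_d -> 'I_p -> fn) (c2 : option ('I_d * 'I_d) -> 'I_p -> fn) (z : W)
    (w1 : 'I_d -> R) (w2 : option ('I_d * 'I_d) -> R) (y : 'rV[R]_p) : 'rV[R]_p :=
  \row_l (\sum_i w1 i * c1 i l (y, z) + \sum_J w2 J * c2 J l (y, z)).

End davie_step.

Section davie_estimates.
Context {R : realType} {p d : nat} {W : topologicalType}.
Local Notation fn := ('rV[R]_p * W -> R^o).
Local Notation J2 := (option ('I_d * 'I_d)).
Variables (U : set ('rV[R]_p * W)) (z : W) (B : set 'rV[R]_p) (N : nat).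
Hypotheses (oU : open U) (pN : (p <= N)%N) (dN : (d <= N)%N) (JN : (#|{: J2}| <= N)%N).
Hypothesis B_convex : forall a b t, B a -> B b -> 0 <= t -> t <= 1 -> B (a + t *: (b - a)).
Hypothesis BU : forall y, B y -> U (y, z).
Variables (c1 : 'I_d -> 'I_p -> fn) (c0 : 'I_p -> fn) (K : R).
Hypothesis K0 : 0 <= K.
Let c2 := second_coef c1 c0.
Hypothesis CLc1 : forall i l, CL 3 U (c1 i l).
Hypothesis CLc2 : forall J l, CL 2 U (c2 J l).
Hypothesis bc1 : forall i l, bounded_words z B 3 (c1 i l) K.
Hypothesis bc2 : forall J l, bounded_words z B 2 (c2 J l) K.
Let M : R := N%:R.
Let M0 : 0 <= M. Proof. by []. Qed.
Let cd : (#|'I_d| <= N)%N. Proof. by rewrite card_ord. Qed.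
Let cp : (#|'I_p| <= N)%N. Proof. by rewrite card_ord. Qed.

Local Notation incr := (davie_incr c1 c2 z).

Section one_step.
(** The weights of one step are kept abstract. The exponent of [eta] counts the order, and
    [eta <= 1] lets second-level terms be bounded like first-level ones. *)
Variables (w1 : 'I_d -> R) (w2 : J2 -> R) (eta : R).
Hypotheses (eta0 : 0 <= eta) (eta1 : eta <= 1).
Hypothesis w1_le : forall i, `|w1 i| <= eta.
Hypothesis w2_le : forall J, `|w2 J| <= eta ^+ 2.

Let eta2 : eta ^+ 2 <= eta. Proof. by rewrite expr2 ler_piMl. Qed.

Let two_sums X (x1 : 'I_d -> R) (x2 : J2 -> R) : 0 <= X ->
  (forall i, `|x1 i| <= X) -> (forall J, `|x2 J| <= X) ->
  `|\sum_i w1 i * x1 i + \sum_J w2 J * x2 J| <= 2 * M * eta * X.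
Proof.
move=> X0 h1 h2; apply: le_trans (ler_normD _ _) _.
have E1 := dot_le cd w1_le h1 eta0 X0.
have E2 := dot_le JN w2_le h2 (exprn_ge0 _ eta0) X0.
apply: le_trans (lerD E1 E2) _.
rewrite (_ : 2 * M * eta * X = M * (eta * X) + M * (eta * X)); last by ring.
by rewrite lerD2l ler_wpM2l// ler_wpM2r.
Qed.

Lemma incr_bound y : B y -> `|incr w1 w2 y| <= 2 * M * eta * K.
Proof.
move=> By; apply: mx_norm_le => [|a l]; first by rewrite !mulr_ge0.
rewrite mxE; apply: two_sums => // [i|J].
  exact: bounded_words0 (bc1 i l) By.
exact: bounded_words0 (bc2 J l) By.
Qed.

Lemma incr_lip y y' : B y -> B y' ->
  `|incr w1 w2 y - incr w1 w2 y'| <= 2 * M * eta * (M * K * `|y - y'|).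
Proof.
move=> By By'; apply: mx_norm_le => [|a l]; first by rewrite !mulr_ge0.
rewrite !mxE opprD addrACA -!sumrB.
under eq_bigr do rewrite -mulrBr; under [X in _ + X]eq_bigr do rewrite -mulrBr.
apply: two_sums => [|i|J]; first by rewrite !mulr_ge0.
  have CL1 : CL 1 U (c1 i l) by exact: CL_le (CLc1 i l).
  exact: (box_lipschitz oU pN B_convex BU K0 CL1 (bounded_words_le (leqW (leqnSn 1)) (bc1 i l))).
have CL1 : CL 1 U (c2 J l) by exact: CL_le (CLc2 J l).
exact: (box_lipschitz oU pN B_convex BU K0 CL1 (bounded_words_le (leqnSn 1) (bc2 J l))).
Qed.

Lemma incr_4point x1 x2 x3 x4 : B x1 -> B x2 -> B x3 -> B x4 ->
  `|incr w1 w2 x1 - incr w1 w2 x2 - (incr w1 w2 x3 - incr w1 w2 x4)| <=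
  2 * M * eta * (M * K * `|x1 - x2 - (x3 - x4)| +
                 M ^+ 2 * K * (`|x1 - x2| + `|x3 - x4|) * `|x2 - x4|).
Proof.
move=> B1 B2 B3 B4.
have C0 : 0 <= M * K * `|x1 - x2 - (x3 - x4)| +
                 M ^+ 2 * K * (`|x1 - x2| + `|x3 - x4|) * `|x2 - x4|.
  by rewrite !(mulr_ge0, addr_ge0, exprn_ge0).
apply: mx_norm_le => [|a l]; first by rewrite !mulr_ge0.
rewrite !mxE.
rewrite [X in `|X|](_ : _ =
  \sum_i w1 i * (c1 i l (x1, z) - c1 i l (x2, z) - (c1 i l (x3, z) - c1 i l (x4, z))) +
  \sum_J w2 J * (c2 J l (x1, z) - c2 J l (x2, z) - (c2 J l (x3, z) - c2 J l (x4, z)))); last first.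
  have lin (I : finType) (w : I -> R) (f1 f2 f3 f4 : I -> R) :
     \sum_i w i * (f1 i - f2 i - (f3 i - f4 i)) =
     \sum_i w i * f1 i - \sum_i w i * f2 i - (\sum_i w i * f3 i - \sum_i w i * f4 i).
    by rewrite -!sumrB; apply: eq_bigr => i _; rewrite !mulrBr.
  by rewrite !lin; ring.
apply: two_sums => // [i|J].
  have CL2 : CL 2 U (c1 i l) by exact: CL_le (CLc1 i l).
  exact: (box_4point oU pN B_convex BU K0 CL2 (bounded_words_le (leqnSn 2) (bc1 i l))).
exact: (box_4point oU pN B_convex BU K0 (CLc2 J l) (bc2 J l)).
Qed.

Let incrK y : y + incr w1 w2 y - y = incr w1 w2 y.
Proof. by rewrite addrC addKr. Qed.

Definition first_incr (y : 'rV[R]_p) l : R := \sum_i w1 i * c1 i l (y, z).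
Definition second_incr (y : 'rV[R]_p) l : R := \sum_J w2 J * c2 J l (y, z).

Lemma incrE y l : incr w1 w2 y 0 l = first_incr y l + second_incr y l.
Proof. by rewrite mxE. Qed.

Lemma first_incr_le y l : B y -> `|first_incr y l| <= M * (eta * K).
Proof. by move=> By; apply: dot_le => // i; exact: bounded_words0 (bc1 i l) By. Qed.

Lemma second_incr_le y l : B y -> `|second_incr y l| <= M * (eta ^+ 2 * K).
Proof.
move=> By; apply: dot_le => // [J|]; last exact: exprn_ge0.
exact: bounded_words0 (bc2 J l) By.
Qed.

Lemma second_incr_lip y y' l : B y -> B y' ->
  `|second_incr y l - second_incr y' l| <= M * (eta ^+ 2 * (M * K * `|y - y'|)).
Proof.
move=> By By'; rewrite -sumrB; under eq_bigr do rewrite -mulrBr.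
apply: dot_le => // [J||]; last 2 first.
- exact: exprn_ge0.
- by rewrite !mulr_ge0.
have CL1 : CL 1 U (c2 J l) by exact: CL_le (CLc2 J l).
exact: (box_lipschitz oU pN B_convex BU K0 CL1 (bounded_words_le (leqnSn 1) (bc2 J l))).
Qed.

Lemma ito1 (f : fn) Kf y : 0 <= Kf -> CL 1 U f -> bounded_words z B 1 f Kf ->
  B y -> B (y + incr w1 w2 y) ->
  `|f (y + incr w1 w2 y, z) - f (y, z)| <= 2 * M ^+ 2 * Kf * K * eta.
Proof.
move=> Kf0 CLf bf By By'.
apply: le_trans (box_lipschitz oU pN B_convex BU Kf0 CLf bf By By') _.
rewrite incrK.
apply: le_trans (ler_wpM2l _ (incr_bound By)) _; first by rewrite mulr_ge0.
by rewrite le_eqVlt; apply/orP; left; apply/eqP; rewrite -/M; ring.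
Qed.

Lemma lie_first (f : fn) y : \sum_i w1 i * lie (c1 i) f (y, z) = \sum_l first_incr y l * partial l f (y, z).
Proof.
under eq_bigr do rewrite /lie mulr_sumr.
rewrite exchange_big /=; apply: eq_bigr => l _; rewrite /first_incr mulr_suml.
by apply: eq_bigr => i _; rewrite mulrA.
Qed.

Lemma ito2 (f : fn) Kf y : 0 <= Kf -> CL 2 U f -> bounded_words z B 2 f Kf ->
  B y -> B (y + incr w1 w2 y) ->
  `|f (y + incr w1 w2 y, z) - f (y, z) - \sum_i w1 i * lie (c1 i) f (y, z)| <=
  (4 * M ^+ 4 * Kf * K ^+ 2 + M ^+ 2 * Kf * K) * eta ^+ 2.
Proof.
move=> Kf0 CLf bf By By'.
have E1 := box_taylor1 oU pN B_convex BU Kf0 CLf bf By By'.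
rewrite !incrK in E1.
rewrite lie_first.
rewrite [X in `|X|](_ : _ = f (y + incr w1 w2 y, z) - f (y, z) - (\sum_l incr w1 w2 y 0 l * partial l f (y, z))
   + \sum_l second_incr y l * partial l f (y, z)); last first.
  have -> : \sum_l incr w1 w2 y 0 l * partial l f (y, z) =
      \sum_l first_incr y l * partial l f (y, z) + \sum_l second_incr y l * partial l f (y, z).
    by rewrite -big_split; apply: eq_bigr => l _; rewrite incrE mulrDl.
  by ring.
apply: le_trans (ler_normD _ _) _.
have E2 : `|\sum_l second_incr y l * partial l f (y, z)| <= M * (M * (eta ^+ 2 * K) * Kf).
  apply: (dot_le cp) => //; last by rewrite !mulr_ge0// exprn_ge0.
    by move=> l; exact: second_incr_le.
  by move=> l; exact: (bf [:: l]).
apply: le_trans (lerD E1 E2) _.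
have E3 : `|incr w1 w2 y| ^+ 2 <= (2 * M * eta * K) ^+ 2.
  by rewrite lerXn2r ?nnegrE ?mulr_ge0//; exact: incr_bound.
apply: le_trans (lerD (ler_wpM2l _ E3) (lexx _)) _; first by rewrite mulr_ge0// exprn_ge0.
by rewrite le_eqVlt; apply/orP; left; apply/eqP; rewrite -/M; ring.
Qed.

Let dist_incr x x' : x + incr w1 w2 x - x - (x' + incr w1 w2 x' - x') = incr w1 w2 x - incr w1 w2 x'.
Proof. by rewrite !incrK. Qed.

Lemma ito1_lip (f : fn) Kf y y' : 0 <= Kf -> CL 2 U f -> bounded_words z B 2 f Kf ->
  B y -> B (y + incr w1 w2 y) -> B y' -> B (y' + incr w1 w2 y') ->
  `|f (y + incr w1 w2 y, z) - f (y, z) - (f (y' + incr w1 w2 y', z) - f (y', z))| <=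
  6 * M ^+ 3 * Kf * K * eta * `|y - y'|.
Proof.
move=> Kf0 CLf bf By Bx By' Bx'.
apply: le_trans (box_4point oU pN B_convex BU Kf0 CLf bf Bx By Bx' By') _.
rewrite dist_incr !incrK.
have E1 := incr_lip By By'.
have E2 := lerD (incr_bound By) (incr_bound By').
have E3 := ler_wpM2l (mulr_ge0 M0 Kf0) E1.
have E4 := ler_wpM2l (mulr_ge0 (exprn_ge0 2 M0) Kf0) E2.
have E5 := ler_wpM2r (normr_ge0 (y - y')) E4.
apply: le_trans (lerD E3 E5) _.
by rewrite le_eqVlt; apply/orP; left; apply/eqP; rewrite -/M; ring.
Qed.

(** Splitting off the second-level part [S] of the increment leaves exactly a first-order Taylor
    remainder, covered by [box_remainder_lipschitz]; [S] is already quadratic in [eta] and Lipschitz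
    in the base point. *)
Lemma ito2_lip (f : fn) Kf y y' : 0 <= Kf -> CL 3 U f -> bounded_words z B 3 f Kf ->
  B y -> B (y + incr w1 w2 y) -> B y' -> B (y' + incr w1 w2 y') ->
  `|f (y + incr w1 w2 y, z) - f (y, z) - \sum_i w1 i * lie (c1 i) f (y, z) -
    (f (y' + incr w1 w2 y', z) - f (y', z) - \sum_i w1 i * lie (c1 i) f (y', z))| <=
  (24 * M ^+ 5 * Kf * K ^+ 2 + 2 * M ^+ 3 * Kf * K) * eta ^+ 2 * `|y - y'|.
Proof.
move=> Kf0 CLf bf By Bx By' Bx'.
have E1 := box_remainder_lipschitz oU pN B_convex BU Kf0 CLf bf By By' Bx Bx'.
have split_first x : \sum_l incr w1 w2 x 0 l * partial l f (x, z) =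
      \sum_l first_incr x l * partial l f (x, z) + \sum_l second_incr x l * partial l f (x, z).
  by rewrite -big_split; apply: eq_bigr => l _; rewrite incrE mulrDl.
rewrite !split_first in E1; rewrite !lie_first.
set A := f (y + _, z) - _ in E1 *; set A' := f (y' + _, z) - _ in E1 *.
set F := \sum_l first_incr y l * _ in E1 *; set F' := \sum_l first_incr y' l * _ in E1 *.
set S := \sum_l second_incr y l * _ in E1; set S' := \sum_l second_incr y' l * _ in E1.
have -> : A - F - (A' - F') = (A - (F + S) - (A' - (F' + S'))) + (S - S') by ring.
have E2 : `|S - S'| <= M * (M * (eta ^+ 2 * (M * K * `|y - y'|)) * Kf) +
    M * (M * (eta ^+ 2 * K) * (M * Kf * `|y - y'|)).
  have -> : S - S' = \sum_l (second_incr y l - second_incr y' l) * partial l f (y, z) +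
     \sum_l second_incr y' l * (partial l f (y, z) - partial l f (y', z)).
    rewrite /S /S' -sumrB -big_split; apply: eq_bigr => l _ /=; ring.
  apply: le_trans (ler_normD _ _) _; apply: lerD; apply: (dot_le cp) => //.
  - by move=> l; exact: second_incr_lip.
  - by move=> l; exact: (bf [:: l]).
  - by rewrite !mulr_ge0// exprn_ge0.
  - by move=> l; exact: second_incr_le.
  - move=> l; have CL1 : CL 1 U (partial l f) by exact: CL_le (CL_partial l CLf).
    exact: (box_lipschitz oU pN B_convex BU Kf0 CL1 (bounded_words_le (leqnSn 1) (bounded_words_partial l bf))).
  - by rewrite !mulr_ge0// exprn_ge0.
  - by rewrite !mulr_ge0.
have E3 := lerD (incr_bound By) (incr_bound By').
have E4 := incr_lip By By'.
have n0 := normr_ge0 (y - y').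
have E5 : (`|incr w1 w2 y| + `|incr w1 w2 y'|) ^+ 2 <= (2 * M * eta * K + 2 * M * eta * K) ^+ 2.
  by rewrite lerXn2r ?nnegrE ?addr_ge0 ?mulr_ge0.
have E6 := ler_wpM2r n0 (ler_wpM2l (mulr_ge0 (exprn_ge0 3 M0) Kf0) E5).
have E7 : M ^+ 2 * Kf * (`|incr w1 w2 y| + `|incr w1 w2 y'|) * `|incr w1 w2 y - incr w1 w2 y'| <=
   M ^+ 2 * Kf * (2 * M * eta * K + 2 * M * eta * K) * (2 * M * eta * (M * K * `|y - y'|)).
  apply: ler_pM => //; first by rewrite !mulr_ge0 ?addr_ge0// exprn_ge0.
  by rewrite ler_wpM2l// mulr_ge0// exprn_ge0.
apply: le_trans (ler_normD _ _) _.
apply: le_trans (lerD (le_trans E1 (lerD E6 E7)) E2) _.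
by rewrite le_eqVlt; apply/orP; left; apply/eqP; rewrite -/M; ring.
Qed.

Hypothesis w_symmetric : forall j k, w2 (Some (j, k)) + w2 (Some (k, j)) = w1 j * w1 k.

Definition second_lie (f : fn) (J : J2) : fn :=
  if J is Some jk then lie (c1 jk.1) (lie (c1 jk.2) f) else lie c0 f.

(** The Leibniz rule: the first sum is what [second_coef] contributes to the step, the second is a
    Hessian term to be matched with the quadratic Taylor term. *)
Lemma lie_lie (f : fn) j k y : CL 2 U f -> B y ->
  lie (c1 j) (lie (c1 k) f) (y, z) =
  \sum_l c2 (Some (j, k)) l (y, z) * partial l f (y, z) +
  \sum_l c1 j l (y, z) * (\sum_m c1 k m (y, z) * partial l (partial m f) (y, z)).
Proof.
move=> CLf By; have Uy := BU By.
have dsum l : partial l (lie (c1 k) f) (y, z) =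
    \sum_m (c1 k m (y, z) * partial l (partial m f) (y, z) + partial l (c1 k m) (y, z) * partial m f (y, z)).
  have cl m : CL 1 U (fun q => c1 k m q * partial m f q : R^o).
    by apply: CLM => //; [exact: CL_le (CLc1 k m)|exact: CL_partial].
  have -> : partial l (lie (c1 k) f) (y, z) = \sum_m partial l (fun q => c1 k m q * partial m f q : R^o) (y, z).
    have [_ <-] : is_derive y (delta_mx 0 l) (fun y => lie (c1 k) f (y, z))
        (\sum_m partial l (fun q => c1 k m q * partial m f q : R^o) (y, z)).
      have -> : (fun y => lie (c1 k) f (y, z)) = \sum_m (fun y => c1 k m (y, z) * partial m f (y, z) : R^o).
        by apply/funext => x; rewrite fct_sumE.
      apply: is_derive_sum => m; apply: derivableP.
      exact: (CL_derivable (cl m) Uy).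
    by [].
  apply: eq_bigr => m _; rewrite (@partialM _ _ _ U)//; first exact: CL_le (CLc1 k m).
  exact: CL_partial.
rewrite {1}/lie; under eq_bigr do rewrite dsum big_split /= mulrDr.
rewrite big_split /= addrC; congr (_ + _).
under eq_bigr do rewrite mulr_sumr.
rewrite exchange_big /=; apply: eq_bigr => m _; rewrite /lie mulr_suml.
by apply: eq_bigr => l _; rewrite mulrA.
Qed.

(* The symmetry of the second-level weights turns the quadratic Taylor term into
   their symmetric part; the drift and the iterated Lie derivatives make up the rest. *)
Lemma ito3 (f : fn) Kf y : 0 <= Kf -> CL 3 U f -> bounded_words z B 3 f Kf ->
  B y -> B (y + incr w1 w2 y) ->
  `|f (y + incr w1 w2 y, z) - f (y, z) - \sum_i w1 i * lie (c1 i) f (y, z)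
     - \sum_J w2 J * second_lie f J (y, z)| <=
  (8 * M ^+ 6 * Kf * K ^+ 3 + 3 * M ^+ 4 * Kf * K ^+ 2) * eta ^+ 3.
Proof.
move=> Kf0 CLf bf By By'.
have CLf2 : CL 2 U f by exact: CL_le CLf.
have E1 := box_taylor2 oU pN B_convex BU Kf0 CLf bf By By'.
rewrite !incrK in E1.
set Dl := incr w1 w2 y in E1 *.
pose H l m := partial m (partial l f) (y, z).
have Hsym l m : H l m = H m l by exact: (partial_commute m l oU CLf2 (BU By)).
have Hle l m : `|H l m| <= Kf by apply: (bf [:: m; l]).
pose a := first_incr y; pose b := second_incr y.
have aE l : `|a l| <= M * (eta * K) by exact: first_incr_le.
have bE l : `|b l| <= M * (eta ^+ 2 * K) by exact: second_incr_le.
have DlE l : Dl 0 l = a l + b l by exact: incrE.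
pose S : R := \sum_l a l * \sum_m a m * H l m.
(* [Q j k] is symmetric because the Hessian is. Replacing [w1 j * w1 k] by the two second-level
   weights therefore gives the same double sum twice. *)
have S_E : S / 2 = \sum_j \sum_k w2 (Some (j, k)) *
    \sum_l c1 j l (y, z) * (\sum_m c1 k m (y, z) * partial l (partial m f) (y, z)).
  pose Q j k : R := \sum_l c1 j l (y, z) * (\sum_m c1 k m (y, z) * partial l (partial m f) (y, z)).
  have Qsym j k : Q j k = Q k j.
    rewrite /Q; under eq_bigr do rewrite mulr_sumr.
    rewrite exchange_big /=; apply: eq_bigr => l _; rewrite mulr_sumr; apply: eq_bigr => m _.
    by rewrite -/(H _ _) -/(H _ _) Hsym; ring.
  have -> : S = \sum_j \sum_k (w1 j * w1 k) * Q j k.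
    rewrite /S /a /first_incr.
    under eq_bigr do rewrite mulr_suml.
    rewrite exchange_big /=; apply: eq_bigr => j _.
    under eq_bigr => l _.
      rewrite mulr_sumr.
      under eq_bigr do rewrite mulr_suml mulr_sumr.
      rewrite exchange_big /=.
      over.
    rewrite exchange_big /=; apply: eq_bigr => k _.
    rewrite /Q mulr_sumr; apply: eq_bigr => l _; rewrite !mulr_sumr; apply: eq_bigr => m _.
    by rewrite Hsym /H; ring.
  under eq_bigr do under eq_bigr do rewrite -w_symmetric mulrDl.
  under eq_bigr do rewrite big_split /=.
  rewrite big_split /= [X in _ + X]exchange_big /=.
  rewrite [X in _ + X](_ : _ = \sum_j \sum_k w2 (Some (j, k)) * Q j k); last first.
    by apply: eq_bigr => j _; apply: eq_bigr => k _; rewrite Qsym.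
  by rewrite -mulr2n -[_ *+ 2]mulr_natr mulfK.
have second_E : \sum_J w2 J * second_lie f J (y, z) = \sum_l b l * partial l f (y, z) + S / 2.
  have -> : \sum_l b l * partial l f (y, z) = \sum_J w2 J * \sum_l c2 J l (y, z) * partial l f (y, z).
    rewrite /b /second_incr; under eq_bigr do rewrite mulr_suml.
    rewrite exchange_big /=; apply: eq_bigr => J _; rewrite mulr_sumr; apply: eq_bigr => l _.
    by rewrite mulrA.
  rewrite S_E !sum_option -addrA; congr (_ + _).
  rewrite (pair_bigA _ (fun j k => w2 (Some (j, k)) * \sum_l c1 j l (y, z) * _)) /=.
  rewrite -big_split /=; apply: eq_bigr => -[j k] _ /=.
  by rewrite -mulrDr lie_lie.
rewrite lie_first second_E -/a.
pose T : R := \sum_l Dl 0 l * \sum_m Dl 0 m * H l m.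
have ab l : `|\sum_m a m * H l m| <= M * (M * (eta * K) * Kf).
  by apply: (dot_le cp) => //; rewrite !mulr_ge0.
have bb l : `|\sum_m b m * H l m| <= M * (M * (eta ^+ 2 * K) * Kf).
  by apply: (dot_le cp) => //; rewrite !mulr_ge0// exprn_ge0.
(* [T] is the Hessian form at the full increment and [S] at its first-level part; every term of the
   difference contains a second-level factor and is at least cubic in [eta]. *)
have ST : `|T - S| <= 3 * M ^+ 4 * Kf * K ^+ 2 * eta ^+ 3.
  have -> : T - S = \sum_l a l * (\sum_m b m * H l m) + \sum_l b l * (\sum_m a m * H l m)
      + \sum_l b l * (\sum_m b m * H l m).
    rewrite /T /S -sumrB -!big_split /=; apply: eq_bigr => l _.
    have -> : \sum_m Dl 0 m * H l m = \sum_m a m * H l m + \sum_m b m * H l m.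
      by rewrite -big_split; apply: eq_bigr => m _; rewrite DlE mulrDl.
    by rewrite DlE; ring.
  have e2 : 0 <= eta ^+ 2 by exact: exprn_ge0.
  have F1 := dot_le cp aE bb (mulr_ge0 M0 (mulr_ge0 eta0 K0))
    (mulr_ge0 M0 (mulr_ge0 (mulr_ge0 M0 (mulr_ge0 e2 K0)) Kf0)).
  have F2 := dot_le cp bE ab (mulr_ge0 M0 (mulr_ge0 e2 K0))
    (mulr_ge0 M0 (mulr_ge0 (mulr_ge0 M0 (mulr_ge0 eta0 K0)) Kf0)).
  have F3 := dot_le cp bE bb (mulr_ge0 M0 (mulr_ge0 e2 K0))
    (mulr_ge0 M0 (mulr_ge0 (mulr_ge0 M0 (mulr_ge0 e2 K0)) Kf0)).
  apply: le_trans (ler_normD _ _) _; apply: le_trans (lerD (ler_normD _ _) F3) _.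
  apply: le_trans (lerD (lerD F1 F2) (lexx _)) _.
  rewrite -/M [leLHS](_ : _ = M ^+ 4 * Kf * K ^+ 2 * (2 * eta ^+ 3 + eta ^+ 4)); last by ring.
  rewrite [leRHS](_ : _ = M ^+ 4 * Kf * K ^+ 2 * (2 * eta ^+ 3 + eta ^+ 3)); last by ring.
  rewrite ler_wpM2l ?mulr_ge0 ?exprn_ge0// lerD2l exprS ler_piMl// exprn_ge0//.
rewrite [X in `|X|](_ : _ = (f (y + Dl, z) - f (y, z) - \sum_l Dl 0 l * partial l f (y, z) - T / 2)
   + (T - S) / 2); last first.
  have -> : \sum_l Dl 0 l * partial l f (y, z) = \sum_l a l * partial l f (y, z) + \sum_l b l * partial l f (y, z).
    by rewrite -big_split; apply: eq_bigr => l _; rewrite DlE mulrDl.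
  by field.
have E3 : `|Dl| ^+ 3 <= (2 * M * eta * K) ^+ 3.
  by rewrite lerXn2r ?nnegrE ?mulr_ge0//; exact: incr_bound.
have ST2 : `|(T - S) / 2| <= 3 * M ^+ 4 * Kf * K ^+ 2 * eta ^+ 3.
  by rewrite normrM [`|2^-1|]ger0_norm//; apply: le_trans ST; rewrite ler_piMr// invf_le1// ler1n.
apply: le_trans (ler_normD _ _) _.
apply: le_trans (lerD (le_trans E1 (ler_wpM2l _ E3)) ST2) _; first by rewrite mulr_ge0// exprn_ge0.
by rewrite le_eqVlt; apply/orP; left; apply/eqP; rewrite -/M; ring.
Qed.

End one_step.

Section two_steps.
Variables (u1 v1 w1 : 'I_d -> R) (u2 v2 w2 : J2 -> R) (eta : R).
Hypotheses (eta0 : 0 <= eta) (eta1 : eta <= 1).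
Hypothesis u1_le : forall i, `|u1 i| <= eta.
Hypothesis u2_le : forall J, `|u2 J| <= eta ^+ 2.
Hypothesis v1_le : forall i, `|v1 i| <= eta.
Hypothesis v2_le : forall J, `|v2 J| <= eta ^+ 2.
Hypothesis chen1 : forall i, w1 i = u1 i + v1 i.
Hypothesis chen2 : forall J, w2 J = u2 J + v2 J + if J is Some jk then u1 jk.1 * v1 jk.2 else 0.

Definition davie_defect y :=
  (y + incr u1 u2 y) + incr v1 v2 (y + incr u1 u2 y) - (y + incr w1 w2 y).

Lemma davie_defectE y l : davie_defect y 0 l =
  \sum_k v1 k * (c1 k l (y + incr u1 u2 y, z) - c1 k l (y, z) - \sum_i u1 i * lie (c1 i) (c1 k l) (y, z)) +
  \sum_J v2 J * (c2 J l (y + incr u1 u2 y, z) - c2 J l (y, z)).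
Proof.
rewrite /davie_defect; set x := y + incr u1 u2 y.
have -> : (x + incr v1 v2 x - (y + incr w1 w2 y)) 0 l = incr u1 u2 y 0 l + incr v1 v2 x 0 l - incr w1 w2 y 0 l.
  rewrite {1}/x !mxE; ring.
rewrite !mxE.
have -> : \sum_i w1 i * c1 i l (y, z) = \sum_i u1 i * c1 i l (y, z) + \sum_i v1 i * c1 i l (y, z).
  by rewrite -big_split; apply: eq_bigr => i _; rewrite chen1 mulrDl.
have -> : \sum_J w2 J * c2 J l (y, z) = \sum_J u2 J * c2 J l (y, z) + \sum_J v2 J * c2 J l (y, z) +
    \sum_k v1 k * \sum_i u1 i * lie (c1 i) (c1 k l) (y, z).
  have -> : \sum_k v1 k * (\sum_i u1 i * lie (c1 i) (c1 k l) (y, z)) =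
      \sum_J (if J is Some jk then u1 jk.1 * v1 jk.2 else 0) * c2 J l (y, z).
    rewrite sum_option mul0r add0r.
    rewrite -(pair_bigA _ (fun j k => u1 j * v1 k * c2 (Some (j, k)) l (y, z))) /= exchange_big /=.
    apply: eq_bigr => k _; rewrite mulr_sumr; apply: eq_bigr => j _.
    by rewrite /c2 /=; ring.
  by rewrite -!big_split; apply: eq_bigr => J _ /=; rewrite chen2 !mulrDl.
under [X in _ = X + _]eq_bigr do rewrite !mulrBr.
under [X in _ = _ + X]eq_bigr do rewrite mulrBr.
by rewrite !sumrB; ring.
Qed.

Lemma davie_defect_le y : B y -> B (y + incr u1 u2 y) ->
  `|davie_defect y| <= M * (4 * M ^+ 4 * K ^+ 3 + 3 * M ^+ 2 * K ^+ 2) * eta ^+ 3.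
Proof.
move=> By Bx; have e2 := exprn_ge0 2 eta0; have e3 := exprn_ge0 3 eta0.
have K3 n : 0 <= K ^+ n by exact: exprn_ge0.
have Mn n : 0 <= M ^+ n by exact: exprn_ge0.
apply: mx_norm_le => [|a l]; first by rewrite !(mulr_ge0, addr_ge0).
rewrite ord1 davie_defectE.
have E1 := @dot_le _ _ _ v1 _ _ _ cd v1_le (fun k =>
  ito2 eta0 eta1 u1_le u2_le K0 (CL_le (leqnSn 2) (CLc1 k l)) (bounded_words_le (leqnSn 2) (bc1 k l)) By Bx) eta0.
have E2 := @dot_le _ _ _ v2 _ _ _ JN v2_le (fun J =>
  ito1 eta0 eta1 u1_le u2_le K0 (CL_le (leqnSn 1) (CLc2 J l)) (bounded_words_le (leqnSn 1) (bc2 J l)) By Bx) e2.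
apply: le_trans (ler_normD _ _) _; apply: le_trans (lerD (E1 _) (E2 _)) _.
- by rewrite !(mulr_ge0, addr_ge0).
- by rewrite !(mulr_ge0, addr_ge0).
by rewrite le_eqVlt; apply/orP; left; apply/eqP; rewrite -/M; ring.
Qed.

Lemma davie_defect_lip y y' : B y -> B (y + incr u1 u2 y) -> B y' -> B (y' + incr u1 u2 y') ->
  `|davie_defect y - davie_defect y'| <=
  M * (24 * M ^+ 5 * K ^+ 3 + 8 * M ^+ 3 * K ^+ 2) * eta ^+ 3 * `|y - y'|.
Proof.
move=> By Bx By' Bx'; have e2 := exprn_ge0 2 eta0; have e3 := exprn_ge0 3 eta0.
have K3 n : 0 <= K ^+ n by exact: exprn_ge0.
have Mn n : 0 <= M ^+ n by exact: exprn_ge0.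
apply: mx_norm_le => [|a l]; first by rewrite !(mulr_ge0, addr_ge0).
have -> : (davie_defect y - davie_defect y') a l = davie_defect y 0 l - davie_defect y' 0 l.
  by rewrite ord1 [LHS]mxE [X in _ + X]mxE.
rewrite !davie_defectE opprD addrACA -!sumrB.
under eq_bigr do rewrite -mulrBr; under [X in _ + X]eq_bigr do rewrite -mulrBr.
have E1 := @dot_le _ _ _ v1 _ _ _ cd v1_le (fun k =>
  ito2_lip eta0 eta1 u1_le u2_le K0 (CLc1 k l) (bc1 k l) By Bx By' Bx') eta0.
have E2 := @dot_le _ _ _ v2 _ _ _ JN v2_le (fun J =>
  ito1_lip eta0 eta1 u1_le u2_le K0 (CLc2 J l) (bc2 J l) By Bx By' Bx') e2.
apply: le_trans (ler_normD _ _) _; apply: le_trans (lerD (E1 _) (E2 _)) _.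
- by rewrite !(mulr_ge0, addr_ge0).
- by rewrite !(mulr_ge0, addr_ge0).
by rewrite le_eqVlt; apply/orP; left; apply/eqP; rewrite -/M; ring.
Qed.

End two_steps.
End davie_estimates.

(** * Charts, vector fields and bump functions *)

Section continuity_helpers.

Lemma continuous_at_open {X Y : topologicalType} (A : set X) (f : X -> Y) x :
  open A -> {within A, continuous f} -> A x -> {for x, continuous f}.
Proof.
by move=> oA; rewrite continuous_open_subspace// => cf Ax; apply: cf; rewrite inE.
Qed.

Lemma open_setX {X Y : topologicalType} (A : set X) (B : set Y) :
  open A -> open B -> open (A `*` B).
Proof.
move=> oA oB; rewrite openE => -[x y] [/= Ax By].
by exists (A, B) => //=; split; exact: open_nbhs_nbhs.
Qed.

Lemma mdist_continuous {R : realType} {Z : metricType R} (z0 : Z) :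
  continuous (fun z : Z => mdist z0 z : R^o).
Proof.
move=> z; apply/cvgrPdist_lt => e e0.
have : \forall z' \near z, ball z e z' by exact: nbhsx_ballx.
apply: filterS => z'; rewrite ballEmdist /= => h.
have t1 := metric_triangle z0 z' z; have t2 := metric_triangle z0 z z'.
rewrite (metric_sym z' z) in t1.
by rewrite ltr_norml; apply/andP; split; lra.
Qed.

Lemma CL_local {R : realType} {p : nat} {W : topologicalType} {E : normedModType R} k
    (U : set ('rV[R]_p * W)) (f : 'rV[R]_p * W -> E) :
  (forall q, U q -> exists2 V, V q & CL k V f) -> CL k U f.
Proof.
move=> H; split.
- by move=> s i q sk /H[V Vq [+ _]]; apply.
- by move=> s q sk /H[V Vq [_]]; apply.
Qed.

Lemma CL_lie {R : realType} {p : nat} {W : topologicalType} k (U : set ('rV[R]_p * W))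
    (c : 'I_p -> 'rV[R]_p * W -> R^o) (g : 'rV[R]_p * W -> R^o) : open U ->
  (forall l, CL k U (c l)) -> CL k.+1 U g -> CL k U (lie c g).
Proof.
by move=> oU cc cg; apply: CL_sum => // l; apply: CLM => //; exact: CL_partial.
Qed.

Lemma eq_lie {R : realType} {p : nat} {W : topologicalType} (U : set ('rV[R]_p * W))
    (c : 'I_p -> 'rV[R]_p * W -> R^o) (g g' : 'rV[R]_p * W -> R^o) q :
  open U -> U q -> (forall q, U q -> g q = g' q) -> lie c g q = lie c g' q.
Proof.
by move=> oU Uq gg'; apply: eq_bigr => l _; congr (_ * _); exact: eq_partial gg'.
Qed.

Lemma lie_coord {R : realType} {p : nat} {W : topologicalType}
    (c : 'I_p -> 'rV[R]_p * W -> R^o) l q : lie c (fun q => q.1 0 l) q = c l q.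
Proof.
rewrite /lie (bigD1 l)//= partial_coord eqxx mulr1 big1 ?addr0// => m ml.
by rewrite partial_coord (negbTE ml) mulr0.
Qed.

Lemma lie_snd {R : realType} {p : nat} {W : topologicalType}
    (c : 'I_p -> 'rV[R]_p * W -> R^o) (h : W -> R^o) q : lie c (fun q => h q.2) q = 0.
Proof.
rewrite /lie big1// => l _; suff -> : partial l (fun q : 'rV[R]_p * W => h q.2) q = 0 by rewrite mulr0.
exact: (@derive_cst _ _ _ (h q.2)).
Qed.

End continuity_helpers.

Section foliated_charts.
Context {R : realType} {p : nat} {M Z : metricType R}.
Variable F : foliated_space p M Z.
Local Notation chartm i := (chart_map (atlas (f:=F) i)).
Local Notation chartv i := (chart_inv (atlas (f:=F) i)).
Local Notation dom i := (chart_dom (atlas (f:=F) i)).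
Local Notation img i := (chart_image (atlas (f:=F) i)).
Local Notation fn := ('rV[R]_p * Z -> R^o).

Definition pullback (i : fs_index F) (f : M -> R) : fn := fun q => f (chartv i q).

Definition component (V : vector_field F) (i : fs_index F) (l : 'I_p) : fn :=
  fun q => tcomp (V (chartv i q)) i 0 l.

Lemma open_image i : open (img i).
Proof. by apply: open_setX; [exact: chart_B1_open|exact: chart_B2_open]. Qed.

Lemma chart_map_image i x : dom i x -> img i (chartm i x).
Proof. exact: chart_map_in. Qed.

Lemma chart_inv_dom i q : img i q -> dom i (chartv i q).
Proof. exact: chart_inv_in. Qed.

Lemma chartK i x : dom i x -> chartv i (chartm i x) = x.
Proof. exact: chart_mapK. Qed.

Lemma chartVK i q : img i q -> chartm i (chartv i q) = q.
Proof. exact: chart_invK. Qed.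

Lemma chart_map_cont i x : dom i x -> {for x, continuous (chartm i)}.
Proof.
apply: continuous_at_open; [exact: chart_dom_open|exact: chart_map_continuous].
Qed.

Lemma chart_inv_cont i q : img i q -> {for q, continuous (chartv i)}.
Proof.
apply: continuous_at_open; [exact: open_image|exact: chart_inv_continuous].
Qed.

Lemma pullbackE i f x : dom i x -> pullback i f (chartm i x) = f x.
Proof. by move=> dx; rewrite /pullback chartK. Qed.

Lemma CL_component k V i l : CL_vector_field k V -> CL k (img i) (component V i l).
Proof. by move=> CLV; apply: CL_coord_component => //; exact: open_image. Qed.

Lemma transition_local i j q : img i q -> dom j (chartv i q) -> forall k,
  exists N f1 f2, [/\ open N, N q, N `<=` transition_dom (atlas (f:=F) i) (atlas (f:=F) j) &
    [/\ CL k N f1, (forall q', N q' -> {for q'.2, continuous f2}) &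
      forall q', N q' -> chartm j (chartv i q') = (f1 q', f2 q'.2)]].
Proof.
move=> iq jq k; have [_ /(_ i j k q (conj iq jq))] := fs_atlas F.
move=> [N [f1 [f2 [[oN Nq Nsub] [CLf1 cf2 eqN]]]]].
exists N, f1, f2; split => //; split => // q' Nq'.
by apply: cf2; exists q'.
Qed.

(** Independence of the chart: pulling [f] back through the transition map and applying the chain
    rule produces the Jacobian by which the components of a tangent vector transform. *)
Lemma vf_applyE V f i x : CL_fun F 1 f -> dom i x ->
  vf_apply V f x = lie (component V i) (pullback i f) (chartm i x).
Proof.
move=> CLf dx; rewrite /vf_apply; set k := chart_at F x.
have dk : dom k x by rewrite /k /chart_at; case: cid.
have imk := chart_map_image dk; have imi := chart_map_image dx.
have jx : dom i (chartv k (chartm k x)) by rewrite chartK.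
have [N [f1 [f2 [oN Nq Nsub [CLf1 cf2 eqN]]]]] := transition_local imk jx 1.
have f_in q : N q -> img i (f1 q, f2 q.2).
  by move=> Nq'; rewrite -eqN//; apply: chart_map_image; have [] := Nsub q Nq'.
have dN l : partial l (fun q => f (chartv k q) : R^o) (chartm k x) =
    \sum_m partial l (fun q => (transition (atlas k) (atlas i) q).1 0 m : R^o) (chartm k x) *
      partial m (pullback i f) (chartm i x).
  have -> : partial l (fun q => f (chartv k q) : R^o) (chartm k x) =
      partial l (fun q => pullback i f (f1 q, f2 q.2)) (chartm k x).
    apply: (eq_partial l oN Nq) => q Nq'; rewrite -eqN//.
    by rewrite pullbackE//; have [] := Nsub q Nq'.
  have D := is_derive_slice_comp oN (@open_image i) f_in l CLf1 (CLf i) Nq.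
  apply: etrans (@derive_val _ _ _ _ _ _ _ D) _.
  apply: eq_bigr => m _; congr (_ * _).
    apply: (eq_partial l oN Nq) => q Nq'.
    by rewrite /transition eqN.
  by rewrite -eqN// chartK.
rewrite /lie; under eq_bigr do rewrite dN mulr_sumr.
rewrite exchange_big /=; apply: eq_bigr => m _.
rewrite /component chartK// (tcomp_jacobian (V x) dk dx) mulr_suml.
by apply: eq_bigr => l _; rewrite mulrA.
Qed.

Lemma pullback_vf_apply (V : vector_field F) f i q : CL_fun F 1 f -> img i q ->
  pullback i (vf_apply V f) q = lie (component V i) (pullback i f) q.
Proof.
by move=> CLf iq; rewrite /pullback (vf_applyE V CLf (chart_inv_dom iq)) chartVK.
Qed.

Lemma CL_fun_le k k' f : (k <= k')%N -> CL_fun F k' f -> CL_fun F k f.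
Proof. by move=> kk CLf i; exact: CL_le (CLf i). Qed.

Lemma CL_vf_apply k (V : vector_field F) f : (k <= 3)%N -> CL_vector_field 3 V -> CL_fun F k.+1 f ->
  CL_fun F k (vf_apply V f).
Proof.
move=> k3 CLV CLf i; have oi := @open_image i.
have CLf1 : CL_fun F 1 f by exact: CL_fun_le CLf.
apply: (@eq_CL _ _ _ _ k (img i) (lie (component V i) (pullback i f))) => //.
  by move=> q iq; rewrite -pullback_vf_apply.
by apply: CL_lie => // l; exact: CL_le (CL_component i l CLV).
Qed.

Lemma vf_apply2E (V V' : vector_field F) f i x : CL_vector_field 3 V' -> CL_fun F 2 f -> dom i x ->
  vf_apply V (vf_apply V' f) x =
  lie (component V i) (lie (component V' i) (pullback i f)) (chartm i x).
Proof.
move=> CLV' CLf dx; have CLf1 : CL_fun F 1 f by exact: CL_fun_le CLf.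
rewrite (vf_applyE V (CL_vf_apply (k := 1) isT CLV' CLf) dx).
exact: (@eq_lie _ _ _ (img i) (component V i) (pullback i (vf_apply V' f)) _ _ (@open_image i)
  (chart_map_image dx) (fun q iq => pullback_vf_apply V' CLf1 iq)).
Qed.

Definition extend (i : fs_index F) (h : fn) (x : M) : R :=
  if `[< dom i x >] then h (chartm i x) else 0.

Lemma extendE i h x : dom i x -> extend i h x = h (chartm i x).
Proof. by move=> dx; rewrite /extend asboolT. Qed.

Lemma pullback_extend i h q : img i q -> pullback i (extend i h) q = h q.
Proof. by move=> iq; rewrite /pullback extendE ?chartVK//; exact: chart_inv_dom. Qed.

(** Near points of the chart domain the transition map transfers the regularity of [h]. Any other
    point lies in the open complement of [C], where the extension is zero. *)
Lemma CL_extend k i h (C : set M) : CL k (img i) h -> closed C -> C `<=` dom i ->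
  (forall x, dom i x -> ~ C x -> h (chartm i x) = 0) -> CL_fun F k (extend i h).
Proof.
move=> CLh clC Cdom h0 j; apply: CL_local => q jq.
have [iq|niq] := pselect (dom i (chartv j q)).
  have [N [f1 [f2 [oN Nq Nsub [CLf1 cf2 eqN]]]]] := transition_local jq iq k.
  exists N => //.
  have f_in q' : N q' -> img i (f1 q', f2 q'.2).
    by move=> Nq'; rewrite -eqN//; apply: chart_map_image; have [] := Nsub q' Nq'.
  apply: (eq_CL oN _ (CL_comp oN (@open_image i) cf2 f_in CLf1 CLh)) => q' Nq'.
  by rewrite -eqN// extendE//; have [] := Nsub q' Nq'.
have nC : ~ C (chartv j q) by move/Cdom.
have oC : open (~` C) by exact: closed_openC.
pose N := img j `&` (chartv j) @^-1` (~` C).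
have oN : open N.
  rewrite openE => q' [jq' Cq']; apply: filterI; first exact: open_nbhs_nbhs (conj (@open_image j) jq').
  by apply: (chart_inv_cont jq'); exact: open_nbhs_nbhs.
exists N => //; apply: (eq_CL oN _ (CL_cst k N 0)) => q' [jq' Cq'].
by rewrite /extend; case: asboolP => // dq'; rewrite h0.
Qed.

End foliated_charts.

Lemma choice2 (I T : Type) (P Q : I -> T -> Prop) : (forall i, exists2 t, P i t & Q i t) ->
  {f & forall i, P i (f i) /\ Q i (f i)}.
Proof. by move=> H; apply: (@choice _ _ (fun i t => P i t /\ Q i t)) => i; have [t] := H i; exists t. Qed.

Section local_bounds.
Context {R : realType} {p : nat} {W : topologicalType}.
Local Notation fn := ('rV[R]_p * W -> R^o).

Lemma near_family_bound (T : topologicalType) (x : T) (I : finType) (P : I -> R -> T -> Prop) :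
  (forall i K K' y, K <= K' -> P i K y -> P i K' y) ->
  (forall i, exists2 K, 0 <= K & \forall y \near x, P i K y) ->
  exists2 K, 0 <= K & \forall y \near x, forall i, P i K y.
Proof.
move=> Pmono H.
have [K HK] := choice2 H.
exists (\sum_i K i); first by apply: sumr_ge0 => i _; have [] := HK i.
apply: (@filter_forall _ _ (fun i y => P i (\sum_i K i) y) (nbhs x)) => i.
have [K0] := HK i; apply: filterS => y; apply: Pmono.
by rewrite (bigD1 i)//= lerDl sumr_ge0// => j _; have [] := HK j.
Qed.

Lemma near_bounded_words k (U : set ('rV[R]_p * W)) (f : fn) q : open U -> CL k U f -> U q ->
  exists2 K, 0 <= K & \forall q' \near q, forall s : seq 'I_p, (size s <= k)%N ->
    `|iter_partial s f q'| <= K.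
Proof.
move=> oU; elim: k f => [|k IH] f CLf Uq.
  have cf : {for q, continuous f} by exact: CL_continuous CLf Uq.
  have /cvgrPdist_le/(_ _ ltr01) := cf => near_f.
  exists (`|f q| + 1); first by rewrite addr_ge0.
  apply: filterS near_f => q' h s; rewrite leqn0 => /nilP-> /=.
  rewrite -[f q'](subrK (f q)) addrC; apply: le_trans (ler_normD _ _) _.
  by rewrite lerD// distrC.
have CLf0 : CL 0 U f by exact: CL_le CLf.
have cf : {for q, continuous f} by exact: CL_continuous CLf Uq.
have /cvgrPdist_le/(_ _ ltr01) := cf => near_f.
have [K K0 HK] := @near_family_bound _ q 'I_p (fun i K q' => forall s : seq 'I_p, (size s <= k)%N ->
    `|iter_partial s (partial i f) q'| <= K)
   (fun i K K' y KK h s sk => le_trans (h s sk) KK)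
   (fun i => IH (partial i f) (CL_partial i CLf) Uq).
exists (`|f q| + 1 + K); first by rewrite !addr_ge0.
apply: filterS2 near_f HK => q' h1 h2 s; case/lastP: s => [_|s i].
  rewrite /= -[f q'](subrK (f q)) addrC; apply: le_trans (ler_normD _ _) _.
  by rewrite -addrA lerD// distrC (le_trans h1)// lerDl.
rewrite size_rcons ltnS => sk; rewrite iter_partial_rcons.
by apply: le_trans (h2 i s sk) _; rewrite lerDr addr_ge0.
Qed.

Lemma compact_bounded_words k (U : set ('rV[R]_p * W)) (f : fn) z (B : set 'rV[R]_p) :
  open U -> compact B -> (forall y, B y -> U (y, z)) -> CL k U f ->
  exists2 K, 0 <= K & bounded_words z B k f K.
Proof.
move=> oU cB BU CLf.
have : \forall K \near +oo, B `<=` (fun y => forall s : seq 'I_p, (size s <= k)%N -> `|iter_partial s f (y, z)| <= K).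
  apply: ((compact_near_coveringP B).1 cB R (pinfty_nbhs R)) => y By.
  have [K K0 HK] := near_bounded_words oU CLf (BU y By).
  have ny := @slice_nbhs R p W (fun q' => forall s : seq 'I_p, (size s <= k)%N ->
    `|iter_partial s f q'| <= K) (y, z) HK.
  exists ([set y | forall s : seq 'I_p, (size s <= k)%N -> `|iter_partial s f (y, z)| <= K], [set K' | K <= K']).
    by split => //=; apply: nbhs_pinfty_ge; rewrite num_real.
  by move=> [y' K'] [/= h KK'] s sk; exact: le_trans (h s sk) KK'.
move=> /pinfty_ex_gt0[K K0 HK]; exists K; first exact: ltW.
by move=> s sk y By; exact: HK.
Qed.

End local_bounds.

Section bump.
Context {R : realType} {p : nat} {M Z : metricType R}.
Variable F : foliated_space p M Z.
Local Notation chartm i := (chart_map (atlas (f:=F) i)).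
Local Notation chartv i := (chart_inv (atlas (f:=F) i)).
Local Notation dom i := (chart_dom (atlas (f:=F) i)).
Local Notation img i := (chart_image (atlas (f:=F) i)).
Local Notation fn := ('rV[R]_p * Z -> R^o).

(* chi = 1 - (1 - e_+^4)_+^4 is of class C^3, equal to 1 where e >= 1 and to 0
   where e <= 0. *)
Lemma bump_exists i x0 (A : set M) : dom i x0 -> nbhs x0 A ->
  exists (chi : fn) (P : set ('rV[R]_p * Z)) (C : set M),
    [/\ CL 3 setT chi, open P, P (chartm i x0) & P `<=` img i] /\
    [/\ closed C, C `<=` dom i `&` A, forall q, P q -> chi q = 1 &
        forall x, dom i x -> ~ C x -> chi (chartm i x) = 0].
Proof.
move=> dx0 nA.
have oimg : open (img i) by exact: open_image.
have nAd : nbhs x0 (dom i `&` A).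
  by apply: filterI => //; apply: open_nbhs_nbhs; split => //; exact: chart_dom_open.
(* Regularity of M provides a closed neighbourhood inside [dom i] and [A], which will carry the
   support. *)
have [B' nB' clB'] := uniform_regular nAd.
pose C := closure B'.
set q0 := chartm i x0.
have iq0 : img i q0 by exact: chart_map_image.
have : \forall q \near q0, img i q /\ C (chartv i q).
  have n1 : \forall q \near q0, img i q by exact: open_nbhs_nbhs.
  have n2 : \forall q \near q0, C (chartv i q).
    apply: (chart_inv_cont iq0); rewrite chartK//.
    by apply: filterS nB'; exact: subset_closure.
  exact: filterS2 n1 n2.
move=> /nbhs_ballP[r' /= r'0 box].
pose r := r' / 2; have r0 : 0 < r by rewrite divr_gt0.
(* At [q0] the value is 2. Positivity confines each coordinate to distance less than sqrt 2 * r and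
   the height to distance less than 2 * r = r', that is, to the box. Squares give smoothness along
   the plaques; the transverse distance enters unsquared. *)
pose e (q : 'rV[R]_p * Z) : R^o := 2 + (- 1) *
  ((\sum_l ((r^-1 * q.1 0 l - r^-1 * q0.1 0 l) ^+ 2)) + r^-1 * mdist q0.2 q.2).
have oT : open (setT : set ('rV[R]_p * Z)) by exact: openT.
have CLe : CL 3 setT e.
  apply: (CLD oT (CL_cst _ _ (2 : R^o))).
  apply: (CLM oT (CL_cst _ _ (-1 : R^o))).
  apply: (CLD oT).
    apply: CL_sum => // l.
    have CLl : CL 3 setT (fun q : 'rV[R]_p * Z => (r^-1 * q.1 0 l : R^o) + (- (r^-1 * q0.1 0 l) : R^o)).
      apply: (CLD oT _ (CL_cst _ _ _)).
      exact: (CLM oT (CL_cst _ _ (r^-1 : R^o)) (CL_coord _ _ _)).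
    exact: (CLM oT CLl CLl).
  apply: (CLM oT (CL_cst _ _ (r^-1 : R^o))).
  apply: (@CL_snd R p Z R^o 3 setT (fun z => mdist q0.2 z : R^o) oT) => q _.
  exact: mdist_continuous.
pose g1 (q : 'rV[R]_p * Z) : R^o := 1 + (-1) * Num.max (e q) 0 ^+ 4.
have CLg1 : CL 3 setT g1.
  apply: (CLD oT (CL_cst _ _ (1 : R^o))).
  exact: (CLM oT (CL_cst _ _ (-1 : R^o)) (CL_pos_power oT CLe)).
pose chi (q : 'rV[R]_p * Z) : R^o := 1 + (-1) * Num.max (g1 q) 0 ^+ 4.
have CLchi : CL 3 setT chi.
  apply: (CLD oT (CL_cst _ _ (1 : R^o))).
  exact: (CLM oT (CL_cst _ _ (-1 : R^o)) (CL_pos_power oT CLg1)).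
have eq0 : e q0 = 2.
  by rewrite /e mdistxx mulr0 addr0 big1 ?mulr0 ?addr0// => l _; rewrite subrr expr0n.
exists chi, (img i `&` [set q | 1 < e q]), C; split; split => //.
- apply: openI => //.
  have ce : continuous e by move=> q; exact: CL_continuous CLe I.
  have := (@continuousP _ _ e).1 ce [set t : R | 1 < t]; apply.
  exact: open_gt.
- by split => //=; rewrite eq0 ltr1n.
- exact: closed_closure.
- move=> q [_ /= e1]; rewrite /chi.
  have -> : Num.max (g1 q) 0 = 0.
    rewrite max_r// /g1 max_l; last by rewrite ltW// (lt_trans ltr01).
    by rewrite mulN1r subr_le0 exprn_ege1// ltW.
  by rewrite expr0n mulr0 addr0.
- move=> x dx nC.
  have e0 : e (chartm i x) <= 0.
    rewrite leNgt; apply/negP => e_gt0; apply: nC.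
    have [_] : img i (chartm i x) /\ C (chartv i (chartm i x)); last by rewrite chartK.
    apply: box; set q := chartm i x in e_gt0 *.
    have dist0 : 0 <= r^-1 * mdist q0.2 q.2 by rewrite mulr_ge0 ?mdist_ge0// invr_ge0 ltW.
    have sq0 l : 0 <= (r^-1 * q.1 0 l - r^-1 * q0.1 0 l) ^+ 2 by exact: sqr_ge0.
    have sum0 : 0 <= \sum_l (r^-1 * q.1 0 l - r^-1 * q0.1 0 l) ^+ 2 by exact: sumr_ge0.
    have hlt : \sum_l (r^-1 * q.1 0 l - r^-1 * q0.1 0 l) ^+ 2 + r^-1 * mdist q0.2 q.2 < 2.
      by move: e_gt0; rewrite /e mulN1r subr_gt0.
    split => /=.
    + rewrite mx_norm_ball /ball_ /=.
      (* 3/2 is a rational upper bound for sqrt 2 that is still smaller than 2. *)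
      apply: (@le_lt_trans _ _ (3 / 2 * r)); last by rewrite /r; lra.
      apply: mx_norm_le => [|a l]; first by rewrite mulr_ge0// ltW.
      rewrite ord1 !mxE.
      have : (r^-1 * q.1 0 l - r^-1 * q0.1 0 l) ^+ 2 < 2.
        apply: le_lt_trans hlt; rewrite (bigD1 l)//= -addrA lerDl addr_ge0// sumr_ge0//.
      rewrite -mulrBr; set t := r^-1 * _ => h.
      have -> : q0.1 0 l - q.1 0 l = - (r * t) by rewrite /t mulrA divff ?gt_eqF// mul1r opprB.
      rewrite normrN normrM gtr0_norm// mulrC; apply: ler_wpM2r; first exact: ltW.
      rewrite leNgt; apply/negP => h2; move: h; rewrite -real_normK ?num_real//; nra.
    + rewrite ballEmdist /=.
      have : r^-1 * mdist q0.2 q.2 < 2 by apply: le_lt_trans hlt; rewrite lerDr.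
      by rewrite mulrC ltr_pdivrMr// /r; lra.
  rewrite /chi /g1 (max_r e0) expr0n mulr0 addr0 max_l// expr1n mulN1r subrr//.
Qed.

End bump.

(** * Existence *)

Section weights.
Context {R : realType} {d : nat}.
Implicit Types w : R * R -> 'rV[R]_d * 'M[R]_d.

Definition weight1 w (s t : R) (i : 'I_d) : R := (w (s, t)).1 0 i.

(** The time increment counts as a second-level weight: it is at most (t - s)^(2 alpha) on intervals
    of length at most 1, and it is additive, so it obeys Chen's relation without a product term. *)
Definition weight2 w (s t : R) (J : option ('I_d * 'I_d)) : R :=
  if J is Some jk then (w (s, t)).2 jk.1 jk.2 else t - s.

Lemma norm_ball_convex n (a0 : 'rV[R]_n) r a b t : `|a - a0| <= r -> `|b - a0| <= r ->
  0 <= t -> t <= 1 -> `|a + t *: (b - a) - a0| <= r.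
Proof.
move=> ha hb t0 t1.
have -> : a + t *: (b - a) - a0 = (1 - t) *: (a - a0) + t *: (b - a0).
  by apply/rowP => j; rewrite !mxE; ring.
apply: le_trans (ler_normD _ _) _; rewrite !normrZ !ger0_norm ?subr_ge0//.
have t1' : 0 <= 1 - t by rewrite subr_ge0.
have := ler_wpM2l t1' ha; have := ler_wpM2l t0 hb; lra.
Qed.

Lemma norm_ball_compact n (a0 : 'rV[R]_n) r : compact [set y : 'rV[R]_n | `|y - a0| <= r].
Proof.
apply: bounded_closed_compact.
  exists (`|a0| + r); split; first by rewrite num_real.
  move=> M hM y /= hy; apply: le_trans (ltW hM).
  rewrite -[y](subrK a0) addrC; apply: le_trans (ler_normD _ _) _; exact: lerD.
have := @closed_closed_ball_ R 'rV[R]_n a0 r; congr closed.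
by apply/seteqP; split => y; rewrite /closed_ball_ /= distrC.
Qed.

End weights.

Section rough_flow.
Context {R : realType} {p d : nat} {W : topologicalType}.
Variables (alpha T Kw : R) (w : R * R -> 'rV[R]_d * 'M[R]_d).
Hypotheses (alpha_gt : 1 / 3 < alpha) (alpha_lt : alpha < 1 / 2).
Hypothesis wg : weakly_geometric alpha T w Kw.
Local Notation fn := ('rV[R]_p * W -> R^o).
Local Notation J2 := (option ('I_d * 'I_d)).

Let alpha0 : 0 < alpha. Proof. by have := alpha_gt; lra. Qed.

(** The added 1 gives [kappa >= 1], hence [Kw <= kappa ^+ 2]. So [wsize] bounds the first-level
    weights and its square bounds the second-level ones, drift included. *)
Definition kappa : R := Kw + 1.

Lemma kappa_ge1 : 1 <= kappa.
Proof. by case: wg => K0 *; rewrite /kappa lerDr. Qed.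

Let kappa0 : 0 <= kappa. Proof. exact: le_trans kappa_ge1. Qed.

Definition wsize s t : R := kappa * (t - s) `^ alpha.

Lemma wsize_ge0 s t : 0 <= wsize s t.
Proof. by rewrite mulr_ge0// powR_ge0. Qed.

Lemma powR_2alpha h : 0 <= h -> h `^ (2 * alpha) = (h `^ alpha) ^+ 2.
Proof. by move=> h0; rewrite mulrC powRrM powR_mulrn// powR_ge0. Qed.

Lemma powR_3alpha h : 0 <= h -> h `^ (3 * alpha) = (h `^ alpha) ^+ 3.
Proof. by move=> h0; rewrite mulrC powRrM powR_mulrn// powR_ge0. Qed.

Lemma weight1_le s t i : 0 <= s -> s <= t -> t <= T -> `|weight1 w s t i| <= wsize s t.
Proof.
case: wg => K0 h1 _ _ _ s0 st tT; apply: le_trans (h1 s t i s0 st tT) _.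
by rewrite ler_wpM2r ?powR_ge0// /kappa lerDl.
Qed.

Lemma le_powR_2alpha h : 0 <= h -> h <= 1 -> h <= h `^ (2 * alpha).
Proof.
rewrite le_eqVlt => /orP[/eqP<- _|h0 h1]; first exact: powR_ge0.
rewrite ger1_powR ?h0//; have := alpha_lt; lra.
Qed.

Lemma weight2_le s t J : 0 <= s -> s <= t -> t <= T -> t - s <= 1 ->
  `|weight2 w s t J| <= wsize s t ^+ 2.
Proof.
move=> s0 st tT ts1; have h0 : 0 <= t - s by rewrite subr_ge0.
have k2 : kappa <= kappa ^+ 2 by rewrite expr2 ler_peMl// kappa_ge1.
rewrite /wsize exprMn -powR_2alpha//.
have P0 : 0 <= (t - s) `^ (2 * alpha) by exact: powR_ge0.
case: J => [[j k]|] /=.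
  case: wg => K0 _ h2 _ _; apply: le_trans (h2 s t j k s0 st tT) _.
  by rewrite ler_wpM2r//; apply: le_trans k2; rewrite /kappa lerDl.
rewrite ger0_norm//; apply: le_trans (le_powR_2alpha h0 ts1) _.
by rewrite ler_peMl//; apply: le_trans k2; exact: kappa_ge1.
Qed.

Lemma wsize_ss s : wsize s s = 0.
Proof. by rewrite /wsize subrr powR0 ?mulr0// gt_eqF. Qed.

Lemma weight1_ss s i : 0 <= s -> s <= T -> weight1 w s s i = 0.
Proof.
move=> s0 sT; apply/eqP; rewrite -normr_le0; apply: le_trans (weight1_le i s0 (lexx s) sT) _.
by rewrite wsize_ss.
Qed.

Lemma weight2_ss s J : 0 <= s -> s <= T -> weight2 w s s J = 0.
Proof.
move=> s0 sT; apply/eqP; rewrite -normr_le0.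
apply: le_trans (weight2_le J s0 (lexx s) sT _) _; first by rewrite subrr.
by rewrite wsize_ss expr0n.
Qed.

Lemma weight1_chen s u t i : 0 <= s -> s <= u -> u <= t -> t <= T ->
  weight1 w s t i = weight1 w s u i + weight1 w u t i.
Proof. by case: wg => _ _ _ ch _ s0 su ut tT; have [+ _] := ch s u t s0 su ut tT; exact. Qed.

Lemma weight2_chen s u t J : 0 <= s -> s <= u -> u <= t -> t <= T ->
  weight2 w s t J = weight2 w s u J + weight2 w u t J +
    if J is Some jk then weight1 w s u jk.1 * weight1 w u t jk.2 else 0.
Proof.
case: wg => _ _ _ ch _ s0 su ut tT.
case: J => [[j k]|] /=; last by rewrite /weight2; ring.
by have [_ +] := ch s u t s0 su ut tT; exact.
Qed.

Lemma weight_symmetric s t j k : 0 <= s -> s <= t -> t <= T ->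
  weight2 w s t (Some (j, k)) + weight2 w s t (Some (k, j)) = weight1 w s t j * weight1 w s t k.
Proof. by case: wg => _ _ _ _; exact. Qed.

Lemma wsize_le s u v t : s <= u -> u <= v -> v <= t -> wsize u v <= wsize s t.
Proof.
move=> su uv vt; rewrite ler_wpM2l// le_powR ?(ltW alpha0) ?subr_ge0//.
by rewrite lerB.
Qed.

(* Davie's second-order Euler step for the vector fields frozen on the plaque at height z. *)
Definition davie_step (c1 : 'I_d -> 'I_p -> fn) (c0 : 'I_p -> fn) (z : W) (s t : R) (y : 'rV[R]_p) :=
  y + davie_incr c1 (second_coef c1 c0) z (weight1 w s t) (weight2 w s t) y.

Lemma davie_step_id c1 c0 z s y : 0 <= s -> s <= T -> davie_step c1 c0 z s s y = y.
Proof.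
move=> s0 sT; apply/rowP => l; rewrite !mxE !big1 ?addr0// => i _.
  by rewrite weight2_ss// mul0r.
by rewrite weight1_ss// mul0r.
Qed.

Variables (N : nat) (K r : R).
Hypotheses (pN : (p <= N)%N) (dN : (d <= N)%N) (JN : (#|{: J2}| <= N)%N).
Hypotheses (K0 : 0 <= K) (r0 : 0 < r).
Let M : R := N%:R.
Let M0 : 0 <= M. Proof. by []. Qed.

(** The data at one height, on a ball of radius [2 * r]: solutions are kept within [r] of the
    centre, and one further step stays in the ball. *)
Definition step_domain (U : set ('rV[R]_p * W)) (z : W) (ystar : 'rV[R]_p) (c1 : 'I_d -> 'I_p -> fn) (c0 : 'I_p -> fn) :=
  let B := [set y : 'rV[R]_p | `|y - ystar| <= 2 * r] in
  [/\ open U, forall y, B y -> U (y, z),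
    (forall i l, CL 3 U (c1 i l)) /\ (forall J l, CL 2 U (second_coef c1 c0 J l)) &
    (forall i l, bounded_words z B 3 (c1 i l) K) /\
    (forall J l, bounded_words z B 2 (second_coef c1 c0 J l) K)].

Definition defect_const : R :=
  M * (4 * M ^+ 4 * K ^+ 3 + 3 * M ^+ 2 * K ^+ 2) * kappa ^+ 3.

Lemma defect_const_ge0 : 0 <= defect_const.
Proof.
have K3 n : 0 <= K ^+ n by exact: exprn_ge0.
have Mn n : 0 <= M ^+ n by exact: exprn_ge0.
by apply: mulr_ge0; [rewrite !(mulr_ge0, addr_ge0)|exact: exprn_ge0].
Qed.

(** [h0] and [L] depend only on the bounds [N], [K], [r] and the driver and are chosen before the
    plaque, the centre and the coefficients. This makes the time of existence locally uniform in the
    starting point, as compactness will require. *)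
Lemma flat_existence : exists h0 L, [/\ 0 < h0, h0 <= 1, 0 <= L & kappa * h0 `^ alpha <= 1] /\
  forall U z ystar c1 c0, step_domain U z ystar c1 c0 ->
  forall s0 t0, 0 <= s0 -> s0 <= t0 -> t0 <= T -> t0 - s0 <= h0 ->
  exists y : R -> 'rV[R]_p, [/\ y s0 = ystar,
    forall t, s0 <= t -> t <= t0 -> `|y t - ystar| <= r,
    forall s t, s0 <= s -> s <= t -> t <= t0 ->
      `|y t - davie_step c1 c0 z s t (y s)| <= L * (t - s) `^ (3 * alpha) &
    forall s t, s0 <= s -> s <= t -> t <= t0 -> `|davie_step c1 c0 z s t (y s) - ystar| <= 2 * r].
Proof.
have th1 : 1 < 3 * alpha by have := alpha_gt; lra.
have q1 := half_powR_lt th1; set q := 2^-1 `^ (3 * alpha) in q1.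
have q0 : 0 <= q by exact: powR_ge0.
(* With this [e] the factor [q * (1 + (1 + e) ^+ 2)] is at most [(1 + 2 * q) / 2]. The remaining
   share [(1 - 2 * q) / 2] of [L] is exactly what the defect term uses in the choice of [L]. *)
pose e : R := (1 - 2 * q) / 3.
have e0 : 0 < e by rewrite /e; lra.
have e1 : e <= 1 / 3 by rewrite /e; lra.
have D0 := defect_const_ge0.
pose L := 2 * (2 + e) * defect_const / (1 - 2 * q).
have L0 : 0 <= L.
  have e2 : 0 <= 2 + e by rewrite addr_ge0// ltW.
  by apply: divr_ge0; [exact: (mulr_ge0 (mulr_ge0 (ler0n _ 2) e2) D0)|rewrite subr_ge0 ltW].
have LK : L * q * (1 + (1 + e) ^+ 2) + (2 + e) * defect_const <= L.
  have -> : (2 + e) * defect_const = L * (1 - 2 * q) / 2.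
    by rewrite /L; field; rewrite gt_eqF// subr_gt0.
  have : q * (1 + (1 + e) ^+ 2) <= (1 + 2 * q) / 2.
    have qe : q * (e * (2 + e)) <= q * (3 * e) by rewrite ler_wpM2l// mulrC ler_wpM2r ?(ltW e0)//; lra.
    have qe2 : q * (3 * e) <= 3 / 2 * e by rewrite mulrCA mulrA ler_wpM2r ?(ltW e0)//; lra.
    have -> : q * (1 + (1 + e) ^+ 2) = 2 * q + q * (e * (2 + e)) by ring.
    by move: qe qe2; rewrite /e; lra.
  move=> /(ler_wpM2l L0); lra.
(* [S] majorizes every coefficient that must become small after multiplication by [x], the alpha-th
   power of [h0]; by the choice of [x], [x * S] is the smallest of 1, [e] and [r]. *)
pose S := kappa + 2 * M * kappa * (M * K) + 2 * M * kappa * K + L + 1.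
have MK0 : 0 <= M * K by rewrite mulr_ge0.
have t1 : 0 <= 2 * M * kappa * (M * K) by exact: (mulr_ge0 (mulr_ge0 (mulr_ge0 (ler0n _ 2) M0) kappa0) MK0).
have t2 : 0 <= 2 * M * kappa * K by exact: (mulr_ge0 (mulr_ge0 (mulr_ge0 (ler0n _ 2) M0) kappa0) K0).
have t12L := addr_ge0 (addr_ge0 (addr_ge0 kappa0 t1) t2) L0.
have S0 : 0 < S by rewrite /S; apply: ltr_wpDl.
pose m := Num.min 1 (Num.min e r).
have m0 : 0 < m by rewrite !lt_min ltr01 e0.
have [m1 me mr] : [/\ m <= 1, m <= e & m <= r] by rewrite /m !ge_min !lexx !orbT.
pose x := m / S.
have x0 : 0 < x by rewrite divr_gt0.
have xS : x * S = m by rewrite divfK// gt_eqF.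
have kS : kappa <= S.
  by rewrite /S; move: t1 t2 L0; lra.
have part c : 0 <= c -> c <= S -> x * c <= m by move=> c0 cS; rewrite -xS ler_wpM2l// ltW.
have x1 : x <= 1.
  by apply: le_trans m1; rewrite -[x]mulr1; apply: part => //; rewrite /S lerDr.
pose h0 := x `^ alpha^-1.
have h00 : 0 < h0 by rewrite powR_gt0.
have h0a : h0 `^ alpha = x by rewrite /h0 -powRrM mulVf ?gt_eqF// powRr1// ltW.
have h01 : h0 <= 1.
  rewrite /h0; have -> : 1 = 1 `^ alpha^-1 :> R by rewrite powR1.
  by apply: le_powR => //; [rewrite invr_ge0 ltW|exact: ltW].
exists h0, L; split.
  split => //; rewrite h0a mulrC; apply: le_trans m1; exact: (part _ kappa0 kS).
move=> U z ystar c1 c0 [oU BU [CL1 CL2] [b1 b2]] s0 t0 s00 st0 t0T th.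
set B := [set y : 'rV[R]_p | _] in BU b1 b2.
have Bconv : forall a b t, B a -> B b -> 0 <= t -> t <= 1 -> B (a + t *: (b - a)).
  by move=> a b t; exact: norm_ball_convex.
(* Sewing asks for [mu s s y = y] at all real [s], while the weights are meaningful only in
   [0, T]. *)
pose mu s t y := if (0 <= s) && (s <= T) then davie_step c1 c0 z s t y else y.
have muE s t y : s0 <= s -> s <= t -> t <= t0 -> mu s t y = davie_step c1 c0 z s t y.
  by move=> ss st tt; rewrite /mu (le_trans s00 ss) (le_trans st (le_trans tt t0T)).
have small s t : s0 <= s -> s <= t -> t <= t0 -> wsize s t <= kappa * x.
  move=> ss st tt; rewrite ler_wpM2l// -h0a le_powR ?(ltW alpha0) ?subr_ge0//.
  by apply: le_trans th; rewrite lerB.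
have kx1 : kappa * x <= 1.
  by rewrite mulrC; apply: le_trans m1; exact: (part _ kappa0 kS).
have W1 s t i : s0 <= s -> s <= t -> t <= t0 -> `|weight1 w s t i| <= wsize s t.
  by move=> ss st tt; apply: weight1_le => //; [exact: le_trans ss|exact: le_trans t0T].
have W2 s t J : s0 <= s -> s <= t -> t <= t0 -> `|weight2 w s t J| <= wsize s t ^+ 2.
  move=> ss st tt; apply: weight2_le => //; [exact: le_trans ss|exact: le_trans t0T|].
  by apply: le_trans h01; apply: le_trans th; rewrite lerB.
have stepB s t y : s0 <= s -> s <= t -> t <= t0 -> B y ->
    `|davie_step c1 c0 z s t y - y| <= 2 * M * (kappa * x) * K.
  move=> ss st tt By; rewrite /davie_step [y + _]addrC addrK.
  have wk := small s t ss st tt.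
  apply: le_trans (incr_bound dN JN K0 b1 b2 (wsize_ge0 s t) (le_trans wk kx1)
    (fun i => W1 s t i ss st tt) (fun J => W2 s t J ss st tt) By) _.
  by rewrite ler_wpM2r// ler_wpM2l// mulr_ge0.
have mk : 2 * M * (kappa * x) * K + L * (t0 - s0) `^ (3 * alpha) <= r.
  have hx : (t0 - s0) `^ (3 * alpha) <= x.
    rewrite powR_3alpha ?subr_ge0//; set v := _ `^ _.
    have v0 : 0 <= v by exact: powR_ge0.
    have vx : v <= x by rewrite -h0a le_powR ?(ltW alpha0) ?subr_ge0.
    apply: (le_trans _ vx); rewrite exprS ler_piMr// exprn_ile1//.
    exact: le_trans vx x1.
  apply: le_trans (lerD (lexx _) (ler_wpM2l L0 hx)) _.
  rewrite [leLHS](_ : _ = x * (2 * M * kappa * K + L)); last by ring.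
  apply: le_trans mr; apply: part; first by rewrite addr_ge0.
  by rewrite /S; have := kappa0; move: t1; lra.
have half : 2 * M * (kappa * x) * K <= r.
  by apply: le_trans mk; rewrite lerDl mulr_ge0// powR_ge0.
have := @sewing_limit R 'rV[R]_p mu ystar s0 t0 (3 * alpha) e defect_const (2 * M * (kappa * x) * K) r L.
case=> //.
- exact: norm_ball_compact.
- by apply: mulr_ge0 => //; exact: ltW alpha0.
- exact: ltW.
- exact: (mulr_ge0 (mulr_ge0 (mulr_ge0 (ler0n _ 2) M0) (mulr_ge0 kappa0 (ltW x0))) K0).
- by move=> s y; rewrite /mu; case: ifP => // /andP[? ?]; rewrite davie_step_id.
- by move=> s t y ss st tt By; rewrite muE//; exact: stepB.
- move=> s t y y' ss st tt By By'; rewrite !muE// /davie_step opprD addrACA.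
  apply: le_trans (ler_normD _ _) _; rewrite mulrDl mul1r lerD2l.
  have wk := small s t ss st tt.
  apply: le_trans (incr_lip oU pN dN JN Bconv BU K0 CL1 CL2 b1 b2 (wsize_ge0 s t) (le_trans wk kx1)
    (fun i => W1 s t i ss st tt) (fun J => W2 s t J ss st tt) By By') _.
  apply: (@le_trans _ _ (2 * M * (kappa * x) * (M * K * `|y - y'|))).
    by rewrite ler_wpM2r ?mulr_ge0// ler_wpM2l// mulr_ge0.
  rewrite [leLHS](_ : _ = x * (2 * M * kappa * (M * K)) * `|y - y'|); last by ring.
  rewrite ler_wpM2r//; apply: le_trans me; apply: part => //; rewrite /S; have := kappa0; move: t2 L0; lra.
- move=> s u t y ss su ut tt Br.
  have By : B y by rewrite /B /=; apply: le_trans Br _; have := ltW r0; lra.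
  have us := le_trans ss su; have st := le_trans su ut; have ut' := le_trans ut tt.
  rewrite !muE//.
  have Bx : B (davie_step c1 c0 z s u y).
    have := stepB s u y ss su ut' By; rewrite /B /= => h.
    rewrite -[davie_step c1 c0 z s u y](subrK y) -addrA; apply: le_trans (ler_normD _ _) _.
    by move: h half Br; lra.
  have wk := small s t ss st tt.
  have wsu : wsize s u <= wsize s t by exact: wsize_le.
  have wut : wsize u t <= wsize s t by exact: wsize_le.
  have W2sq a b J : s0 <= a -> a <= b -> b <= t0 -> wsize a b <= wsize s t -> `|weight2 w a b J| <= wsize s t ^+ 2.
    move=> h1 h2 h3 h4; apply: le_trans (W2 a b J h1 h2 h3) _.
    by rewrite lerXn2r ?nnegrE ?wsize_ge0.
  have := davie_defect_le oU pN dN JN Bconv BU K0 CL1 CL2 b1 b2 (wsize_ge0 s t) (le_trans wk kx1)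
    (fun i => le_trans (W1 s u i ss su ut') wsu) (fun J => W2sq s u J ss su ut' wsu)
    (fun i => le_trans (W1 u t i us ut tt) wut) (fun J => W2sq u t J us ut tt wut)
    (fun i => weight1_chen i (le_trans s00 ss) su ut (le_trans tt t0T))
    (fun J => weight2_chen J (le_trans s00 ss) su ut (le_trans tt t0T)) By Bx.
  rewrite /wsize exprMn powR_3alpha ?subr_ge0// mulrA.
  exact.
- move=> y [y0 ybr ysol]; exists y; split => //.
    by move=> s t ss st tt; rewrite -muE//; exact: ysol.
  move=> s t ss st tt; have Br := ybr s ss (le_trans st tt).
  have By : B (y s) by rewrite /B /=; apply: le_trans Br _; have := ltW r0; lra.
  have h := stepB s t (y s) ss st tt By.
  rewrite -[davie_step c1 c0 z s t (y s)](subrK (y s)) -addrA; apply: le_trans (ler_normD _ _) _.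
  by move: h half Br; lra.
Qed.

End rough_flow.

Section strong_solutions.
Context {R : realType} {p d : nat} {M Z : metricType R}.
Variable F : foliated_space p M Z.
Variables (V0 : vector_field F) (V : 'I_d -> vector_field F).
Hypotheses (CLV0 : CL_vector_field 3 V0) (CLV : forall i, CL_vector_field 3 (V i)).
Variables (alpha T Kw : R) (w : R * R -> 'rV[R]_d * 'M[R]_d).
Hypotheses (alpha_gt : 1 / 3 < alpha) (alpha_lt : alpha < 1 / 2).
Hypothesis wg : weakly_geometric alpha T w Kw.
Local Notation chartm i := (chart_map (atlas (f:=F) i)).
Local Notation chartv i := (chart_inv (atlas (f:=F) i)).
Local Notation dom i := (chart_dom (atlas (f:=F) i)).
Local Notation img i := (chart_image (atlas (f:=F) i)).
Local Notation J2 := (option ('I_d * 'I_d)).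

Definition drift_component i := component V0 i.
Definition driving_component i (j : 'I_d) := component (V j) i.
Local Notation c0 i := (drift_component i).
Local Notation c1 i := (driving_component i).
Local Notation c2 i := (second_coef (c1 i) (c0 i)).

Definition second_apply (f : M -> R) (J : J2) : M -> R :=
  if J is Some jk then vf_apply (V jk.1) (vf_apply (V jk.2) f) else vf_apply V0 f.

Lemma CL_c1 i j l : CL 3 (img i) (c1 i j l).
Proof. exact: (CL_component i l (CLV j)). Qed.

Lemma CL_c2 i J l : CL 2 (img i) (c2 i J l).
Proof.
case: J => [[j k]|] /=; last exact: CL_le (CL_component i l CLV0).
apply: CL_lie; first exact: open_image; last exact: CL_c1.
by move=> m; exact: CL_le (CL_c1 i j m).
Qed.

Lemma box_exists i x0 : dom i x0 -> exists rho K, [/\ 0 < rho, 0 <= K &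
  forall y z, `|(chartm i x0).1 - y| < rho -> mdist (chartm i x0).2 z < rho ->
    [/\ img i (y, z),
      forall j l (s : seq 'I_p), (size s <= 3)%N -> `|iter_partial s (c1 i j l) (y, z)| <= K &
      forall J l (s : seq 'I_p), (size s <= 2)%N -> `|iter_partial s (c2 i J l) (y, z)| <= K]].
Proof.
move=> dx; have oi : open (img i) by exact: open_image.
have iq := chart_map_image dx; set q0 := chartm i x0 in iq *.
have [K1 K10 H1] := @near_family_bound R _ q0 ('I_d * 'I_p)%type
   (fun jl K q => forall s : seq 'I_p, (size s <= 3)%N -> `|iter_partial s (c1 i jl.1 jl.2) q| <= K)
   (fun jl K K' q KK h s sk => le_trans (h s sk) KK)
   (fun jl => near_bounded_words oi (CL_c1 i jl.1 jl.2) iq).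
have [K2 K20 H2] := @near_family_bound R _ q0 (J2 * 'I_p)%type
   (fun jl K q => forall s : seq 'I_p, (size s <= 2)%N -> `|iter_partial s (c2 i jl.1 jl.2) q| <= K)
   (fun jl K K' q KK h s sk => le_trans (h s sk) KK)
   (fun jl => near_bounded_words oi (CL_c2 i jl.1 jl.2) iq).
have nU : \forall q \near q0, img i q by exact: open_nbhs_nbhs.
have : \forall q \near q0, [/\ img i q,
    forall jl (s : seq 'I_p), (size s <= 3)%N -> `|iter_partial s (c1 i jl.1 jl.2) q| <= K1
   & forall jl (s : seq 'I_p), (size s <= 2)%N -> `|iter_partial s (c2 i jl.1 jl.2) q| <= K2].
  exact: filterS3 nU H1 H2.
move=> /nbhs_ballP[rho /= rho0 box].
exists rho, (K1 + K2); split => //; first by rewrite addr_ge0.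
move=> y z hy hz; have [] := box (y, z).
  by split => /=; [rewrite mx_norm_ball|rewrite ballEmdist].
move=> h1 h2 h3; split => //.
- by move=> j l s sk; apply: le_trans (h2 (j, l) s sk) _; rewrite lerDl.
- by move=> J l s sk; apply: le_trans (h3 (J, l) s sk) _; rewrite lerDr.
Qed.

(* The expansions of lower order make the notion stable under concatenation. *)
Definition strong_solution (s0 t0 : R) (x : R -> M) := [/\
  forall g, CL_fun F 1 g -> exists2 C, 0 <= C & forall s t, s0 <= s -> s <= t -> t <= t0 ->
    `|g (x t) - g (x s)| <= C * (t - s) `^ alpha,
  forall g, CL_fun F 2 g -> exists2 C, 0 <= C & forall s t, s0 <= s -> s <= t -> t <= t0 ->
    `|g (x t) - g (x s) - \sum_i weight1 w s t i * vf_apply (V i) g (x s)| <= C * (t - s) `^ (2 * alpha) &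
  forall g, CL_fun F 3 g -> exists2 C, 0 <= C & forall s t, s0 <= s -> s <= t -> t <= t0 ->
    `|g (x t) - g (x s) - \sum_i weight1 w s t i * vf_apply (V i) g (x s)
      - \sum_J weight2 w s t J * second_apply g J (x s)| <= C * (t - s) `^ (3 * alpha)].

Let N : nat := (p + d + #|{: J2}|)%N.
Let pN : (p <= N)%N. Proof. by rewrite /N -addnA leq_addr. Qed.
Let dN : (d <= N)%N. Proof. by rewrite /N addnAC leq_addl. Qed.
Let JN : (#|{: J2}| <= N)%N. Proof. by rewrite /N leq_addl. Qed.

Lemma pullback_second i g J y z : CL_fun F 2 g -> img i (y, z) ->
  second_apply g J (chartv i (y, z)) = second_lie (c1 i) (c0 i) (pullback i g) J (y, z).
Proof.
move=> CLg iq; have dx := chart_inv_dom iq.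
case: J => [[j k]|] /=; first by rewrite (vf_apply2E (V j) (CLV k) CLg dx) chartVK.
have CLg1 : CL_fun F 1 g by exact: CL_fun_le CLg.
by rewrite (vf_applyE V0 CLg1 dx) chartVK.
Qed.

(** A test function at time [t] is first compared with its value at the end of the Davie step, at a
    cost of order 3 alpha; the step itself is then expanded by [ito1], [ito2] or [ito3]. *)
Lemma plaque_strong_solution i z ystar r K h0 L s0 t0 y :
  0 <= K -> 0 <= r -> 0 <= L -> h0 <= 1 -> kappa Kw * h0 `^ alpha <= 1 ->
  step_domain K r (img i) z ystar (c1 i) (c0 i) ->
  0 <= s0 -> s0 <= t0 -> t0 <= T -> t0 - s0 <= h0 ->
  (forall t, s0 <= t -> t <= t0 -> `|y t - ystar| <= r) ->
  (forall s t, s0 <= s -> s <= t -> t <= t0 ->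
      `|y t - davie_step w (c1 i) (c0 i) z s t (y s)| <= L * (t - s) `^ (3 * alpha)) ->
  (forall s t, s0 <= s -> s <= t -> t <= t0 -> `|davie_step w (c1 i) (c0 i) z s t (y s) - ystar| <= 2 * r) ->
  strong_solution s0 t0 (fun t => chartv i (y t, z)).
Proof.
move=> K0 r0 L0 h01 kh [oU BU [CL1 CL2] [b1 b2]] s00 st0 t0T th ybr ysol ystep.
set B := [set y : 'rV[R]_p | _] in BU b1 b2.
have a0 : 0 < alpha by have := alpha_gt; lra.
have Bconv : forall a b t, B a -> B b -> 0 <= t -> t <= 1 -> B (a + t *: (b - a)).
  by move=> a b t; exact: norm_ball_convex.
have Kw0 : 0 <= Kw by case: wg.
have kap : 1 <= kappa Kw by exact: kappa_ge1 wg.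
have kap0 : 0 <= kappa Kw by exact: le_trans kap.
have By t : s0 <= t -> t <= t0 -> B (y t).
  by move=> st tt; rewrite /B /=; apply: le_trans (ybr t st tt) _; rewrite ler_peMl// ler1n.
have wk s t : s0 <= s -> s <= t -> t <= t0 -> wsize alpha Kw s t <= 1.
  move=> ss st tt; apply: le_trans kh; rewrite ler_wpM2l// le_powR ?(ltW a0) ?subr_ge0//.
  by apply: le_trans th; rewrite lerB.
have pw s t : s0 <= s -> s <= t -> t <= t0 -> 0 <= (t - s) `^ alpha /\ (t - s) `^ alpha <= 1.
  move=> ss st tt; split; first exact: powR_ge0.
  have -> : 1 = 1 `^ alpha :> R by rewrite powR1.
  rewrite le_powR ?(ltW a0) ?subr_ge0//; apply: le_trans h01; apply: le_trans th; exact: lerB.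
have W1 s t j : s0 <= s -> s <= t -> t <= t0 -> `|weight1 w s t j| <= wsize alpha Kw s t.
  by move=> ss st tt; apply: (weight1_le wg) => //; [exact: le_trans ss|exact: le_trans t0T].
have W2 s t J : s0 <= s -> s <= t -> t <= t0 -> `|weight2 w s t J| <= wsize alpha Kw s t ^+ 2.
  move=> ss st tt; apply: (weight2_le alpha_lt wg) => //; [exact: le_trans ss|exact: le_trans t0T|].
  by apply: le_trans h01; apply: le_trans th; rewrite lerB.
have cB : compact B by exact: norm_ball_compact.
have bounds k g : CL_fun F k g -> exists2 Kg, 0 <= Kg & bounded_words z B k (pullback i g) Kg.
  by move=> CLg; exact: (compact_bounded_words oU cB BU (CLg i)).
have rem g Kg s t : CL_fun F 1 g -> 0 <= Kg -> bounded_words z B 1 (pullback i g) Kg ->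
    s0 <= s -> s <= t -> t <= t0 ->
    `|pullback i g (y t, z) - pullback i g (davie_step w (c1 i) (c0 i) z s t (y s), z)| <=
    N%:R * Kg * L * ((t - s) `^ alpha) ^+ 3.
  move=> CLg Kg0 bg ss st tt.
  apply: le_trans (box_lipschitz oU pN Bconv BU Kg0 (CLg i) bg (ystep s t ss st tt) (By t (le_trans ss st) tt)) _.
  rewrite -[leRHS]mulrA ler_wpM2l ?mulr_ge0//.
  by rewrite -powR_3alpha ?subr_ge0//; exact: ysol.
have vfE g j s : CL_fun F 1 g -> s0 <= s -> s <= t0 ->
    vf_apply (V j) g (chartv i (y s, z)) = lie (c1 i j) (pullback i g) (y s, z).
  move=> CLg ss st; have iq := BU (y s) (By s ss st).
  by rewrite (vf_applyE (V j) CLg (chart_inv_dom iq)) chartVK.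
have split3 (a b c e f A1 A2 : R) : `|a - b| <= A1 -> `|b - c - e - f| <= A2 -> `|a - c - e - f| <= A1 + A2.
  move=> h1 h2; rewrite (_ : a - c - e - f = (a - b) + (b - c - e - f)); last by ring.
  by apply: le_trans (ler_normD _ _) _; exact: lerD.
split => g CLg.
- have [Kg Kg0 bg] := bounds 1%N g CLg.
  exists (N%:R * Kg * L + 2 * N%:R ^+ 2 * Kg * K * kappa Kw).
    by rewrite !(mulr_ge0, addr_ge0, exprn_ge0).
  move=> s t ss st tt; have [v0 v1] := pw s t ss st tt; set v := _ `^ _ in v0 v1 *.
  have E1 := rem g Kg s t CLg Kg0 bg ss st tt.
  have E2 := ito1 oU pN dN JN Bconv BU K0 b1 b2 (wsize_ge0 wg s t) (wk s t ss st tt)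
    (fun j => W1 s t j ss st tt) (fun J => W2 s t J ss st tt) Kg0 (CLg i) bg
    (By s ss (le_trans st tt)) (ystep s t ss st tt).
  have := @split3 (pullback i g (y t, z)) _ (pullback i g (y s, z)) 0 0 _ _ E1.
  rewrite !subr0 => /(_ _ E2) /le_trans; apply.
  rewrite [leRHS]mulrDl /wsize -/v; apply: lerD; last by rewrite !mulrA.
  by apply: ler_wpM2l; [rewrite !mulr_ge0|rewrite exprS ler_piMr// exprn_ile1].
- have [Kg Kg0 bg] := bounds 2%N g CLg.
  have CLg1 : CL_fun F 1 g by exact: CL_fun_le CLg.
  exists (N%:R * Kg * L + (4 * N%:R ^+ 4 * Kg * K ^+ 2 + N%:R ^+ 2 * Kg * K) * (kappa Kw) ^+ 2).
    by rewrite !(mulr_ge0, addr_ge0, exprn_ge0).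
  move=> s t ss st tt; have [v0 v1] := pw s t ss st tt.
  rewrite powR_2alpha ?subr_ge0//; set v := _ `^ _ in v0 v1 *.
  have E1 := rem g Kg s t CLg1 Kg0 (bounded_words_le (leqnSn 1) bg) ss st tt.
  have E2 := ito2 oU pN dN JN Bconv BU K0 b1 b2 (wsize_ge0 wg s t) (wk s t ss st tt)
    (fun j => W1 s t j ss st tt) (fun J => W2 s t J ss st tt) Kg0 (CLg i) bg
    (By s ss (le_trans st tt)) (ystep s t ss st tt).
  under eq_bigr do rewrite vfE ?(le_trans st tt)//.
  have := @split3 (pullback i g (y t, z)) _ (pullback i g (y s, z)) (\sum_j weight1 w s t j * lie (c1 i j) (pullback i g) (y s, z)) 0 _ _ E1.
  rewrite !subr0 => /(_ _ E2) /le_trans; apply.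
  rewrite [leRHS]mulrDl /wsize -/v exprMn; apply: lerD; last by rewrite !mulrA.
  by apply: ler_wpM2l; [rewrite !mulr_ge0|rewrite exprS ler_piMl// exprn_ge0].
- have [Kg Kg0 bg] := bounds 3%N g CLg.
  have CLg1 : CL_fun F 1 g by exact: CL_fun_le CLg.
  have CLg2 : CL_fun F 2 g by exact: CL_fun_le CLg.
  exists (N%:R * Kg * L + (8 * N%:R ^+ 6 * Kg * K ^+ 3 + 3 * N%:R ^+ 4 * Kg * K ^+ 2) * (kappa Kw) ^+ 3).
    by rewrite !(mulr_ge0, addr_ge0, exprn_ge0).
  move=> s t ss st tt; have [v0 v1] := pw s t ss st tt.
  rewrite powR_3alpha ?subr_ge0//; set v := _ `^ _ in v0 v1 *.
  have E1 := rem g Kg s t CLg1 Kg0 (bounded_words_le (leqW (leqnSn 1)) bg) ss st tt.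
  have E2 := ito3 oU pN dN JN Bconv BU K0 CL1 b1 b2 (wsize_ge0 wg s t) (wk s t ss st tt)
    (fun j => W1 s t j ss st tt) (fun J => W2 s t J ss st tt)
    (fun j k => weight_symmetric wg j k (le_trans s00 ss) st (le_trans tt t0T)) Kg0 (CLg i) bg
    (By s ss (le_trans st tt)) (ystep s t ss st tt).
  under eq_bigr do rewrite vfE ?(le_trans st tt)//.
  have iq := BU (y s) (By s ss (le_trans st tt)).
  under [X in _ - _ - X]eq_bigr do rewrite pullback_second//.
  have := @split3 (pullback i g (y t, z)) _ (pullback i g (y s, z)) (\sum_j weight1 w s t j * lie (c1 i j) (pullback i g) (y s, z))
    (\sum_J weight2 w s t J * second_lie (c1 i) (c0 i) (pullback i g) J (y s, z)) _ _ E1 E2.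
  move=> /le_trans; apply.
  by rewrite [leRHS]mulrDl /wsize -/v exprMn; apply: lerD => //; rewrite !mulrA.
Qed.

Lemma local_existence (x0 : M) : exists2 h, 0 < h & \forall x \near x0,
  forall s0 t0, 0 <= s0 -> s0 <= t0 -> t0 <= T -> t0 - s0 <= h ->
  exists2 X : R -> M, X s0 = x & strong_solution s0 t0 X.
Proof.
pose i := chart_at F x0.
have dx0 : dom i x0 by rewrite /i /chart_at; case: cid.
have [rho [K [rho0 K0 box]]] := box_exists dx0.
(* Starting points are taken within [rho / 2] of the centre, and [2 * r + rho / 2 < rho] keeps their
   balls in the box. *)
pose r := rho / 8; have r0 : 0 < r by rewrite divr_gt0.
have [h0 [L [[h00 h01 L0 kh] exist]]] :=
  @flat_existence R p d Z alpha T Kw w alpha_gt alpha_lt wg N K r pN dN JN K0 r0.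
exists h0 => //.
have near_q : \forall q \near chartm i x0, `|(chartm i x0).1 - q.1| < rho / 2 /\ mdist (chartm i x0).2 q.2 < rho.
  apply/nbhs_ballP; exists (rho / 2) => /=; first by rewrite divr_gt0.
  move=> q [/= h1 h2]; split; first by move: h1; rewrite mx_norm_ball.
  by move: h2; rewrite ballEmdist /= => h2; apply: lt_trans h2 _; lra.
have near_d : \forall x \near x0, dom i x by apply: open_nbhs_nbhs; split => //; exact: chart_dom_open.
have near_x : \forall x \near x0, `|(chartm i x0).1 - (chartm i x).1| < rho / 2 /\ mdist (chartm i x0).2 (chartm i x).2 < rho.
  exact: (chart_map_cont dx0 near_q).
apply: filterS2 near_d near_x => x dx [hy hz] s0 t0 s00 st0 t0T th.
set ystar := (chartm i x).1 in hy *; set z := (chartm i x).2 in hz *.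
have inB y : `|y - ystar| <= 2 * r -> `|(chartm i x0).1 - y| < rho.
  move=> By; rewrite -[X in X - y](subrK ystar) -addrA.
  apply: le_lt_trans (ler_normD _ _) _; rewrite [X in _ + X]distrC.
  by move: By hy; rewrite /r; lra.
have sd : step_domain K r (img i) z ystar (c1 i) (c0 i).
  split.
  - exact: open_image.
  - by move=> y /= /inB hy'; have [] := box y z hy' hz.
  - by split; [exact: CL_c1|exact: CL_c2].
  - split.
      by move=> j l s sk y /= /inB hy'; have [_ + _] := box y z hy' hz; exact.
    by move=> J l s sk y /= /inB hy'; have [_ _] := box y z hy' hz; exact.
have [y [y0 ybr ysol ystep]] := exist _ _ _ _ _ sd s0 t0 s00 st0 t0T th.
exists (fun t => chartv i (y t, z)); first by rewrite y0 -surjective_pairing chartK.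
exact: (plaque_strong_solution K0 (ltW r0) L0 h01 kh sd s00 st0 t0T th ybr ysol ystep).
Qed.

End strong_solutions.

(** * Concatenation and global existence *)

Section global_solutions.
Context {R : realType} {p d : nat} {M Z : metricType R}.
Variable F : foliated_space p M Z.
Variables (V0 : vector_field F) (V : 'I_d -> vector_field F).
Hypotheses (CLV0 : CL_vector_field 3 V0) (CLV : forall i, CL_vector_field 3 (V i)).
Variables (alpha T Kw : R) (w : R * R -> 'rV[R]_d * 'M[R]_d).
Hypotheses (alpha_gt : 1 / 3 < alpha) (alpha_lt : alpha < 1 / 2).
Hypothesis wg : weakly_geometric alpha T w Kw.
Local Notation J2 := (option ('I_d * 'I_d)).
Local Notation strong := (strong_solution V0 V alpha w).
Local Notation D2 := (second_apply V0 V).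

Let a0 : 0 < alpha. Proof. by have := alpha_gt; lra. Qed.

Lemma CL_second_apply f J : CL_fun F 3 f -> CL_fun F 1 (D2 f J).
Proof.
move=> CLf; case: J => [[j k]|] /=.
  exact: (CL_vf_apply (k := 1) isT (CLV j) (CL_vf_apply (k := 2) isT (CLV k) CLf)).
exact: (CL_vf_apply (k := 1) isT CLV0 (CL_fun_le (leqnSn 2) CLf)).
Qed.

(** Concatenated intervals may be longer than 1, so the drift weight is compared with (t - s)^(2
    alpha) at the price of a power of [T]. *)
Lemma weight2_le_T s t J : 0 <= s -> s <= t -> t <= T ->
  `|weight2 w s t J| <= (Kw + T `^ (1 - 2 * alpha)) * (t - s) `^ (2 * alpha).
Proof.
move=> s0 st tT; have [K0 _ h2 _ _] := wg.
have h0 : 0 <= t - s by rewrite subr_ge0.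
have P0 : 0 <= (t - s) `^ (2 * alpha) by exact: powR_ge0.
case: J => [[j k]|] /=.
  apply: le_trans (h2 s t j k s0 st tT) _.
  by rewrite ler_wpM2r// lerDl powR_ge0.
rewrite ger0_norm//.
have e0 : 0 <= 1 - 2 * alpha by have := alpha_lt; lra.
apply: (@le_trans _ _ (T `^ (1 - 2 * alpha) * (t - s) `^ (2 * alpha))); last first.
  by rewrite ler_wpM2r// lerDr.
have {1}-> : t - s = (t - s) `^ (1 - 2 * alpha) * (t - s) `^ (2 * alpha).
  rewrite -powRD; first by rewrite subrK powRr1.
  by rewrite subrK oner_eq0.
by rewrite ler_wpM2r// le_powR//; move: s0 tT; lra.
Qed.

Lemma strong_eq s0 t0 x x' : (forall t, s0 <= t -> t <= t0 -> x t = x' t) ->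
  strong s0 t0 x -> strong s0 t0 x'.
Proof.
move=> xx' [E1 E2 E3]; split => g CLg.
- have [C C0 H] := E1 g CLg; exists C => // s t ss st tt.
  by rewrite -!xx' ?(le_trans ss st) ?(le_trans st tt)//; exact: H.
- have [C C0 H] := E2 g CLg; exists C => // s t ss st tt.
  by rewrite -!xx' ?(le_trans ss st) ?(le_trans st tt)//; exact: H.
- have [C C0 H] := E3 g CLg; exists C => // s t ss st tt.
  by rewrite -!xx' ?(le_trans ss st) ?(le_trans st tt)//; exact: H.
Qed.

Lemma glue_estimate (E : R -> R -> R) s0 c t0 theta C1 C2 C3 : 0 <= theta ->
  0 <= C1 -> 0 <= C2 -> 0 <= C3 ->
  (forall s t, s0 <= s -> s <= t -> t <= c -> `|E s t| <= C1 * (t - s) `^ theta) ->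
  (forall s t, c <= s -> s <= t -> t <= t0 -> `|E s t| <= C2 * (t - s) `^ theta) ->
  (forall s t, s0 <= s -> s <= c -> c <= t -> t <= t0 ->
     `|E s t| <= `|E s c| + `|E c t| + C3 * (t - s) `^ theta) ->
  forall s t, s0 <= s -> s <= t -> t <= t0 -> `|E s t| <= (C1 + C2 + C3) * (t - s) `^ theta.
Proof.
move=> th0 C10 C20 C30 H1 H2 H3 s t ss st tt.
have P0 : 0 <= (t - s) `^ theta by exact: powR_ge0.
have [tc|ct] := leP t c.
  by apply: le_trans (H1 s t ss st tc) _; rewrite ler_wpM2r// -addrA lerDl addr_ge0.
have [cs|sc] := leP c s.
  by apply: le_trans (H2 s t cs st tt) _; rewrite ler_wpM2r// addrAC lerDr addr_ge0.
apply: le_trans (H3 s t ss (ltW sc) (ltW ct) tt) _; rewrite 2!mulrDl.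
rewrite lerD2r; apply: lerD.
  apply: le_trans (H1 s c ss (ltW sc) (lexx c)) _; rewrite ler_wpM2l// le_powR ?subr_ge0 ?(ltW sc)//.
  by rewrite lerD2r ltW.
apply: le_trans (H2 c t (lexx c) (ltW ct) tt) _; rewrite ler_wpM2l// le_powR ?subr_ge0 ?(ltW ct)//.
by rewrite lerB// ltW.
Qed.

(** For [s < c < t], Chen's relation writes the third-order error as the errors on the two pieces
    plus first-level weights times second-order errors of [vf_apply (V i) g] plus second-level
    weights times increments of the [second_apply] terms. The lower-order clauses at [c] give all of
    this the order 3 alpha. *)
Lemma strong_concat s0 c t0 x : 0 <= s0 -> t0 <= T -> s0 <= c -> c <= t0 ->
  strong s0 c x -> strong c t0 x -> strong s0 t0 x.
Proof.
move=> s00 t0T sc0 ct0 [A1 A2 A3] [B1 B2 B3].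
have [Kw0 _ _ _ _] := wg.
pose N := (d + #|{: J2}|)%N.
have dN : (#|'I_d| <= N)%N by rewrite card_ord leq_addr.
have JN : (#|{: J2}| <= N)%N by rewrite leq_addl.
pose k1 := kappa Kw; have k10 : 0 <= k1 by apply: le_trans (kappa_ge1 wg).
pose k2 := Kw + T `^ (1 - 2 * alpha); have k20 : 0 <= k2 by rewrite addr_ge0// powR_ge0.
have pow u v r : 0 <= r -> u <= v -> 0 <= u -> u `^ r <= v `^ r by move=> *; exact: le_powR.
have w1le s t i : s0 <= s -> s <= c -> c <= t -> t <= t0 -> `|weight1 w c t i| <= k1 * (t - s) `^ alpha.
  move=> ss sc ct tt; apply: le_trans (weight1_le wg i (le_trans s00 sc0) ct (le_trans tt t0T)) _.
  by rewrite /wsize ler_wpM2l// pow ?(ltW a0) ?subr_ge0// lerB.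
have w2le s t J : s0 <= s -> s <= c -> c <= t -> t <= t0 -> `|weight2 w c t J| <= k2 * ((t - s) `^ alpha) ^+ 2.
  move=> ss sc ct tt; apply: le_trans (weight2_le_T J (le_trans s00 sc0) ct (le_trans tt t0T)) _.
  rewrite -/k2 -powR_2alpha ?subr_ge0 ?(le_trans sc)// ler_wpM2l// pow ?subr_ge0//.
    by rewrite mulr_ge0// ltW.
  by rewrite lerB.
have expand1 g : CL_fun F 1 g -> exists2 C, 0 <= C & forall s t, s0 <= s -> s <= c -> c <= t ->
    `|g (x c) - g (x s)| <= C * (t - s) `^ alpha.
  move=> CLg; have [C C0 H] := A1 g CLg; exists C => // s t ss sc ct.
  apply: le_trans (H s c ss sc (lexx c)) _.
  by rewrite ler_wpM2l// pow ?(ltW a0) ?subr_ge0// lerD2r.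
have expand2 g : CL_fun F 2 g -> exists2 C, 0 <= C & forall s t, s0 <= s -> s <= c -> c <= t ->
    `|g (x c) - g (x s) - \sum_i weight1 w s c i * vf_apply (V i) g (x s)| <= C * ((t - s) `^ alpha) ^+ 2.
  move=> CLg; have [C C0 H] := A2 g CLg; exists C => // s t ss sc ct.
  rewrite -powR_2alpha ?subr_ge0 ?(le_trans sc)//.
  apply: le_trans (H s c ss sc (lexx c)) _.
  by rewrite ler_wpM2l// pow ?subr_ge0 ?mulr_ge0 ?(ltW a0)// lerD2r.
split => g CLg.
- have [C1 C10 H1] := A1 g CLg; have [C2 C20 H2] := B1 g CLg.
  exists (C1 + C2 + 0); first by rewrite !addr_ge0.
  apply: (@glue_estimate (fun s t => g (x t) - g (x s)) s0 c) => //; first exact: ltW.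
  move=> s t ss sc ct tt; rewrite mul0r addr0.
  rewrite (_ : g (x t) - g (x s) = (g (x c) - g (x s)) + (g (x t) - g (x c))); last by ring.
  exact: ler_normD.
- have [C1 C10 H1] := A2 g CLg; have [C2 C20 H2] := B2 g CLg.
  have CLVg i : CL_fun F 1 (vf_apply (V i) g) by exact: (CL_vf_apply (k := 1) isT (CLV i) CLg).
  have [D HD] := choice2 (fun i => expand1 _ (CLVg i)).
  pose DD := \sum_i D i.
  have DD0 : 0 <= DD by apply: sumr_ge0 => i _; have [] := HD i.
  have DDi i : D i <= DD by rewrite /DD (bigD1 i)//= lerDl sumr_ge0// => j _; have [] := HD j.
  exists (C1 + C2 + N%:R * (k1 * DD)); first by rewrite !(addr_ge0, mulr_ge0).
  apply: (@glue_estimate (fun s t => g (x t) - g (x s) - \sum_i weight1 w s t i * vf_apply (V i) g (x s)) s0 c) => //.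
  + by rewrite mulr_ge0// ltW.
  + by rewrite !mulr_ge0.
  move=> s t ss sc ct tt.
  have h0 : 0 <= t - s by rewrite subr_ge0 (le_trans sc).
  rewrite (_ : g (x t) - g (x s) - _ = (g (x c) - g (x s) - \sum_i weight1 w s c i * vf_apply (V i) g (x s)) +
     (g (x t) - g (x c) - \sum_i weight1 w c t i * vf_apply (V i) g (x c)) +
     \sum_i weight1 w c t i * (vf_apply (V i) g (x c) - vf_apply (V i) g (x s))); last first.
    under [X in _ = _ + X]eq_bigr do rewrite mulrBr.
    rewrite sumrB.
    under [X in _ - X = _]eq_bigr do rewrite (weight1_chen wg _ (le_trans s00 ss) sc ct (le_trans tt t0T)) mulrDl.
    by rewrite big_split /=; ring.
  apply: le_trans (ler_normD _ _) _; apply: lerD; first exact: ler_normD.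
  have v0 : 0 <= (t - s) `^ alpha by exact: powR_ge0.
  apply: le_trans (dot_le (X := k1 * (t - s) `^ alpha) (Y := DD * (t - s) `^ alpha) dN _ _ _ _) _.
  + by move=> i; exact: w1le.
  + by move=> i; have [_ h] := HD i; apply: le_trans (h s t ss sc ct) _; rewrite ler_wpM2r.
  + by rewrite mulr_ge0.
  + by rewrite mulr_ge0.
  by rewrite powR_2alpha// le_eqVlt; apply/orP; left; apply/eqP; ring.
- have [C1 C10 H1] := A3 g CLg; have [C2 C20 H2] := B3 g CLg.
  have CLVg i : CL_fun F 2 (vf_apply (V i) g) by exact: (CL_vf_apply (k := 2) isT (CLV i) CLg).
  have CLDg J : CL_fun F 1 (D2 g J) by exact: CL_second_apply.
  have [D HD] := choice2 (fun i => expand2 _ (CLVg i)).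
  have [D' HD'] := choice2 (fun J => expand1 _ (CLDg J)).
  pose DD := \sum_i D i; pose DD' := \sum_J D' J.
  have DD0 : 0 <= DD by apply: sumr_ge0 => i _; have [] := HD i.
  have DDi i : D i <= DD by rewrite /DD (bigD1 i)//= lerDl sumr_ge0// => j _; have [] := HD j.
  have DD0' : 0 <= DD' by apply: sumr_ge0 => i _; have [] := HD' i.
  have DDi' i : D' i <= DD' by rewrite /DD' (bigD1 i)//= lerDl sumr_ge0// => j _; have [] := HD' j.
  have CC0 : 0 <= N%:R * (k1 * DD) + N%:R * (k2 * DD').
    exact: (addr_ge0 (mulr_ge0 (ler0n _ _) (mulr_ge0 k10 DD0)) (mulr_ge0 (ler0n _ _) (mulr_ge0 k20 DD0'))).
  exists (C1 + C2 + (N%:R * (k1 * DD) + N%:R * (k2 * DD'))); first exact: (addr_ge0 (addr_ge0 C10 C20) CC0).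
  apply: (@glue_estimate (fun s t => g (x t) - g (x s) - \sum_i weight1 w s t i * vf_apply (V i) g (x s)
       - \sum_J weight2 w s t J * D2 g J (x s)) s0 c) => //.
  + by rewrite mulr_ge0// ltW.
  move=> s t ss sc ct tt.
  have h0 : 0 <= t - s by rewrite subr_ge0 (le_trans sc).
  rewrite (_ : g (x t) - g (x s) - _ - _ = (g (x c) - g (x s) - \sum_i weight1 w s c i * vf_apply (V i) g (x s)
         - \sum_J weight2 w s c J * D2 g J (x s)) +
     (g (x t) - g (x c) - \sum_i weight1 w c t i * vf_apply (V i) g (x c) - \sum_J weight2 w c t J * D2 g J (x c)) +
     (\sum_i weight1 w c t i * (vf_apply (V i) g (x c) - vf_apply (V i) g (x s)
         - \sum_j weight1 w s c j * vf_apply (V j) (vf_apply (V i) g) (x s)) +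
      \sum_J weight2 w c t J * (D2 g J (x c) - D2 g J (x s)))); last first.
    under [X in _ = _ + (X + _)]eq_bigr do rewrite !mulrBr.
    rewrite !sumrB.
    under [X in _ = _ + (_ + X)]eq_bigr do rewrite mulrBr.
    rewrite sumrB.
    under [X in _ - X - _ = _]eq_bigr do rewrite (weight1_chen wg _ (le_trans s00 ss) sc ct (le_trans tt t0T)) mulrDl.
    under [X in _ - _ - X = _]eq_bigr do rewrite (weight2_chen wg _ (le_trans s00 ss) sc ct (le_trans tt t0T)) !mulrDl.
    rewrite !big_split /=.
    have -> : \sum_(J : J2) (if J is Some jk then weight1 w s c jk.1 * weight1 w c t jk.2 else 0) * D2 g J (x s) =
       \sum_i weight1 w c t i * \sum_j weight1 w s c j * vf_apply (V j) (vf_apply (V i) g) (x s).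
      rewrite sum_option mul0r add0r.
      rewrite -(pair_bigA _ (fun j k => weight1 w s c j * weight1 w c t k * vf_apply (V j) (vf_apply (V k) g) (x s))) /= exchange_big /=.
      apply: eq_bigr => k _; rewrite mulr_sumr; apply: eq_bigr => j _; ring.
    by ring.
  apply: le_trans (ler_normD _ _) _; apply: lerD; first exact: ler_normD.
  have v0 : 0 <= (t - s) `^ alpha by exact: powR_ge0.
  have v20 : 0 <= ((t - s) `^ alpha) ^+ 2 by exact: exprn_ge0.
  have F1 : `|\sum_i weight1 w c t i * (vf_apply (V i) g (x c) - vf_apply (V i) g (x s)
         - \sum_j weight1 w s c j * vf_apply (V j) (vf_apply (V i) g) (x s))| <=
      N%:R * (k1 * (t - s) `^ alpha * (DD * ((t - s) `^ alpha) ^+ 2)).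
    apply: (dot_le dN) => [i|i||].
    + exact: w1le.
    + by have [_ h] := HD i; apply: le_trans (h s t ss sc ct) _; rewrite ler_wpM2r.
    + by rewrite mulr_ge0.
    + by rewrite mulr_ge0.
  have F2 : `|\sum_J weight2 w c t J * (D2 g J (x c) - D2 g J (x s))| <=
      N%:R * (k2 * ((t - s) `^ alpha) ^+ 2 * (DD' * (t - s) `^ alpha)).
    apply: (dot_le JN) => [J|J||].
    + exact: w2le.
    + by have [_ h] := HD' J; apply: le_trans (h s t ss sc ct) _; rewrite ler_wpM2r.
    + by rewrite mulr_ge0.
    + by rewrite mulr_ge0.
  apply: le_trans (ler_normD _ _) _; apply: le_trans (lerD F1 F2) _.
  by rewrite powR_3alpha// le_eqVlt; apply/orP; left; apply/eqP; ring.
Qed.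

Hypothesis compact_M : compact [set: M].

(** The time of existence is uniform near each point; compactness in its near-covering form, with
    [h] tending to 0 from the right, makes it uniform on M. *)
Lemma uniform_local_existence : exists2 h, 0 < h & forall x : M,
  forall s0 t0, 0 <= s0 -> s0 <= t0 -> t0 <= T -> t0 - s0 <= h ->
  exists2 X : R -> M, X s0 = x & strong s0 t0 X.
Proof.
have : \forall h \near (0 : R)^'+, [set: M] `<=` (fun x => forall s0 t0, 0 <= s0 -> s0 <= t0 -> t0 <= T -> t0 - s0 <= h ->
    exists2 X : R -> M, X s0 = x & strong s0 t0 X).
  apply: ((compact_near_coveringP _).1 compact_M R ((0 : R)^'+)) => x0 _.
  have [h h0 near_x] := local_existence CLV0 CLV alpha_gt alpha_lt wg x0.
  exists ([set x | forall s0 t0, 0 <= s0 -> s0 <= t0 -> t0 <= T -> t0 - s0 <= h ->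
    exists2 X : R -> M, X s0 = x & strong s0 t0 X], [set h' | h' <= h]).
    by split => //=; apply: nbhs_right_le.
  move=> [x' h'] [/= H hh] s0 t0 s00 st tT th; apply: H => //; exact: le_trans hh.
move=> near_h; have nh0 : \forall h \near (0 : R)^'+, 0 < h by exact: nbhs_right_gt.
have [h [H h0]] := filter_ex (filterI near_h nh0).
by exists h => // x; exact: H.
Qed.

Lemma global_existence x0 s0 t0 : 0 <= s0 -> s0 <= t0 -> t0 <= T ->
  exists2 X : R -> M, X s0 = x0 & strong s0 t0 X.
Proof.
move=> s00 st0 tT; have [h h0 local] := uniform_local_existence.
have [n nh] : exists n, t0 - s0 <= n%:R * h.
  exists (Num.truncn ((t0 - s0) / h)).+1.
  by rewrite -ler_pdivrMr// ltW// truncnS_gt.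
elim: n t0 st0 tT nh => [|n IH] t0 st0 tT nh.
  apply: local => //; apply: le_trans nh _; rewrite mul0r; exact: ltW.
have [le|lt] := leP (t0 - s0) h; first exact: local.
pose c := t0 - h.
have sc : s0 <= c by rewrite /c; lra.
have ct : c <= t0 by rewrite /c; lra.
have [X1 X1s st1] : exists2 X : R -> M, X s0 = x0 & strong s0 c X.
  apply: IH => //; first exact: le_trans tT.
  by move: nh; rewrite -[n.+1]addn1 natrD mulrDl mul1r /c; lra.
have [X2 X2c st2] : exists2 X : R -> M, X c = X1 c & strong c t0 X.
  apply: local => //; first exact: le_trans sc.
  by rewrite /c opprB addrC subrK.
exists (fun t => if t <= c then X1 t else X2 t); first by rewrite sc.
apply: (strong_concat s00 tT sc ct).
  by apply: strong_eq st1 => t _ ->.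
apply: strong_eq st2 => t ct' _; case: ifP => // tc.
by have -> : t = c by apply/eqP; rewrite eq_le tc.
Qed.

(** Test functions detect the topology: a bump supported in the neighbourhood [A] equals 1 at [x t],
    and by its Hölder bound along the path it stays positive at nearby times. *)
Lemma strong_continuous s0 t0 x : strong s0 t0 x -> {within `[s0, t0]%classic, continuous x}.
Proof.
move=> [E1 _ _]; apply/subspace_continuousP => t tI A nA.
move: (tI); rewrite /= in_itv /= => /andP[st tt].
pose i := chart_at F (x t).
have dx : chart_dom (atlas i) (x t) by rewrite /i /chart_at; case: cid.
have [chi [P [C [[CLchi oP Pq Psub] [clC Csub chi1 chi0]]]]] := bump_exists dx nA.
have CLf : CL_fun F 3 (extend i chi).
  apply: (CL_extend _ clC) => //; first exact: CL_sub CLchi.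
  by move=> y /Csub[].
have f1 : extend i chi (x t) = 1 by rewrite extendE// chi1.
have fA y : 0 < extend i chi y -> A y.
  rewrite /extend; case: asboolP => [dy|_]; last by rewrite ltxx.
  have [Cy|nCy] := pselect (C y); first by have [] := Csub y Cy.
  by rewrite chi0// ltxx.
have [K K0 HK] := E1 _ (CL_fun_le (isT : (1 <= 3)%N) CLf).
(* Within this time the bump changes by at most [K / (K + 1) < 1]. *)
pose del := (K + 1)^-1 `^ alpha^-1.
have K1 : 0 < K + 1 by rewrite ltr_wpDl.
have del0 : 0 < del by rewrite powR_gt0// invr_gt0.
have dela : del `^ alpha = (K + 1)^-1.
  by rewrite /del -powRrM mulVf ?gt_eqF// powRr1// invr_ge0 ltW.
have near_t : \forall s \near t, `|t - s| < del.
  by apply/nbhs_ballP; exists del => // s; rewrite /ball /=.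
apply: filterS near_t => s hs; rewrite /= in_itv /= => /andP[ss stt]; apply: fA.
suff : `|extend i chi (x t) - extend i chi (x s)| < 1.
  by rewrite f1 ltr_norml => /andP[_]; lra.
apply: (@le_lt_trans _ _ (K * (K + 1)^-1)); last by rewrite ltr_pdivrMr//; lra.
have bound u v : s0 <= u -> u <= v -> v <= t0 -> `|v - u| < del ->
    `|extend i chi (x v) - extend i chi (x u)| <= K * (K + 1)^-1.
  move=> su uv vt duv; apply: le_trans (HK u v su uv vt) _.
  rewrite ler_wpM2l// -dela le_powR ?(ltW a0) ?subr_ge0//.
  by move: duv; rewrite ger0_norm ?subr_ge0// => /ltW.
have [sts|tss] := leP s t; first exact: bound.
by rewrite distrC; apply: bound => //; [exact: ltW|rewrite distrC].
Qed.

End global_solutions.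

(** * Uniqueness *)

Section small_times.
Context {R : realType}.

Lemma small_time (alpha c : R) : 0 < alpha -> 0 < c -> exists h, [/\ 0 < h, h <= 1, h `^ alpha <= 1 & h `^ alpha <= c].
Proof.
move=> a0 c0; pose x := Num.min 1 c.
have x0 : 0 < x by rewrite lt_min ltr01.
have [x1 xc] : x <= 1 /\ x <= c by rewrite /x !ge_min !lexx orbT.
have hx : (x `^ alpha^-1) `^ alpha = x by rewrite -powRrM mulVf ?gt_eqF// powRr1// ltW.
exists (x `^ alpha^-1); rewrite hx; split => //; first exact: powR_gt0.
have -> : 1 = 1 `^ alpha^-1 :> R by rewrite powR1.
by apply: le_powR => //; [rewrite invr_ge0 ltW|exact: ltW].
Qed.

End small_times.

Section flat_uniqueness.
Context {R : realType} {p d : nat} {W : topologicalType}.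
Variables (alpha T Kw : R) (w : R * R -> 'rV[R]_d * 'M[R]_d).
Hypotheses (alpha_gt : 1 / 3 < alpha) (alpha_lt : alpha < 1 / 2).
Hypothesis wg : weakly_geometric alpha T w Kw.
Local Notation fn := ('rV[R]_p * W -> R^o).
Local Notation J2 := (option ('I_d * 'I_d)).
Variables (N : nat) (K r L : R).
Hypotheses (pN : (p <= N)%N) (dN : (d <= N)%N) (JN : (#|{: J2}| <= N)%N).
Hypotheses (K0 : 0 <= K) (r0 : 0 < r) (L0 : 0 <= L).
Let M : R := N%:R.
Let M0 : 0 <= M. Proof. by []. Qed.
Let a0 : 0 < alpha. Proof. by have := alpha_gt; lra. Qed.

Lemma flat_unique (U : set ('rV[R]_p * W)) z ystar (c1 : 'I_d -> 'I_p -> fn) (c0 : 'I_p -> fn) :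
  step_domain K r U z ystar c1 c0 -> exists2 h1, 0 < h1 & forall s0 t0 (x y : R -> 'rV[R]_p), 0 <= s0 -> s0 <= t0 -> t0 <= T -> t0 - s0 <= h1 ->
  x s0 = y s0 ->
  (forall t, s0 <= t -> t <= t0 -> `|x t - ystar| <= r) ->
  (forall t, s0 <= t -> t <= t0 -> `|y t - ystar| <= r) ->
  (forall s t, s0 <= s -> s <= t -> t <= t0 ->
      `|x t - davie_step w c1 c0 z s t (x s)| <= L * (t - s) `^ (3 * alpha)) ->
  (forall s t, s0 <= s -> s <= t -> t <= t0 ->
      `|y t - davie_step w c1 c0 z s t (y s)| <= L * (t - s) `^ (3 * alpha)) ->
  forall t, s0 <= t -> t <= t0 -> x t = y t.
Proof.
move=> [oU BU [CL1 CL2] [b1 b2]].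
set B := [set y : 'rV[R]_p | _] in BU b1 b2.
have Bconv : forall a b t, B a -> B b -> 0 <= t -> t <= 1 -> B (a + t *: (b - a)).
  by move=> a b t; exact: norm_ball_convex.
have th1 : 1 < 3 * alpha by have := alpha_gt; lra.
have q1 := half_powR_lt th1; set q := 2^-1 `^ (3 * alpha) in q1.
have q0 : 0 <= q by exact: powR_ge0.
(* The contraction condition reads [(2 + e) * q + Q * h < 1]. Since [q < 1/2], both [e * q] and a
   second summand at most [e] fit into the gap [1 - 2 * q]. *)
pose e : R := (1 - 2 * q) / 3.
have e0 : 0 < e by rewrite /e; lra.
have e1 : e <= 1 / 3 by rewrite /e; lra.
pose k := kappa Kw.
have k1 : 1 <= k by exact: kappa_ge1 wg.
have k0 : 0 <= k by exact: le_trans k1.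
have K3 n : 0 <= K ^+ n by exact: exprn_ge0.
have Mn n : 0 <= M ^+ n by exact: exprn_ge0.
have kn n : 0 <= k ^+ n by exact: exprn_ge0.
(* The first summand is the quadratic coefficient of [incr_4point] for steps of size at most 1, the
   second the Lipschitz constant of the defect. *)
pose Ku := 2 * M * (M ^+ 2 * K) + M * (24 * M ^+ 5 * K ^+ 3 + 8 * M ^+ 3 * K ^+ 2) * k ^+ 3.
have Ku1 : 0 <= 2 * M * (M ^+ 2 * K) by rewrite !mulr_ge0.
have Ku2 : 0 <= M * (24 * M ^+ 5 * K ^+ 3 + 8 * M ^+ 3 * K ^+ 2) * k ^+ 3.
  by apply: mulr_ge0 => //; rewrite !(mulr_ge0, addr_ge0).
have Ku0 : 0 <= Ku by exact: addr_ge0.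
pose Q := 2 * Ku * L * (1 + e) + Ku.
have Q0 : 0 <= Q.
  by apply: addr_ge0 => //; rewrite !mulr_ge0// addr_ge0// ltW.
pose S := k + 2 * M * k * (M * K) + 2 * M * k * K + Q + 1.
have s1 : 0 <= 2 * M * k * (M * K) by exact: (mulr_ge0 (mulr_ge0 (mulr_ge0 (ler0n _ 2) M0) k0) (mulr_ge0 M0 K0)).
have s2 : 0 <= 2 * M * k * K by exact: (mulr_ge0 (mulr_ge0 (mulr_ge0 (ler0n _ 2) M0) k0) K0).
have S0 : 0 < S by rewrite /S; move: k0 s1 s2 Q0; lra.
pose m := Num.min 1 (Num.min e r).
have m0 : 0 < m by rewrite !lt_min ltr01 e0.
have [m1 me mr] : [/\ m <= 1, m <= e & m <= r] by rewrite /m !ge_min !lexx !orbT.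
have [h1 [h10 h11 ha1 hac]] := small_time a0 (divr_gt0 m0 S0).
set v1 := h1 `^ alpha in ha1 hac.
have v10 : 0 <= v1 by exact: powR_ge0.
have part c : c <= S -> v1 * c <= m.
  move=> cS; have [cp|cn] := leP 0 c; last by rewrite (le_trans _ (ltW m0))// mulr_ge0_le0// ltW.
  apply: (@le_trans _ _ (m / S * S)); last by rewrite divfK// gt_eqF.
  by apply: ler_pM.
exists h1 => // s0 t0 x y s00 st0 t0T th xy0 xr yr xsol ysol.
pose mu s t y := if (0 <= s) && (s <= T) then davie_step w c1 c0 z s t y else y.
have muE s t y' : s0 <= s -> s <= t -> t <= t0 -> mu s t y' = davie_step w c1 c0 z s t y'.
  by move=> ss st tt; rewrite /mu (le_trans s00 ss) (le_trans st (le_trans tt t0T)).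
have small s t : s0 <= s -> s <= t -> t <= t0 -> wsize alpha Kw s t <= k * v1.
  move=> ss st tt; rewrite ler_wpM2l// /v1 le_powR ?(ltW a0) ?subr_ge0//.
  by apply: le_trans th; rewrite lerB.
have kS : k <= S by rewrite /S; move: s1 s2 Q0; lra.
have kx1 : k * v1 <= 1 by rewrite mulrC; apply: le_trans m1; exact: part.
have W1 s t i : s0 <= s -> s <= t -> t <= t0 -> `|weight1 w s t i| <= wsize alpha Kw s t.
  by move=> ss st tt; apply: (weight1_le wg) => //; [exact: le_trans ss|exact: le_trans t0T].
have W2 s t J : s0 <= s -> s <= t -> t <= t0 -> `|weight2 w s t J| <= wsize alpha Kw s t ^+ 2.
  move=> ss st tt; apply: (weight2_le alpha_lt wg) => //; [exact: le_trans ss|exact: le_trans t0T|].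
  by apply: le_trans h11; apply: le_trans th; rewrite lerB.
have rB y' : `|y' - ystar| <= r -> B y'.
  by move=> h; rewrite /B /=; apply: le_trans h _; rewrite ler_peMl ?ltW// ltr1n.
have Bstep s t y' : s0 <= s -> s <= t -> t <= t0 -> `|y' - ystar| <= r -> B (davie_step w c1 c0 z s t y').
  move=> ss st tt hr; have By' := rB y' hr; have wk := small s t ss st tt.
  have := incr_bound dN JN K0 b1 b2 (wsize_ge0 wg s t) (le_trans wk kx1)
    (fun i => W1 s t i ss st tt) (fun J => W2 s t J ss st tt) By'.
  move=> hb; rewrite /B /= /davie_step addrAC; apply: le_trans (ler_normD _ _) _.
  have hb2 : 2 * M * wsize alpha Kw s t * K <= r.
    apply: (@le_trans _ _ (2 * M * (k * v1) * K)).
      by rewrite ler_wpM2r// ler_wpM2l// mulr_ge0.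
    rewrite [leLHS](_ : _ = v1 * (2 * M * k * K)); last by ring.
    by apply: le_trans mr; apply: part; rewrite /S; move: k0 s1 Q0; lra.
  by move: hr (le_trans hb hb2); lra.
apply: (@sewing_unique R 'rV[R]_p mu x y B s0 t0 (3 * alpha) e Ku L) => //.
- by rewrite mulr_ge0// ltW.
- exact: ltW.
- by move=> s y'; rewrite /mu; case: ifP => // /andP[? ?]; rewrite (davie_step_id alpha_gt alpha_lt wg).
- move=> s t ss st tt; rewrite !muE//; split.
  + by apply: rB; apply: xr => //; exact: le_trans tt.
  + by apply: Bstep => //; apply: xr => //; exact: le_trans tt.
  + by apply: rB; apply: yr => //; exact: le_trans tt.
  + by apply: Bstep => //; apply: yr => //; exact: le_trans tt.
- by move=> s t ss st tt; rewrite muE//; exact: xsol.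
- by move=> s t ss st tt; rewrite muE//; exact: ysol.
- move=> s t a b ss st tt Ba Bb; rewrite !muE// /davie_step opprD addrACA.
  apply: le_trans (ler_normD _ _) _; rewrite mulrDl mul1r lerD2l.
  have wk := small s t ss st tt.
  apply: le_trans (incr_lip oU pN dN JN Bconv BU K0 CL1 CL2 b1 b2 (wsize_ge0 wg s t) (le_trans wk kx1)
    (fun i => W1 s t i ss st tt) (fun J => W2 s t J ss st tt) Ba Bb) _.
  apply: (@le_trans _ _ (2 * M * (k * v1) * (M * K * `|a - b|))).
    by rewrite ler_wpM2r ?mulr_ge0// ler_wpM2l// mulr_ge0.
  rewrite [leLHS](_ : _ = v1 * (2 * M * k * (M * K)) * `|a - b|); last by ring.
  rewrite ler_wpM2r//; apply: le_trans me; apply: part; rewrite /S; move: k0 s2 Q0; lra.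
- move=> s t a b c d' ss st tt Ba Bb Bc Bd; rewrite !muE// /davie_step.
  have wk := small s t ss st tt.
  have := incr_4point oU pN dN JN Bconv BU K0 CL1 CL2 b1 b2 (wsize_ge0 wg s t) (le_trans wk kx1)
    (fun i => W1 s t i ss st tt) (fun J => W2 s t J ss st tt) Ba Bb Bc Bd.
  set Ia := davie_incr _ _ _ _ _ a; set Ib := davie_incr _ _ _ _ _ b.
  set Ic := davie_incr _ _ _ _ _ c; set Id := davie_incr _ _ _ _ _ d'.
  move=> E.
  have -> : a + Ia - (b + Ib) - (c + Ic - (d' + Id)) = (a - b - (c - d')) + (Ia - Ib - (Ic - Id)).
    by apply/rowP => j; rewrite !mxE; ring.
  apply: le_trans (ler_normD _ _) _; rewrite mulrDl mul1r -[leRHS]addrA lerD2l.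
  apply: le_trans E _.
  set X := `|a - b - (c - d')|; set Y := (`|a - b| + `|c - d'|) * `|b - d'|.
  have X0 : 0 <= X by exact: normr_ge0.
  have Y0 : 0 <= Y by exact: (mulr_ge0 (addr_ge0 (normr_ge0 _) (normr_ge0 _)) (normr_ge0 _)).
  have -> : M ^+ 2 * K * (`|a - b| + `|c - d'|) * `|b - d'| = M ^+ 2 * K * Y by rewrite /Y mulrA.
  rewrite -[Ku * _ * _]mulrA -/Y [leLHS]mulrDr; apply: lerD.
    apply: (@le_trans _ _ (2 * M * (k * v1) * (M * K * X))).
      by rewrite ler_wpM2r ?mulr_ge0// ler_wpM2l// mulr_ge0.
    rewrite [leLHS](_ : _ = v1 * (2 * M * k * (M * K)) * X); last by ring.
    rewrite ler_wpM2r//; apply: le_trans me; apply: part; rewrite /S; move: k0 s2 Q0; lra.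
  apply: (@le_trans _ _ (2 * M * 1 * (M ^+ 2 * K * Y))).
    by rewrite ler_wpM2r ?mulr_ge0// ler_wpM2l ?mulr_ge0//; exact: le_trans wk kx1.
  rewrite mulr1 mulrA ler_wpM2r// /Ku lerDl//.
- move=> s u t ss su ut tt.
  have us := le_trans ss su; have st := le_trans su ut; have ut' := le_trans ut tt.
  rewrite !muE//.
  have wk := small s t ss st tt.
  have wsu : wsize alpha Kw s u <= wsize alpha Kw s t by exact: (wsize_le alpha_gt wg).
  have wut : wsize alpha Kw u t <= wsize alpha Kw s t by exact: (wsize_le alpha_gt wg).
  have W2sq a b J : s0 <= a -> a <= b -> b <= t0 -> wsize alpha Kw a b <= wsize alpha Kw s t -> `|weight2 w a b J| <= wsize alpha Kw s t ^+ 2.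
    move=> g1 g2 g3 g4; apply: le_trans (W2 a b J g1 g2 g3) _.
    by rewrite lerXn2r ?nnegrE ?(wsize_ge0 wg).
  have xs := xr s ss (le_trans st tt); have ys := yr s ss (le_trans st tt).
  have := davie_defect_lip oU pN dN JN Bconv BU K0 CL1 CL2 b1 b2 (wsize_ge0 wg s t) (le_trans wk kx1)
    (fun i => le_trans (W1 s u i ss su ut') wsu) (fun J => W2sq s u J ss su ut' wsu)
    (fun i => le_trans (W1 u t i us ut tt) wut) (fun J => W2sq u t J us ut tt wut)
    (fun i => weight1_chen wg i (le_trans s00 ss) su ut (le_trans tt t0T))
    (fun J => weight2_chen wg J (le_trans s00 ss) su ut (le_trans tt t0T))
    (rB _ xs) (Bstep s u _ ss su ut' xs) (rB _ ys) (Bstep s u _ ss su ut' ys).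
  move=> /le_trans; apply.
  rewrite ler_wpM2r// /wsize exprMn powR_3alpha ?subr_ge0// mulrA ler_wpM2r ?exprn_ge0 ?powR_ge0//.
  by rewrite /Ku lerDr.
- have hx : (t0 - s0) `^ (3 * alpha) <= v1.
    rewrite powR_3alpha ?subr_ge0//; set v := _ `^ _.
    have v0 : 0 <= v by exact: powR_ge0.
    have vx : v <= v1 by rewrite /v /v1 le_powR ?(ltW a0) ?subr_ge0.
    apply: (le_trans _ vx); rewrite exprS ler_piMr// exprn_ile1//.
    exact: le_trans vx ha1.
  have hQ : (2 * Ku * L * (1 + e) + Ku) * (t0 - s0) `^ (3 * alpha) <= e.
    apply: le_trans (ler_wpM2l Q0 hx) _; rewrite mulrC; apply: le_trans me; apply: part.
    by rewrite /S; move: k0 s1 s2; lra.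
  rewrite -/q; apply: le_lt_trans (lerD (lexx _) hQ) _.
  have : e * q <= e * (1 / 2) by rewrite ler_wpM2l ?(ltW e0)//; lra.
  by rewrite /e; move: q1; lra.
Qed.

End flat_uniqueness.

(** * From test functions to Davie's estimate, and back to paths on M *)

Section local_steps.
Context {R : realType} {p d : nat} {M Z : metricType R}.
Variable F : foliated_space p M Z.
Variables (V0 : vector_field F) (V : 'I_d -> vector_field F).
Hypotheses (CLV0 : CL_vector_field 3 V0) (CLV : forall i, CL_vector_field 3 (V i)).
Variables (alpha T Kw : R) (w : R * R -> 'rV[R]_d * 'M[R]_d).
Hypotheses (alpha_gt : 1 / 3 < alpha) (alpha_lt : alpha < 1 / 2).
Hypothesis wg : weakly_geometric alpha T w Kw.
Local Notation chartm i := (chart_map (atlas (f:=F) i)).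
Local Notation chartv i := (chart_inv (atlas (f:=F) i)).
Local Notation dom i := (chart_dom (atlas (f:=F) i)).
Local Notation img i := (chart_image (atlas (f:=F) i)).
Local Notation fn := ('rV[R]_p * Z -> R^o).
Local Notation J2 := (option ('I_d * 'I_d)).
Local Notation c0 i := (drift_component V0 i).
Local Notation c1 i := (driving_component V i).
Local Notation c2 i := (second_coef (c1 i) (c0 i)).
Local Notation D2 := (second_apply V0 V).

(** Every C^3 function in the chart coincides, on one neighbourhood common to all of them, with a
    global test function: its product with the bump. *)
Lemma plateau i x0 : dom i x0 -> exists P : set ('rV[R]_p * Z),
  [/\ open P, P (chartm i x0), P `<=` img i &
    forall g : fn, CL 3 (img i) g -> exists2 f, CL_fun F 3 f & forall q, P q -> pullback i f q = g q].
Proof.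
move=> dx0; have [chi [P [C [[CLchi oP Px0 Pimg] [clC Cdom chi1 chi0]]]]] :=
  bump_exists dx0 (@filterT _ (nbhs x0) _).
have oi := @open_image _ _ _ _ F i.
exists P; split => // g CLg; exists (extend i (fun q => chi q * g q)).
  apply: (CL_extend _ clC); first by apply: CLM => //; exact: CL_sub CLchi.
    by move=> x /Cdom[].
  by move=> x dx nC; rewrite chi0// mul0r.
by move=> q Pq; rewrite pullback_extend ?chi1 ?mul1r//; exact: Pimg.
Qed.

Section on_plateau.
Variables (i : fs_index F) (P : set ('rV[R]_p * Z)) (f : M -> R) (g : fn).
Hypotheses (oP : open P) (Pimg : P `<=` img i) (CLf : CL_fun F 3 f).
Hypothesis fg : forall q, P q -> pullback i f q = g q.

Lemma plateau_apply (U : vector_field F) x : dom i x -> P (chartm i x) ->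
  vf_apply U f x = lie (component U i) g (chartm i x).
Proof.
move=> dx Px; rewrite (vf_applyE U (CL_fun_le (isT : (1 <= 3)%N) CLf) dx).
exact: (@eq_lie _ _ _ P).
Qed.

Lemma plateau_second J x : dom i x -> P (chartm i x) ->
  D2 f J x = second_lie (c1 i) (c0 i) g J (chartm i x).
Proof.
move=> dx Px; rewrite -{1}(chartK dx) [X in D2 f J (chartv i X)]surjective_pairing.
rewrite (pullback_second V0 CLV) -?surjective_pairing; last exact: Pimg.
  case: J => [[j k]|] /=; last exact: (@eq_lie _ _ _ P).
  by apply: (@eq_lie _ _ _ P) => // q Pq; exact: (@eq_lie _ _ _ P).
exact: (CL_fun_le (isT : (2 <= 3)%N) CLf).
Qed.

End on_plateau.

Lemma second_lie_coord i J l q : second_lie (c1 i) (c0 i) (fun q => q.1 0 l) J q = c2 i J l q.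
Proof.
case: J => [[j k]|] /=; last exact: lie_coord.
by congr (lie _ _ q); apply/funext => q'; exact: lie_coord.
Qed.

Lemma second_lie_snd i J (h : Z -> R^o) q : second_lie (c1 i) (c0 i) (fun q => h q.2) J q = 0.
Proof.
case: J => [[j k]|] /=; last exact: lie_snd.
have -> : lie (c1 i k) (fun q => h q.2) = (fun q => (fun=> 0 : R^o) q.2).
  by apply/funext => q'; exact: lie_snd.
exact: (lie_snd (c1 i j) (fun=> 0)).
Qed.

Lemma within_window (X : topologicalType) (x : R -> X) a b tau (N : set X) :
  {within `[a, b]%classic, continuous x} -> a <= tau -> tau <= b -> nbhs (x tau) N ->
  exists2 h, 0 < h & forall t, a <= t -> t <= b -> `|tau - t| <= h -> N (x t).
Proof.
move=> cx at_ tb nN.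
have tI : `[a, b]%classic tau by rewrite /= in_itv /= at_.
have := (@subspace_continuousP _ _ _ x).1 cx tau tI N nN.
move=> /nbhs_ballP[h /= h0 H]; exists (h / 2); first by rewrite divr_gt0.
move=> t ta tb' th; apply: H; last by rewrite /= in_itv /= ta.
by rewrite /ball /=; apply: le_lt_trans th _; lra.
Qed.

(* The local property shared by the solutions of the RDE and of the ODE. *)
Definition davie_path (i : fs_index F) (rho s0 t0 : R) (x : R -> M) := exists2 L, 0 <= L &
  forall s t, s0 <= s -> s <= t -> t <= t0 ->
  [/\ dom i (x t), (chartm i (x t)).2 = (chartm i (x s0)).2,
    `|(chartm i (x t)).1 - (chartm i (x s0)).1| <= rho &
    `|(chartm i (x t)).1 - davie_step w (c1 i) (c0 i) (chartm i (x s0)).2 s t (chartm i (x s)).1|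
      <= L * (t - s) `^ (3 * alpha)].

(** Only windows to the right of [tau] occur, since uniqueness is propagated forward. [rho] is
    arbitrary, so that the path can be confined to a ball on which the flat estimates hold. *)
Definition locally_davie (a b : R) (x : R -> M) := forall tau i rho, a <= tau -> tau < b ->
  dom i (x tau) -> 0 < rho -> exists2 h, 0 < h & davie_path i rho tau (Num.min (tau + h) b) x.

Let N : nat := (p + d + #|{: J2}|)%N.
Let pN : (p <= N)%N. Proof. by rewrite /N -addnA leq_addr. Qed.
Let dN : (d <= N)%N. Proof. by rewrite /N addnAC leq_addl. Qed.
Let JN : (#|{: J2}| <= N)%N. Proof. by rewrite /N leq_addl. Qed.

(** Both paths start from the same point, hence stay at the same height in the chart, and uniqueness
    on that plaque makes them agree for a while; [L1 + L2] is a common error constant. *)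
Lemma davie_extend c x : dom (chart_at F (x c)) (x c) -> 0 <= c -> forall b, c < b -> b <= T -> forall x',
  x' c = x c ->
  (forall rho, 0 < rho -> exists2 h, 0 < h & davie_path (chart_at F (x c)) rho c (Num.min (c + h) b) x) ->
  (forall rho, 0 < rho -> exists2 h, 0 < h & davie_path (chart_at F (x c)) rho c (Num.min (c + h) b) x') ->
  exists c', [/\ c < c', c' <= b & forall t, c <= t -> t <= c' -> x t = x' t].
Proof.
set i := chart_at F (x c) => dx c0' b cb bT x' x'c locx locx'.
have [rho [K [rho0 K0 box]]] := box_exists CLV0 CLV dx.
pose r := rho / 4; have r0 : 0 < r by rewrite divr_gt0.
have [h1 h10 [L1 L10 Hx]] := locx r r0.
have [h2 h20 [L2 L20 Hx']] := locx' r r0.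
set z := (chartm i (x c)).2 in box Hx; set ystar := (chartm i (x c)).1 in box Hx.
rewrite x'c -/z -/ystar in Hx'.
have inB y : `|y - ystar| <= 2 * r -> `|ystar - y| < rho.
  by rewrite distrC /r => By; apply: le_lt_trans By _; lra.
have zrho : mdist z z < rho by rewrite mdistxx.
have sd : step_domain K r (img i) z ystar (c1 i) (c0 i).
  split.
  - exact: open_image.
  - by move=> y /= /inB hy'; have [] := box y z hy' zrho.
  - by split; [exact: CL_c1|exact: CL_c2].
  - split.
      by move=> j l s sk y /= /inB hy'; have [_ + _] := box y z hy' zrho; exact.
    by move=> J l s sk y /= /inB hy'; have [_ _] := box y z hy' zrho; exact.
have L12 : 0 <= L1 + L2 by exact: addr_ge0.
have [h3 h30 uniq_flat] := @flat_unique R p d Z alpha T Kw w alpha_gt alpha_lt wg N K r (L1 + L2)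
  pN dN JN K0 r0 L12 (img i) z ystar (c1 i) (c0 i) sd.
pose c' := Num.min (c + Num.min h1 (Num.min h2 h3)) b.
have cc' : c < c' by rewrite lt_min cb ltrDl !lt_min h10 h20 h30.
have [e1 e2 e3 e4] : [/\ c' <= Num.min (c + h1) b, c' <= Num.min (c + h2) b, c' <= c + h3 & c' <= b].
  have e4 : c' <= b by rewrite ge_min lexx orbT.
  have e0 : c' <= c + Num.min h1 (Num.min h2 h3) by rewrite ge_min lexx.
  rewrite !le_min e4 !andbT; split => //; apply: (le_trans e0); rewrite lerD2l !ge_min lexx ?orbT//.
exists c'; split => // t ct tc'.
have Hx1 s u (a1 : c <= s) (a2 : s <= u) (a3 : u <= c') := Hx s u a1 a2 (le_trans a3 e1).
have Hx1' s u (a1 : c <= s) (a2 : s <= u) (a3 : u <= c') := Hx' s u a1 a2 (le_trans a3 e2).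
have c'h : c' - c <= h3 by rewrite lerBlDl.
have pw s u : 0 <= (u - s) `^ (3 * alpha) by exact: powR_ge0.
have E := uniq_flat c c' (fun t => (chartm i (x t)).1) (fun t => (chartm i (x' t)).1) c0' (ltW cc')
  (le_trans e4 bT) c'h.
have [d1 z1 _ _] := Hx1 c t (lexx c) ct tc'.
have [d1' z1' _ _] := Hx1' c t (lexx c) ct tc'.
rewrite -(chartK d1) -(chartK d1') [chartm i (x t)]surjective_pairing [chartm i (x' t)]surjective_pairing z1 z1'.
congr (chartv i (_, _)); apply: E => //; first by rewrite x'c.
- by move=> u cu uc; have [] := Hx1 c u (lexx c) cu uc.
- by move=> u cu uc; have [] := Hx1' c u (lexx c) cu uc.
- move=> s u cs su uc; have [_ _ _ h] := Hx1 s u cs su uc; apply: le_trans h _.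
  by rewrite ler_wpM2r// lerDl.
- move=> s u cs su uc; have [_ _ _ h] := Hx1' s u cs su uc; apply: le_trans h _.
  by rewrite ler_wpM2r// lerDr.
Qed.

(** Let [c] be the supremum of the times up to which the paths agree. They agree at [c] by
    continuity, and [davie_extend] leads past [c] unless [c = b]. *)
Lemma locally_davie_unique a b x x' : 0 <= a -> b <= T ->
  {within `[a, b]%classic, continuous x} -> {within `[a, b]%classic, continuous x'} ->
  locally_davie a b x -> locally_davie a b x' -> x a = x' a ->
  forall t, a <= t -> t <= b -> x t = x' t.
Proof.
move=> a0 bT cx cx' lx lx' xa t0 at0 t0b.
have ab : a <= b by exact: le_trans t0b.
pose S := [set c | [/\ a <= c, c <= b & forall t, a <= t -> t <= c -> x t = x' t]].
have Sa : S a.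
  by split => // t at_ ta; have -> : t = a by apply/eqP; rewrite eq_le at_ ta.
have Sub : ubound S b by move=> c [].
have hsS : has_sup S by split; [exists a|exists b].
pose c := sup S.
have ac : a <= c by apply: (ub_le_sup hsS.2).
have cb : c <= b by apply: (ge_sup _ Sub); exists a.
have below t : a <= t -> t < c -> x t = x' t.
  move=> at_ tc; have [c' [_ _ H] tc'] := sup_gt (ex_intro _ a Sa) tc.
  by apply: H => //; exact: ltW.
have xc : x c = x' c.
  have [ca|ac'] := leP c a; first by have -> : c = a by apply/eqP; rewrite eq_le ca ac.
  apply/eqP/negP => /negP; rewrite -mdist_gt0 => D0.
  set D := mdist _ _ in D0.
  have D20 : 0 < D / 2 by rewrite divr_gt0.
  have near_ball (y : M) : nbhs y [set y' | mdist y y' < D / 2].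
    by rewrite -ballEmdist; exact: nbhsx_ballx.
  have [h1 h10 H1] := within_window cx ac cb (near_ball _).
  have [h2 h20 H2] := within_window cx' ac cb (near_ball _).
  pose t := Num.max a (c - Num.min h1 h2).
  have at_ : a <= t by rewrite le_max lexx.
  have tc : t < c by rewrite gt_max ac' ltrBlDr ltrDl lt_min h10.
  have [th1 th2] : `|c - t| <= h1 /\ `|c - t| <= h2.
    have ctm : c - t <= Num.min h1 h2 by rewrite lerBlDl -lerBlDr le_max lexx orbT.
    have ct0 : 0 <= c - t by rewrite subr_ge0; exact: ltW.
    by rewrite ger0_norm//; split; apply: (le_trans ctm); rewrite ge_min lexx ?orbT.
  have tb := le_trans (ltW tc) cb.
  have := metric_triangle (x c) (x t) (x' c).
  have D1 : mdist (x c) (x t) < D / 2 by exact: H1.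
  have D2' : mdist (x t) (x' c) < D / 2 by rewrite below// metric_sym; exact: H2.
  by rewrite -/D leNgt; apply/negP/negPn; move: D1 D2'; lra.
have Sc : S c.
  split => // t at_; rewrite le_eqVlt => /orP[/eqP->//|]; exact: below.
have [bc|cltb] := leP b c; first by have [_ _] := Sc; apply => //; exact: le_trans bc.
have dx : dom (chart_at F (x c)) (x c) by rewrite /chart_at; case: cid.
have dx' : dom (chart_at F (x c)) (x' c) by rewrite -xc.
have [c' [cc' c'b H]] := davie_extend dx (le_trans a0 ac) cltb bT (esym xc)
  (fun rho => lx c _ rho ac cltb dx) (fun rho => lx' c _ rho ac cltb dx').
have : S c'.
  split => //; first exact: le_trans (ltW cc').
  by move=> t at_ tc'; have [tc|ct] := ltP t c; [exact: below|exact: H].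
by move/(ub_le_sup hsS.2); rewrite leNgt -/c cc'.
Qed.

Lemma plateau_window (a b : R) (x : R -> M) (tau : R) i (rho : R) :
  {within `[a, b]%classic, continuous x} -> a <= tau -> tau < b -> dom i (x tau) -> 0 < rho -> exists (P : set ('rV[R]_p * Z)) (h : R),
  [/\ 0 < h, open P, P `<=` img i,
    forall g : fn, CL 3 (img i) g -> exists2 f, CL_fun F 3 f & forall q, P q -> pullback i f q = g q &
    forall t, tau <= t -> t <= Num.min (tau + h) b ->
      [/\ dom i (x t), P (chartm i (x t)) & `|(chartm i (x t)).1 - (chartm i (x tau)).1| <= rho]].
Proof.
move=> cx at_ tb dx rho0; have [P [oP Px Pimg tests]] := plateau dx.
have nd : \forall y \near x tau, dom i y by apply: open_nbhs_nbhs; split => //; exact: chart_dom_open.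
have nP : \forall q \near chartm i (x tau), P q by exact: open_nbhs_nbhs.
have nr : \forall q \near chartm i (x tau), `|(chartm i (x tau)).1 - q.1| < rho.
  apply/nbhs_ballP; exists rho => // q [/= h1 _]; by move: h1; rewrite mx_norm_ball.
have [h h0 H] := within_window cx at_ (ltW tb) (filterI nd (filterI (chart_map_cont dx nP) (chart_map_cont dx nr))).
exists P, h; split => // t tt; rewrite le_min => /andP[th tb'].
have [|d' [/= P' r']] := H t (le_trans at_ tt) tb'.
  by rewrite distrC ger0_norm ?subr_ge0// lerBlDl.
by split => //; rewrite distrC; exact: ltW.
Qed.

Lemma height_constant (s0 t0 C : R) (z : R -> Z) : 0 <= C ->
  (forall s t, s0 <= s -> s <= t -> t <= t0 ->
    `|mdist (z s0) (z t) - mdist (z s0) (z s)| <= C * (t - s) `^ (3 * alpha)) ->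
  forall t, s0 <= t -> t <= t0 -> z t = z s0.
Proof.
move=> C0 H t st tt; have th1 : 1 < 3 * alpha by have := alpha_gt; lra.
have := @additive_constant R R^o (fun t => mdist (z s0) (z t)) s0 t0 (3 * alpha) C th1 C0 H s0 t (lexx _) st tt.
by rewrite mdistxx => /mdist_positivity.
Qed.

Lemma davie_path_of_coordinates i (rho s0 t0 : R) (x : R -> M) : 0 < rho ->
  (forall t, s0 <= t -> t <= t0 -> [/\ dom i (x t), (chartm i (x t)).2 = (chartm i (x s0)).2 &
      `|(chartm i (x t)).1 - (chartm i (x s0)).1| <= rho]) ->
  (forall l, exists2 C, 0 <= C & forall s t, s0 <= s -> s <= t -> t <= t0 ->
    `|(chartm i (x t)).1 0 l - (chartm i (x s)).1 0 l - \sum_j weight1 w s t j * c1 i j l (chartm i (x s))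
      - \sum_J weight2 w s t J * c2 i J l (chartm i (x s))| <= C * (t - s) `^ (3 * alpha)) ->
  davie_path i rho s0 t0 x.
Proof.
move=> rho0 win coords.
have [C HC] := choice2 coords.
have L0 : 0 <= \sum_l C l by apply: sumr_ge0 => l _; have [] := HC l.
exists (\sum_l C l) => // s t ss st tt.
have [dt zt rt] := win t (le_trans ss st) tt.
have [ds zs rs] := win s ss (le_trans st tt).
split => //; apply: mx_norm_le => [|a l]; first by rewrite mulr_ge0// powR_ge0.
rewrite ord1 {a}; have [C0 H] := HC l.
apply: le_trans (_ : C l * (t - s) `^ (3 * alpha) <= _); last first.
  rewrite ler_wpM2r ?powR_ge0// (bigD1 l)//= lerDl sumr_ge0// => j _; by have [] := HC j.
apply: le_trans (H s t ss st tt).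
rewrite !mxE -zs -surjective_pairing le_eqVlt; apply/orP; left; apply/eqP; congr `|_|; ring.
Qed.

Lemma locally_davie_of_expansion (a b : R) (x : R -> M) : {within `[a, b]%classic, continuous x} ->
  (forall f, CL_fun F 3 f -> exists2 C, 0 <= C & forall s t, a <= s -> s <= t -> t <= b ->
    `|f (x t) - f (x s) - \sum_i weight1 w s t i * vf_apply (V i) f (x s)
      - \sum_J weight2 w s t J * D2 f J (x s)| <= C * (t - s) `^ (3 * alpha)) ->
  locally_davie a b x.
Proof.
move=> cx expand tau i rho at_ tb dx rho0.
have [P [h [h0 oP Pimg tests win]]] := plateau_window cx at_ tb dx rho0.
exists h => //; set t0 := Num.min _ _ in win *.
have t0b : t0 <= b by rewrite ge_min lexx orbT.
have local (g : fn) : CL 3 (img i) g -> exists2 C, 0 <= C & forall s t, tau <= s -> s <= t -> t <= t0 ->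
    `|g (chartm i (x t)) - g (chartm i (x s)) - \sum_j weight1 w s t j * lie (c1 i j) g (chartm i (x s))
      - \sum_J weight2 w s t J * second_lie (c1 i) (c0 i) g J (chartm i (x s))| <= C * (t - s) `^ (3 * alpha).
  move=> CLg; have [f CLf fg] := tests g CLg; have [C C0 H] := expand f CLf; exists C => // s t ss st tt.
  have [dt Pt _] := win t (le_trans ss st) tt; have [ds Ps _] := win s ss (le_trans st tt).
  have := H s t (le_trans at_ ss) st (le_trans tt t0b).
  under eq_bigr do rewrite (plateau_apply oP CLf fg _ ds Ps).
  under [X in _ - X]eq_bigr do rewrite (plateau_second oP Pimg CLf fg _ ds Ps).
  by rewrite -[f (x t)](pullbackE f dt) -[f (x s)](pullbackE f ds) !fg.
(* The distance to the initial plaque has no leafwise derivatives. *)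
have CLz : CL 3 (img i) (fun q => mdist (chartm i (x tau)).2 q.2 : R^o).
  by apply: CL_snd => [|q _]; [exact: open_image|exact: mdist_continuous].
have [C C0 HC] := local _ CLz.
have zE : forall t, tau <= t -> t <= t0 -> (chartm i (x t)).2 = (chartm i (x tau)).2.
  apply: (@height_constant tau t0 C (fun t => (chartm i (x t)).2) C0) => s t ss st tt.
  have := HC s t ss st tt; rewrite !big1 ?subr0//.
    by move=> J _; rewrite second_lie_snd mulr0.
  by move=> j _; rewrite lie_snd mulr0.
apply: davie_path_of_coordinates => // [t st tt|l].
  by have [? _ ?] := win t st tt; split => //; exact: zE.
have [C' C'0 H] := local _ (CL_coord 3 (img i) l); exists C' => // s t ss st tt.
have := H s t ss st tt.
under eq_bigr do rewrite lie_coord.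
by under [X in _ - X]eq_bigr do rewrite second_lie_coord.
Qed.

End local_steps.

(** * Lipschitz drivers *)

Section RS_bounds.
Context {R : realType}.

(** The default value 0 of a non-existent integral obeys the bound as well. The lemma can thus be
    applied to an ODE solution before its integrands are known to be regular. *)
Lemma RS_integral_bound (F g : R -> R) (s t B k : R) : s <= t -> 0 <= B -> 0 <= k ->
  (forall u, s <= u -> u <= t -> `|F u| <= B) ->
  (forall u v, s <= u -> u <= v -> v <= t -> `|g v - g u| <= k * (v - u)) ->
  `|RS_integral F g s t| <= B * k * (t - s).
Proof.
move=> st B0 k0 FB gk; rewrite /RS_integral; case: xgetP => [I _ /= HI|_]; last first.
  by rewrite normr0 !mulr_ge0// subr_ge0.
apply/ler_addgt0Pr => e e0; have [delta d0 H] := HI e e0.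
have [pts part fine] := itv_partition_exists st d0.
pose P i := nth s (s :: pts) i.
have ge_s i : (i <= size pts)%N -> s <= P i.
  by move=> ip; rewrite /P (set_nth_default t)//; apply: itv_partition_nth_ge part.
have le_t i : (i <= size pts)%N -> P i <= t.
  by move=> ip; rewrite /P (set_nth_default t)//; apply: itv_partition_nth_le part.
have step i : (i < size pts)%N -> P i <= P i.+1.
  by move=> ip; apply: ltW; case: part => /(pathP s) + _; exact.
have /H : forall i, (i < size pts)%N -> nth s pts i - nth s (s :: pts) i < delta /\ nth s (s :: pts) i <= P i <= nth s pts i.
  by move=> i ip; split; [exact: fine|rewrite lexx; exact: step].
move=> /(_ part); set S := RS_sum _ _ _ _ _ => SI.
have SB : `|S| <= B * k * (t - s).
  apply: le_trans (ler_norm_sum _ _ _) _.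
  have <- : \sum_(i < size pts) (P i.+1 - P i) = t - s.
    rewrite -(big_mkord xpredT (fun i => P i.+1 - P i)) telescope_sumr// /P.
    by rewrite (itv_partition_nth_size s part).
  rewrite mulr_sumr; apply: ler_sum => i _; rewrite normrM -mulrA; apply: ler_pM => //.
    by apply: FB; [exact: ge_s i (ltnW (ltn_ord i))|exact: le_t i (ltnW (ltn_ord i))].
  by apply: gk; [exact: ge_s i (ltnW (ltn_ord i))|exact: step|exact: (le_t i.+1)].
rewrite -[I](subrK S) addrC; apply: le_trans (ler_normD _ _) _.
by apply: lerD => //; rewrite distrC; exact: ltW.
Qed.

Lemma powR_le_powR (h T r r' : R) : 0 <= h -> h <= T -> 0 < r -> r <= r' ->
  h `^ r' <= T `^ (r' - r) * h `^ r.
Proof.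
move=> h0 hT r0 rr; have -> : h `^ r' = h `^ (r' - r) * h `^ r.
  by rewrite -powRD subrK// gt_eqF//; exact: lt_le_trans rr.
by rewrite ler_wpM2r ?powR_ge0// le_powR// subr_ge0.
Qed.

End RS_bounds.

Section lipschitz_drivers.
Context {R : realType} {p d : nat} {M Z : metricType R}.
Variable F : foliated_space p M Z.
Variables (V0 : vector_field F) (V : 'I_d -> vector_field F).
Hypotheses (CLV0 : CL_vector_field 3 V0) (CLV : forall i, CL_vector_field 3 (V i)).
Variables (alpha T : R) (w : R * R -> 'rV[R]_d * 'M[R]_d).
Hypotheses (alpha_gt : 1 / 3 < alpha) (alpha_lt : alpha < 1 / 2).
Variable v : R -> 'rV[R]_d.
Hypothesis lip_v : lipschitz_path T v.
Hypothesis w_lift : forall s t, 0 <= s -> s <= t -> t <= T -> w (s, t) = natural_lift v (s, t).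
Local Notation chartm i := (chart_map (atlas (f:=F) i)).
Local Notation img i := (chart_image (atlas (f:=F) i)).
Local Notation fn := ('rV[R]_p * Z -> R^o).
Local Notation J2 := (option ('I_d * 'I_d)).
Local Notation c0 i := (drift_component V0 i).
Local Notation c1 i := (driving_component V i).
Local Notation c2 i := (second_coef (c1 i) (c0 i)).
Local Notation locally_davie := (locally_davie V0 V alpha w).

Let a0 : 0 < alpha. Proof. by have := alpha_gt; lra. Qed.
Let a3 : 0 < 3 * alpha. Proof. by rewrite mulr_gt0. Qed.

Lemma weight1_lift s t j : 0 <= s -> s <= t -> t <= T -> weight1 w s t j = v t 0 j - v s 0 j.
Proof. by move=> s0 st tT; rewrite /weight1 w_lift// !mxE. Qed.

Lemma square_le_powR s t : 0 <= s -> s <= t -> t <= T ->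
  (t - s) ^+ 2 <= T `^ (2 - 3 * alpha) * (t - s) `^ (3 * alpha).
Proof.
move=> s0 st tT; have h0 : 0 <= t - s by rewrite subr_ge0.
rewrite -powR_mulrn//; apply: powR_le_powR => //; first by move: s0 tT; lra.
by have := alpha_lt; lra.
Qed.

Let N : nat := (p + d + #|{: J2}|)%N.
Let pN : (p <= N)%N. Proof. by rewrite /N -addnA leq_addr. Qed.
Let ddN : (#|{: 'I_d * 'I_d}| <= N)%N.
Proof. by rewrite /N card_option; apply: leq_trans (leq_addl _ _); exact: leqnSn. Qed.

Lemma sum_const_bound (n : nat) (G : 'I_n -> R) c : (forall j, `|G j| <= c) -> `|\sum_j G j| <= n%:R * c.
Proof.
move=> H; apply: le_trans (ler_norm_sum _ _ _) _.
apply: le_trans (ler_sum _ (fun j _ => H j)) _.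
by rewrite sumr_const card_ord mulr_natl.
Qed.

(** A bootstrap: bounded integrands freeze the height and make the coordinates Lipschitz. The
    integrands are then Lipschitz too, the integrals exist, and they equal their one-point sums up
    to second order, which is better than 3 alpha. *)
Lemma ode_locally_davie (a b : R) m (x : R -> M) : 0 <= a -> b <= T ->
  ode_solution V0 V v a b m x -> locally_davie a b x.
Proof.
move=> a_ge0 bT [cx _ ode] tau i rho at_ tb dx rho0.
have [rhob [K [rhob0 K0 box]]] := box_exists CLV0 CLV dx.
pose r := Num.min rho (rhob / 2).
have r0 : 0 < r by rewrite lt_min rho0 divr_gt0.
have rrho : r <= rho by rewrite ge_min lexx.
have rrhob : r < rhob.
  have : r <= rhob / 2 by rewrite ge_min lexx orbT.
  by move/le_lt_trans; apply; lra.
have [P [h [h0 oP Pimg tests win]]] := plateau_window cx at_ tb dx r0.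
exists h => //; set t0 := Num.min _ _ in win *.
have t0b : t0 <= b by rewrite ge_min lexx orbT.
have t0T := le_trans t0b bT; have tau0 := le_trans a_ge0 at_.
pose q u := chartm i (x u).
have [k k0 vk] := lipschitz_pathP lip_v.
have vlip j s t : tau <= s -> s <= t -> t <= t0 -> `|v t 0 j - v s 0 j| <= k * (t - s).
  by move=> ss st tt; apply: vk => //; [exact: le_trans ss|exact: le_trans t0T].
have idlip s t : tau <= s -> s <= t -> t <= t0 -> `|t - s| <= 1 * (t - s).
  by move=> _ st _; rewrite mul1r ger0_norm// subr_ge0.
have local (g : fn) : CL 3 (img i) g -> exists (G : 'I_d -> R -> R) (G0 : R -> R),
  (forall u, tau <= u -> u <= t0 -> (forall j, G j u = lie (c1 i j) g (q u)) /\ G0 u = lie (c0 i) g (q u)) /\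
  forall s t, tau <= s -> s <= t -> t <= t0 -> g (q t) - g (q s) =
    \sum_j RS_integral (G j) (fun u => v u 0 j) s t + RS_integral G0 id s t.
  move=> CLg; have [f CLf fg] := tests g CLg.
  exists (fun j u => vf_apply (V j) f (x u)), (fun u => vf_apply V0 f (x u)); split.
    move=> u tu ut; have [du Pu _] := win u tu ut.
    by split => [j|]; exact: (plateau_apply oP CLf fg).
  move=> s t ss st tt; have [dt Pt _] := win t (le_trans ss st) tt; have [ds Ps _] := win s ss (le_trans st tt).
  by rewrite -!fg// !pullbackE// (ode f CLf)//; [exact: le_trans ss|exact: le_trans t0b].
have increment G G0 (B : R) : 0 <= B -> (forall u, tau <= u -> u <= t0 -> (forall j, `|G j u| <= B) /\ `|G0 u| <= B) ->
    forall s t, tau <= s -> s <= t -> t <= t0 ->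
    `|\sum_(j < d) RS_integral (G j) (fun u => v u 0 j) s t + RS_integral G0 id s t| <= B * (d%:R * k + 1) * (t - s).
  move=> B0 GB s t ss st tt; apply: le_trans (ler_normD _ _) _.
  have E1 j : `|RS_integral (G j) (fun u => v u 0 j) s t| <= B * k * (t - s).
    apply: RS_integral_bound => // [u su ut|u u' su uu ut].
      by have [] := GB u (le_trans ss su) (le_trans ut tt).
    by apply: vlip => //; [exact: le_trans su|exact: le_trans tt].
  have E2 : `|RS_integral G0 id s t| <= B * 1 * (t - s).
    apply: RS_integral_bound => // [u su ut|u u' su uu ut].
      by have [] := GB u (le_trans ss su) (le_trans ut tt).
    by apply: idlip => //; [exact: le_trans su|exact: le_trans tt].
  apply: le_trans (lerD (sum_const_bound E1) E2) _.
  rewrite le_eqVlt; apply/orP; left; apply/eqP; ring.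
have CLz : CL 3 (img i) (fun q' => mdist (q tau).2 q'.2 : R^o).
  by apply: CL_snd => [|q' _]; [exact: open_image|exact: mdist_continuous].
have zE : forall t, tau <= t -> t <= t0 -> (q t).2 = (q tau).2.
  have [G [G0 [GE H]]] := local _ CLz.
  apply: (@height_constant R Z alpha alpha_gt tau t0 0 (fun t => (q t).2) (lexx 0)) => s t ss st tt.
  rewrite (H s t ss st tt) mul0r.
  (* The leafwise derivatives of the distance vanish, so the integrands are bounded by 0 and the
     distance has zero increments. *)
  have := increment G G0 0 (lexx 0) _ s t ss st tt; rewrite !mul0r; apply.
  by move=> u tu ut; have [E1 E2] := GE u tu ut; split => [j|]; rewrite ?E1 ?E2 lie_snd normr0.
set z := (q tau).2 in zE; set ystar := (q tau).1.
pose B := [set y : 'rV[R]_p | `|y - ystar| <= r].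
have Bconv y1 y2 t : B y1 -> B y2 -> 0 <= t -> t <= 1 -> B (y1 + t *: (y2 - y1)).
  exact: norm_ball_convex.
have boxB y : B y -> [/\ img i (y, z),
      forall j l (s : seq 'I_p), (size s <= 3)%N -> `|iter_partial s (c1 i j l) (y, z)| <= K &
      forall J l (s : seq 'I_p), (size s <= 2)%N -> `|iter_partial s (c2 i J l) (y, z)| <= K].
  move=> By; apply: box; last by rewrite mdistxx.
  by rewrite distrC; exact: le_lt_trans By _.
have BU y : B y -> img i (y, z) by move=> /boxB[].
have bw1 j l : bounded_words z B 1 (c1 i j l) K.
  move=> s sk y By; have [_ + _] := boxB y By; apply; exact: leq_trans sk _.
have bw2 J l : bounded_words z B 1 (c2 i J l) K.
  move=> s sk y By; have [_ _] := boxB y By; apply; exact: leq_trans sk _.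
have qB u : tau <= u -> u <= t0 -> B (q u).1 by move=> tu ut; have [_ _] := win u tu ut.
have qE u : tau <= u -> u <= t0 -> q u = ((q u).1, z).
  by move=> tu ut; rewrite -(zE u tu ut) -surjective_pairing.
pose D := K * (d%:R * k + 1).
have D0 : 0 <= D by rewrite mulr_ge0// addr_ge0// mulr_ge0.
have c1K j l u : tau <= u -> u <= t0 -> `|c1 i j l (q u)| <= K.
  by move=> tu ut; rewrite qE//; exact: (bounded_words0 (bw1 j l) (qB u tu ut)).
have c2K J l u : tau <= u -> u <= t0 -> `|c2 i J l (q u)| <= K.
  by move=> tu ut; rewrite qE//; exact: (bounded_words0 (bw2 J l) (qB u tu ut)).
have ylip s t : tau <= s -> s <= t -> t <= t0 -> `|(q t).1 - (q s).1| <= D * (t - s).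
  move=> ss st tt; apply: mx_norm_le => [|e l]; first by rewrite mulr_ge0// subr_ge0.
  rewrite ord1 {e}; have [G [G0 [GE H]]] := local _ (CL_coord 3 (img i) l).
  have := H s t ss st tt; rewrite !mxE => ->; apply: increment => // u tu ut.
  by have [E1 E2] := GE u tu ut; split => [j|]; rewrite ?E1 ?E2 lie_coord; [exact: c1K|exact: (c2K None)].
have clip (c : fn) : CL 1 (img i) c -> bounded_words z B 1 c K ->
    forall s t, tau <= s -> s <= t -> t <= t0 -> `|c (q t) - c (q s)| <= N%:R * K * D * (t - s).
  move=> CLc bc s t ss st tt; have tt' := le_trans ss st; have ss' := le_trans st tt.
  rewrite qE// [in c (q s)]qE//.
  apply: le_trans (box_lipschitz (@open_image _ _ _ _ F i) pN Bconv BU K0 CLc bc (qB s ss ss') (qB t tt' tt)) _.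
  by rewrite -[leRHS]mulrA ler_wpM2l ?mulr_ge0//; exact: ylip.
have NKD0 : 0 <= N%:R * K * D by exact: (mulr_ge0 (mulr_ge0 (ler0n _ _) K0) D0).
have [L1 L10 int1] := RS_integral_lipschitz NKD0 k0.
have [L2 L20 int2] := RS_integral_lipschitz NKD0 (ler01 : 0 <= (1 : R)).
have [C2 C20 w2C] := lift_square_bound lip_v.
apply: davie_path_of_coordinates => // [t st tt|l].
  by have [? _ hr] := win t st tt; split => //; [exact: zE|exact: le_trans rrho].
have T0 : 0 <= T `^ (2 - 3 * alpha) by exact: powR_ge0.
pose Q := d%:R * L1 + L2 + N%:R * (C2 * K).
have Q0 : 0 <= Q.
  exact: (addr_ge0 (addr_ge0 (mulr_ge0 (ler0n _ _) L10) L20) (mulr_ge0 (ler0n _ _) (mulr_ge0 C20 K0))).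
exists (Q * T `^ (2 - 3 * alpha)); first exact: mulr_ge0.
move=> s t ss st tt; have s0 := le_trans tau0 ss; have tT := le_trans tt t0T; have st0 := le_trans st tt.
rewrite -mulrA; apply: le_trans (ler_wpM2l Q0 (square_le_powR s0 st tT)).
have [G [G0 [GE H]]] := local _ (CL_coord 3 (img i) l).
have GE1 j u : tau <= u -> u <= t0 -> G j u = c1 i j l (q u).
  by move=> tu ut; have [E1 _] := GE u tu ut; rewrite E1 lie_coord.
have GE0 u : tau <= u -> u <= t0 -> G0 u = c2 i None l (q u).
  by move=> tu ut; have [_ E2] := GE u tu ut; rewrite E2 lie_coord.
have tau_t0 : tau <= t0 by exact: le_trans ss st0.
have I1 j : `|RS_integral (G j) (fun u => v u 0 j) s t - weight1 w s t j * c1 i j l (q s)| <= L1 * (t - s) ^+ 2.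
  have [||y Hy] := int1 (G j) (fun u => v u 0 j) tau t0 tau_t0.
  - move=> u u' tu uu ut; rewrite !GE1 ?(le_trans tu uu) ?(le_trans uu ut)//; apply: (clip (c1 i j l)) => //.
    exact: CL_le (CL_c1 CLV i j l).
  - by move=> u u' tu uu ut; exact: vlip.
  have [_ -> ] := Hy s t ss st tt.
  by rewrite weight1_lift// GE1// mulrC.
have I0 : `|RS_integral G0 id s t - (t - s) * c2 i None l (q s)| <= L2 * (t - s) ^+ 2.
  have [||y Hy] := int2 G0 id tau t0 tau_t0.
  - move=> u u' tu uu ut; rewrite !GE0 ?(le_trans tu uu) ?(le_trans uu ut)//; apply: (clip (c2 i None l)) => //.
    exact: CL_le (CL_c2 CLV0 CLV i None l).
  - by move=> u u' tu uu ut; exact: idlip.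
  have [_ -> ] := Hy s t ss st tt.
  by rewrite GE0// mulrC.
rewrite (H s t ss st tt) sum_option /=.
(* For a Lipschitz driver the second-level part of the step is itself an error term, quadratic in
   [t - s]. *)
rewrite (_ : _ - _ - _ = \sum_j (RS_integral (G j) (fun u => v u 0 j) s t - weight1 w s t j * c1 i j l (q s)) +
  (RS_integral G0 id s t - (t - s) * c2 i None l (q s)) -
  \sum_jk weight2 w s t (Some jk) * c2 i (Some jk) l (q s)); last first.
  by rewrite sumrB /q /weight2 /=; ring.
apply: le_trans (ler_normB _ _) _; rewrite /Q [leRHS]mulrDl; apply: lerD.
  apply: le_trans (ler_normD _ _) _; rewrite [leRHS]mulrDl; apply: lerD => //.
  by rewrite -mulrA; exact: sum_const_bound.
rewrite -mulrA [C2 * K * _]mulrAC; apply: (dot_le ddN) => // [[j1 k1]|jk|].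
- by rewrite /= w_lift//; exact: w2C.
- exact: c2K.
- by rewrite mulr_ge0// exprn_ge0// subr_ge0.
Qed.

End lipschitz_drivers.

(** * Comparison of RDE and ODE solutions *)

Section solutions.
Context {R : realType} {p d : nat} {M Z : metricType R}.
Variable F : foliated_space p M Z.
Variables (V0 : vector_field F) (V : 'I_d -> vector_field F).
Hypotheses (CLV0 : CL_vector_field 3 V0) (CLV : forall i, CL_vector_field 3 (V i)).
Variables (alpha T Kw : R) (w : R * R -> 'rV[R]_d * 'M[R]_d).
Hypotheses (alpha_gt : 1 / 3 < alpha) (alpha_lt : alpha < 1 / 2).
Hypothesis wg : weakly_geometric alpha T w Kw.
Local Notation D2 := (second_apply V0 V).
Local Notation strong := (strong_solution V0 V alpha w).
Local Notation locally_davie := (locally_davie V0 V alpha w).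

Lemma expansion_sums (f : M -> R) (x : R -> M) s t :
  f (x t) - f (x s) - \sum_(i < d) vf_apply (V i) f (x s) * (w (s, t)).1 0 i
    - \sum_(j < d) \sum_(k < d) vf_apply (V j) (vf_apply (V k) f) (x s) * (w (s, t)).2 j k
    - vf_apply V0 f (x s) * (t - s) =
  f (x t) - f (x s) - \sum_i weight1 w s t i * vf_apply (V i) f (x s)
    - \sum_J weight2 w s t J * D2 f J (x s).
Proof.
rewrite sum_option /= pair_bigA /=.
under eq_bigr do rewrite mulrC.
under [X in _ - _ - X - _ = _]eq_bigr do rewrite mulrC.
rewrite opprD addrA [in RHS]addrAC mulrC.
congr (_ - _ - _); apply: eq_bigr => -[j k] _ //.
Qed.

Lemma strong_rde_solution a b m x : x a = m -> strong a b x -> rde_solution V0 V alpha w a b m x.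
Proof.
move=> xa sx; split => //; first exact: strong_continuous sx.
move=> f CLf; have [_ _ /(_ f CLf)[C _ H]] := sx; exists C => s t as_ st tb.
by rewrite expansion_sums [`|t - s|]ger0_norm ?subr_ge0//; exact: H.
Qed.

Lemma rde_locally_davie a b m x : rde_solution V0 V alpha w a b m x -> locally_davie a b x.
Proof.
move=> [cx _ expand]; apply: locally_davie_of_expansion => // f CLf.
(* The constant in [rde_solution] has no prescribed sign. *)
have [C H] := expand f CLf; exists `|C| => // s t as_ st tb.
rewrite -expansion_sums; apply: le_trans (H s t as_ st tb) _.
by rewrite [`|t - s|]ger0_norm ?subr_ge0// ler_wpM2r ?powR_ge0// ler_norm.
Qed.

Variable v : R -> 'rV[R]_d.
Hypothesis lip_v : lipschitz_path T v.
Hypothesis w_lift : forall s t, 0 <= s -> s <= t -> t <= T -> w (s, t) = natural_lift v (s, t).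

Let a0 : 0 < alpha. Proof. by have := alpha_gt; lra. Qed.
Let a3 : 0 < 3 * alpha. Proof. by rewrite mulr_gt0. Qed.

Lemma strong_ode_solution a b m x : 0 <= a -> a <= b -> b <= T -> x a = m -> strong a b x ->
  ode_solution V0 V v a b m x.
Proof.
move=> a_ge0 ab bT xa sx; split => //; first exact: strong_continuous sx.
move=> f CLf; have [E1 _ /(_ f CLf)[C C0 HC]] := sx.
have [k k0 vk] := lipschitz_pathP lip_v.
have CLf2 : CL_fun F 2 f by exact: CL_fun_le CLf.
have E1' (U : vector_field F) : CL_vector_field 3 U -> exists2 C, 0 <= C &
    forall s t, a <= s -> s <= t -> t <= b -> `|vf_apply U f (x t) - vf_apply U f (x s)| <= C * (t - s) `^ alpha.
  by move=> CLU; apply: E1; exact: (CL_vf_apply (k := 1) isT CLU CLf2).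
pose T1 := T `^ ((1 + alpha) - 3 * alpha).
have T10 : 0 <= T1 by exact: powR_ge0.
have prim (U : vector_field F) (g : R -> R) c : 0 <= c -> CL_vector_field 3 U ->
    (forall s t, a <= s -> s <= t -> t <= b -> `|g t - g s| <= c * (t - s)) ->
    exists2 Ly : R * (R -> R), 0 <= Ly.1 & forall s t, a <= s -> s <= t -> t <= b ->
      RS_integral (fun u => vf_apply U f (x u)) g s t = Ly.2 t - Ly.2 s /\
      `|Ly.2 t - Ly.2 s - vf_apply U f (x s) * (g t - g s)| <= Ly.1 * (t - s) `^ (3 * alpha).
  move=> c_ge0 CLU gc; have [C' C'0 HU] := E1' U CLU.
  have [L L0 H] := RS_primitive a0 C'0 c_ge0.
  have [y Hy] := H (fun u => vf_apply U f (x u)) g a b ab HU gc.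
  exists (L * T1, y); first exact: mulr_ge0.
  move=> s t as_ st tb; have [_ -> E] := Hy s t as_ st tb; split => //.
  apply: le_trans E _; rewrite -mulrA ler_wpM2l//; apply: powR_le_powR => //.
  - by rewrite subr_ge0.
  - by move: (le_trans a_ge0 as_) (le_trans tb bT); lra.
  - by have := alpha_lt; lra.
have vlip j s t : a <= s -> s <= t -> t <= b -> `|v t 0 j - v s 0 j| <= k * (t - s).
  by move=> ss st tt; apply: vk => //; [exact: le_trans ss|exact: le_trans bT].
have idlip s t : a <= s -> s <= t -> t <= b -> `|id t - id s| <= 1 * (t - s).
  by move=> _ st _; rewrite mul1r ger0_norm// subr_ge0.
have [[L0 y0] /= L00 Hy0] := prim V0 id 1 ler01 CLV0 idlip.
have [LY HLY] := choice2 (fun j => prim (V j) (fun u => v u 0 j) k k0 (CLV j) (vlip j)).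
have [C2 C20 w2C] := lift_square_bound lip_v.
have bnd jk : exists2 B, 0 <= B & forall s, a <= s -> s <= b -> `|D2 f (Some jk) (x s)| <= B.
  have [C' C'0 H] := E1 _ (CL_second_apply CLV0 CLV (Some jk) CLf).
  exists (`|D2 f (Some jk) (x a)| + C' * (b - a) `^ alpha); first by rewrite addr_ge0// mulr_ge0// powR_ge0.
  move=> s as_ sb; rewrite -[D2 f (Some jk) (x s)](subrK (D2 f (Some jk) (x a))) addrC.
  apply: le_trans (ler_normD _ _) _; rewrite lerD2l; apply: le_trans (H a s (lexx a) as_ sb) _.
  by rewrite ler_wpM2l// le_powR ?(ltW a0) ?subr_ge0 ?lerD2r.
have [B HB] := choice2 bnd.
have BB0 : 0 <= \sum_jk B jk by apply: sumr_ge0 => jk _; have [] := HB jk.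
have Ble jk : B jk <= \sum_jk B jk by rewrite (bigD1 jk)//= lerDl sumr_ge0// => j _; have [] := HB j.
have LL0 : 0 <= \sum_j (LY j).1 by apply: sumr_ge0 => j _; have [] := HLY j.
pose T2 := T `^ (2 - 3 * alpha); have T20 : 0 <= T2 by exact: powR_ge0.
pose n : R := #|{: 'I_d * 'I_d}|%:R.
have CC0 : 0 <= n * (C2 * T2 * \sum_jk B jk) by exact: (mulr_ge0 (ler0n _ _) (mulr_ge0 (mulr_ge0 C20 T20) BB0)).
(* [z] is the difference of the two sides of the integral equation, up to a constant. All its
   increments are of order 3 alpha > 1, so [additive_constant] applies. *)
pose z t : R^o := f (x t) - \sum_j (LY j).2 t - y0 t.
have th1 : 1 < 3 * alpha by have := alpha_gt; lra.
have zE : forall s t, a <= s -> s <= t -> t <= b -> z t = z s.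
  apply: (@additive_constant R R^o z a b (3 * alpha)
    (C + \sum_j (LY j).1 + L0 + n * (C2 * T2 * \sum_jk B jk)) th1).
    by rewrite !addr_ge0.
  move=> s t as_ st tb; have s0 := le_trans a_ge0 as_; have tT := le_trans tb bT.
  set h3 := (t - s) `^ (3 * alpha).
  have h30 : 0 <= h3 by exact: powR_ge0.
  rewrite (_ : z t - z s = (f (x t) - f (x s) - \sum_i weight1 w s t i * vf_apply (V i) f (x s)
      - \sum_J weight2 w s t J * D2 f J (x s))
    - \sum_j ((LY j).2 t - (LY j).2 s - vf_apply (V j) f (x s) * (v t 0 j - v s 0 j))
    - (y0 t - y0 s - vf_apply V0 f (x s) * (t - s))
    + \sum_jk weight2 w s t (Some jk) * D2 f (Some jk) (x s)); last first.
    rewrite sum_option !sumrB /= /z.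
    under eq_bigr do rewrite (weight1_lift w_lift _ s0 st tT) mulrC.
    ring.
  rewrite !mulrDl.
  apply: le_trans (ler_normD _ _) _; apply: lerD; last first.
    apply: le_trans (dot_le (X := C2 * T2 * h3) (Y := \sum_jk B jk) (leqnn _) _ _ _ _) _.
    - move=> [j1 k1]; rewrite /= w_lift//; apply: le_trans (w2C s t j1 k1 s0 st tT) _.
      by rewrite -mulrA ler_wpM2l//; exact: square_le_powR.
    - by move=> jk; apply: le_trans (Ble jk); have [_] := HB jk; apply => //; exact: le_trans tb.
    - exact: (mulr_ge0 (mulr_ge0 C20 T20) h30).
    - exact: BB0.
    by rewrite /n le_eqVlt; apply/orP; left; apply/eqP; ring.
  apply: le_trans (ler_normB _ _) _; apply: lerD; last by have [] := Hy0 s t as_ st tb.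
  apply: le_trans (ler_normB _ _) _; apply: lerD; first exact: HC.
  apply: le_trans (ler_norm_sum _ _ _) _; rewrite mulr_suml; apply: ler_sum => j _.
  by have [_ /(_ s t as_ st tb)[]] := HLY j.
move=> s t as_ st tb; have := zE s t as_ st tb; rewrite /z.
have [-> _] := Hy0 s t as_ st tb.
have -> : \sum_i RS_integral (fun u => vf_apply (V i) f (x u)) (fun u => v u 0 i) s t =
    \sum_i ((LY i).2 t - (LY i).2 s).
  by apply: eq_bigr => j _; have [_ /(_ s t as_ st tb)[]] := HLY j.
rewrite sumrB => H.
have -> : f (x t) = f (x t) - \sum_i (LY i).2 t - y0 t + \sum_i (LY i).2 t + y0 t by ring.
by rewrite H; ring.
Qed.

End solutions.

Theorem proposition4p6 (R : realType) (p d : nat) (M Z : metricType R)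
    (F : foliated_space p M Z) (alpha T a b : R)
    (w : R * R -> 'rV[R]_d * 'M[R]_d)
    (V0 : vector_field F) (V : 'I_d -> vector_field F) :
  1 / 3 < alpha -> alpha < 1 / 2 -> 0 < T ->
  geometric_rough_path alpha T w ->
  0 <= a -> a <= b -> b <= T ->
  compact [set: M] ->
  CL_vector_field 3 V0 -> (forall i, CL_vector_field 3 (V i)) ->
  forall m : M, exists x : R -> M,
    [/\ rde_solution V0 V alpha w a b m x,
        (forall y, rde_solution V0 V alpha w a b m y ->
           forall t, a <= t -> t <= b -> y t = x t) &
        (forall v : R -> 'rV[R]_d, lipschitz_path T v ->
           (forall s t, 0 <= s -> s <= t -> t <= T ->
              w (s, t) = natural_lift v (s, t)) ->
           ode_solution V0 V v a b m x /\
           (forall y, ode_solution V0 V v a b m y ->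
              forall t, a <= t -> t <= b -> y t = x t))].
Proof.
move=> alpha_gt alpha_lt T0 wgeo a_ge0 ab bT compM CLV0 CLV m.
have alpha0 : 0 < alpha by lra.
have [Kw wg] := geometric_rough_pathP alpha0 wgeo.
have [x xa sx] := global_existence CLV0 CLV alpha_gt alpha_lt wg compM m a_ge0 ab bT.
have rx := strong_rde_solution alpha_gt xa sx.
have cont y : rde_solution V0 V alpha w a b m y -> {within `[a, b]%classic, continuous y} by case.
(* A competitor is used only through [locally_davie], so this one statement serves both the RDE and
   the ODE. *)
have unique y : {within `[a, b]%classic, continuous y} -> y a = m ->
    locally_davie V0 V alpha w a b y -> forall t, a <= t -> t <= b -> y t = x t.
  move=> cy ya ly; apply: (locally_davie_unique CLV0 CLV alpha_gt alpha_lt wg a_ge0 bT cy (cont x rx) ly).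
    exact: (rde_locally_davie CLV alpha_gt rx).
  by rewrite xa.
exists x; split => //.
- move=> y ry; have [cy ya _] := ry; apply: unique => //; exact: (rde_locally_davie CLV alpha_gt ry).
- move=> v lip_v w_lift; split.
    exact: (strong_ode_solution CLV0 CLV alpha_gt alpha_lt lip_v w_lift).
  move=> y oy; have [cy ya _] := oy; apply: unique => //.
  exact: (ode_locally_davie CLV0 CLV alpha_gt alpha_lt lip_v w_lift a_ge0 bT oy).
Qed.
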